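(* Let $L_1,L_2$ be positive integers, $p_1,p_2>2$ and $1<r<2$ with $1/p_1+1/p_2=1/r$. There exists a constant $C$ independent of $f_1,f_2,M_1,M_2,m$ such that for all integers $M_1,M_2$ and all integers $m\ge1$, $$\big\|\Pi_{L_1,L_2,M_1,M_2,m}(f_1,f_2)\big\|_r\le Cm\|f_1\|_{p_1}\|f_2\|_{p_2}$$ holds for all $f_1\in L^{p_1}(\mathbb R)$ and $f_2\in L^{p_2}(\mathbb R)$.
   Context: $\widehat f(\xi)=\int f(x)e^{-2\pi i x\xi}\,dx$. Let $\Phi_1$ be a fixed Schwartz function whose Fourier transform is a standard (smooth) bump function supported on $[1/2,2]$. For $\ell\in\{1,2\}$ and $j\in\mathbb Z$, define $\Phi_{\ell,j,m}$ by $$\widehat\Phi_{\ell,j,m}(\xi)=e^{2\pi i 2^m\,\xi/2^{L_\ell j+M_\ell}}\;\widehat\Phi_1\Big(\frac{\xi}{2^{L_\ell j+M_\ell}}\Big),$$ set $f_{\ell,j,m}=f_\ell*\Phi_{\ell,j,m}$, and $$\Pi_{L_1,L_2,M_1,M_2,m}(f_1,f_2)(x)=\sum_{j\in\mathbb Z}\ \prod_{\ell=1}^2 f_{\ell,j,m}(x).$$ *)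

(* Defs.v *)
From HB Require Import structures.
From mathcomp Require Import all_boot all_order all_algebra.
From mathcomp Require Import all_classical all_reals all_analysis.
From mathcomp Require Import complex.

Set Implicit Arguments.
Unset Strict Implicit.
Unset Printing Implicit Defensive.

Import Order.TTheory GRing.Theory Num.Theory.
Import numFieldNormedType.Exports.

Local Open Scope classical_set_scope.
Local Open Scope ring_scope.
Local Open Scope complex_scope.

(* The library has no topology or sigma-algebra on R[i]: differentiation,
   integration, measurability and limits of complex-valued functions of a real
   variable are all taken on real and imaginary parts. *)
Section Defs.
Variable R : realType.
Local Notation mu := (@lebesgue_measure R).

Definition cabs (z : R[i]) : R := ComplexField.Normc.normc z.

(* e^{it} *)
Definition expi (t : R) : R[i] := cos t +i* sin t.

Definition cintegral (f : R -> R[i]) : R[i] :=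
  (\int[mu]_x complex.Re (f x))%R +i* (\int[mu]_x complex.Im (f x))%R.

Definition smooth (f : R -> R) : Prop :=
  forall (n : nat) (x : R), derivable (derive1n n f) x 1.

Definition cderiven (n : nat) (f : R -> R[i]) (x : R) : R[i] :=
  derive1n n (fun y => complex.Re (f y)) x +i* derive1n n (fun y => complex.Im (f y)) x.

Definition schwartz (f : R -> R[i]) : Prop :=
  [/\ smooth (fun x => complex.Re (f x)), smooth (fun x => complex.Im (f x)) &
      forall a n : nat, exists C : R,
        forall x : R, `|x| ^+ a * cabs (cderiven n f x) <= C].

Definition fourier (f : R -> R[i]) (xi : R) : R[i] :=
  cintegral (fun x => f x * expi (- (2 * pi * x * xi))).

Definition bump_on (a b : R) (g : R -> R) : Prop :=
  smooth g /\ forall xi, xi \notin `[a, b] -> g xi = 0.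

Definition is_mother (Phi : R -> R[i]) : Prop :=
  schwartz Phi /\
  exists2 g : R -> R, bump_on 2^-1 2 g & forall xi, fourier Phi xi = (g xi)%:C.

(* Phi' = Phi_{l,j,m}, where L = L_l and M = M_l; a Schwartz function is
   determined by its Fourier transform. *)
Definition is_shifted_dilate (Phi : R -> R[i]) (L : nat) (M : int) (m : nat)
    (j : int) (Phi' : R -> R[i]) : Prop :=
  schwartz Phi' /\
  forall xi : R,
    let s := (2 : R) ^ (L%:Z * j + M) in
    fourier Phi' xi = expi (2 * pi * 2 ^+ m * (xi / s)) * fourier Phi (xi / s).

Definition convol (f g : R -> R[i]) (x : R) : R[i] :=
  cintegral (fun y => f y * g (x - y)).

Definition cLnorm (p : R) (f : R -> R[i]) : \bar R :=
  Lnorm mu p%:E (fun x => (cabs (f x))%:E).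

Definition in_Lp (p : R) (f : R -> R[i]) : Prop :=
  [/\ measurable_fun [set: R] (fun x => complex.Re (f x)),
      measurable_fun [set: R] (fun x => complex.Im (f x)) &
      (cLnorm p f < +oo)%E].

Definition abs_summable (a : int -> R[i]) : Prop :=
  summable [set: int] (fun j => (cabs (a j))%:E).

(* Limit of the sums over -n <= j <= n; only meaningful where the series
   converges, e.g. under abs_summable, in which case it is the unordered sum. *)
Definition sumZ (a : int -> R[i]) : R[i] :=
  let S (n : nat) := \sum_(k < n.*2.+1) a (k%:Z - n%:Z) in
  limn (fun n => complex.Re (S n)) +i* limn (fun n => complex.Im (S n)).

Definition Pi_term (Phi1 Phi2 : int -> R -> R[i]) (f1 f2 : R -> R[i]) (x : R)
    (j : int) : R[i] :=
  convol f1 (Phi1 j) x * convol f2 (Phi2 j) x.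

Definition Pi_op (Phi1 Phi2 : int -> R -> R[i]) (f1 f2 : R -> R[i]) (x : R)
    : R[i] :=
  sumZ (Pi_term Phi1 Phi2 f1 f2 x).

End Defs.

(* Main.v *)
(* By uniqueness of the Fourier transform, Phi_{l,j,m}(x) = s Phi(s x + 2^m) with
   s = 2^(L_l j + M_l); beyond that, only the decay and smoothness of Phi and its
   vanishing integral matter.  Cut Phi into Lipschitz pieces of mean zero, the n-th
   one living near n with size O((1 + n^2)^-2).  At a point of a dyadic interval I of
   length 1/s, convolution with Phi_{l,j,m} becomes a sum over n of pairings with
   atoms adapted to the translate of I by about 2^m - n times its length.  Atoms are
   almost orthogonal, and the dyadic maximal function composed with a translation by
   N intervals is of weak type (1,1) with constant O(log(2 + |N|)), here at most
   O(m + |n|).  Applied on the level sets of a weight w in L^q with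
   1/q + 2/p = 1, these two facts bound a weighted square sum by O(m) ||f||_p^2 ||w||_q,
   and duality turns this into O(m^(1/2)) ||f||_p for the L^p norm of the square
   function (sum_j |f_{l,j,m}|^2)^(1/2).  Cauchy-Schwarz in j and Hoelder in x then
   give the factor m^(1/2) m^(1/2) = m. *)

Require Import Defs.
From HB Require Import structures.
From mathcomp Require Import all_boot all_order all_algebra.
From mathcomp Require Import all_classical all_reals all_analysis.
From mathcomp Require Import complex.
From mathcomp Require Import measurable_realfun ring lra zify.
Import Order.TTheory GRing.Theory Num.Theory.
Import numFieldNormedType.Exports.
Local Open Scope classical_set_scope.
Local Open Scope ring_scope.

Set Implicit Arguments.
Unset Strict Implicit.
Unset Printing Implicit Defensive.

(** * Integrals of real functions on the line: affine substitution and Hoelder *)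

Section RealIntegral.
Variable R : realType.
Local Notation mu := (@lebesgue_measure R).
Implicit Types f g : R -> R.

(** Since p > 2, the square function can be tested against weights in the dual of L^(p/2), so no
    Calderon-Zygmund theory enters: L^2 orthogonality acts on each superlevel set of the averaged
    weight, and the maximal function measures these sets. Two difficulties shape the details: the
    absorption arguments need integrals that are finite beforehand, and neither the square function
    nor the bilinear series comes with measurability or convergence. Therefore every estimate
    concerns a finite family of dyadic intervals, with constants that do not depend on the family,
    and the convolutions are evaluated at one point [pt I] per interval. An atom seen from any point
    of an interval is adapted to the same translate of that interval, so the bounds are uniform in
    the choice of points; nearly maximal points then give step functions above the square function.
    A single monotone limit at the end produces a measurable envelope, and its finiteness almost
    everywhere yields the absolute convergence of the series. *)

Definition integ f := mu.-integrable setT (EFin \o f).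
Definition Int f : R := (\int[mu]_x f x)%R.

Lemma integ_mf f : integ f -> measurable_fun setT f.
Proof. by move=> /measurable_int /measurable_EFinP. Qed.

Lemma integ_le f g : measurable_fun setT f -> (forall x, `|f x| <= g x) ->
  integ g -> integ f.
Proof.
move=> mf fg; apply: le_integrable => //; first exact/measurable_EFinP.
by move=> x _ /=; rewrite lee_fin (le_trans (fg x))// ler_norm.
Qed.

Lemma integD f g : integ f -> integ g -> integ (fun x => f x + g x).
Proof. by move=> h1 h2; apply: (integrableD measurableT h1 h2). Qed.

Lemma integB f g : integ f -> integ g -> integ (fun x => f x - g x).
Proof. by move=> h1 h2; apply: (integrableB measurableT h1 h2). Qed.

Lemma integZ c f : integ f -> integ (fun x => c * f x).
Proof. by move=> h; apply: (integrableZl measurableT c h). Qed.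

Lemma integ0 : integ (fun=> 0).
Proof. exact: integrable0. Qed.

Lemma integ_sum (J : Type) (s : seq J) (F : J -> R -> R) :
  (forall j, integ (F j)) -> integ (fun x => \sum_(j <- s) F j x).
Proof.
move=> h; elim: s => [|j s ih].
  by under [X in integ X]funext do rewrite big_nil; exact: integ0.
by under [X in integ X]funext do rewrite big_cons; exact: integD.
Qed.

Lemma integ_norm f : integ f -> integ (fun x => `|f x|).
Proof.
move=> h; apply: (integ_le (g := fun x => `|f x|)) => [|x|].
- by apply: measurableT_comp => //; exact: integ_mf.
- by rewrite normr_id.
- exact: (integrable_abse h).
Qed.

Lemma IntD f g : integ f -> integ g -> Int (fun x => f x + g x) = Int f + Int g.
Proof. exact: RintegralD. Qed.

Lemma IntB f g : integ f -> integ g -> Int (fun x => f x - g x) = Int f - Int g.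
Proof. exact: RintegralB. Qed.

Lemma IntZ c f : integ f -> Int (fun x => c * f x) = c * Int f.
Proof. by move=> h; apply: RintegralZl. Qed.

Lemma Int0 : Int (fun=> 0) = 0.
Proof. by rewrite /Int /Rintegral integral0. Qed.

Lemma Int_sum (J : Type) (s : seq J) (F : J -> R -> R) :
  (forall j, integ (F j)) ->
  Int (fun x => \sum_(j <- s) F j x) = \sum_(j <- s) Int (F j).
Proof.
move=> h; elim: s => [|j s ih].
  by under [X in Int X]funext do rewrite big_nil; rewrite Int0 big_nil.
under [X in Int X]funext do rewrite big_cons.
by rewrite IntD ?ih ?big_cons//; exact: integ_sum.
Qed.

Lemma Int_le f g : integ f -> integ g -> (forall x, f x <= g x) -> Int f <= Int g.
Proof. by move=> hf hg fg; apply: le_Rintegral. Qed.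

Lemma Int_ge0 f : (forall x, 0 <= f x) -> 0 <= Int f.
Proof. by move=> f0; apply: Rintegral_ge0. Qed.

Lemma Int_abs f : integ f -> `|Int f| <= Int (fun x => `|f x|).
Proof. exact: le_normr_Rintegral. Qed.

Lemma Int_abs_le f g : integ f -> integ g -> (forall x, `|f x| <= g x) ->
  `|Int f| <= Int g.
Proof.
move=> hf hg fg; apply: (le_trans (Int_abs hf)).
by apply: Int_le => //; exact: integ_norm.
Qed.

Lemma EFin_Int f : integ f -> (\int[mu]_x (f x)%:E = (Int f)%:E)%E.
Proof. by move=> h; rewrite /Int /Rintegral fineK//; apply: integrable_fin_num. Qed.

Lemma nneg_integ f B : measurable_fun setT f -> (forall x, 0 <= f x) ->
  (\int[mu]_x (f x)%:E <= B%:E)%E -> integ f.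
Proof.
move=> mf f0 h; apply/integrableP; split; first exact/measurable_EFinP.
under eq_integral do rewrite /= ger0_norm//.
by rewrite (le_lt_trans h)// ltry.
Qed.

Lemma eq_Int f g : f =1 g -> Int f = Int g.
Proof. by move=> /funext ->. Qed.

Lemma eq_integ f g : f =1 g -> integ f -> integ g.
Proof. by move=> /funext ->. Qed.

Lemma measurable_aff (a b : R) : measurable_fun setT (fun x : R => a * x + b).
Proof. by apply: measurable_funD => //; apply: measurable_funM. Qed.

Local Notation aff a b := (fun x : measurableTypeR R => (a * x + b)%R : measurableTypeR R).

(** The right-hand side is a measure in [A], so by uniqueness of Lebesgue measure it is enough to
    test the intervals []u, v]]. For a < 0 the preimage has its closed end on the left, hence the
    two cases. *)
Lemma lebesgue_affine (a b : R) (A : set R) : a != 0 -> measurable A ->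
  mu A = (`|a|%:E * pushforward mu (aff a b) A)%E.
Proof.
move=> a0 mA.
have mphi : measurable_fun setT (aff a b). by exact: measurable_aff.
pose phi : {mfun measurableTypeR R >-> measurableTypeR R} :=
  HB.pack (aff a b) (isMeasurableFun.Build _ _ _ _ _ mphi).
have an : 0 <= `|a| by [].
rewrite (lebesgue_measure_unique (mu := mscale (NngNum an) (pushforward mu phi)))//.
move=> _ [[u v]] _ <- /=; rewrite /mscale /pushforward /=.
rewrite lebesgue_measure_itv /= lte_fin.
have [ag0|al0] : 0 < a \/ a < 0 by move: a0; rewrite neq_lt => /orP[]; auto.
  transitivity (`|a|%:E * mu `]((u - b) / a)%R, ((v - b) / a)%R]%classic)%E; last first.
    congr (_ * _)%E; apply: (congr1 lebesgue_measure).
    by apply/esym/seteqP; split=> x /=; rewrite !in_itv /= ltr_pdivrMr// ler_pdivlMr// (mulrC x) ltrBlDr lerBrDr.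
  rewrite lebesgue_measure_itv /= lte_fin ltr_pM2r ?invr_gt0// ltrD2r.
  case: ifP => // _; last by rewrite mule0.
  by rewrite -!EFinD -EFinM gtr0_norm//; congr EFin; field.
transitivity (`|a|%:E * mu `[((v - b) / a)%R, ((u - b) / a)%R[%classic)%E; last first.
    congr (_ * _)%E; apply: (congr1 lebesgue_measure).
  by apply/esym/seteqP; split=> x /=; rewrite !in_itv /= ltr_ndivlMr// ler_ndivrMr// (mulrC x) ltrBlDr lerBrDr andbC.
rewrite lebesgue_measure_itv /= lte_fin ltr_nM2r ?invr_lt0// ltrD2r.
case: ifP => // _; last by rewrite mule0.
by rewrite -!EFinD -EFinM ltr0_norm//; congr EFin; field.
Qed.

Lemma measurable_affine (a b : R) f : measurable_fun setT f ->
  measurable_fun setT (fun x => f (a * x + b)).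
Proof.
move=> mf; apply: (measurableT_comp mf).
exact: measurable_aff.
Qed.

Lemma ge0_integral_affine (a b : R) (f : R -> \bar R) : a != 0 ->
  measurable_fun setT f -> (forall x, 0 <= f x)%E ->
  (\int[mu]_x f x = `|a|%:E * \int[mu]_x f (a * x + b)%R)%E.
Proof.
move=> a0 mf f0.
have mphi : measurable_fun setT (aff a b). by exact: measurable_aff.
pose phi : {mfun measurableTypeR R >-> measurableTypeR R} :=
  HB.pack (aff a b) (isMeasurableFun.Build _ _ _ _ _ mphi).
have an : 0 <= `|a| by [].
rewrite (eq_measure_integral (mscale (NngNum an) (pushforward mu phi))); last first.
  by move=> A mA _; apply: lebesgue_affine.
rewrite ge0_integral_mscale//; congr (_ * _)%E.
by rewrite ge0_integral_pushforward.
Qed.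

Lemma integ_affine (a b : R) f : a != 0 -> integ f -> integ (fun x => f (a * x + b)).
Proof.
move=> a0 hf; have mf := integ_mf hf; apply/integrableP; split.
  by apply/measurable_EFinP; apply: measurable_affine.
move: hf => /integrableP[_]; rewrite (ge0_integral_affine b a0)//=; last first.
  by apply/measurable_EFinP; apply: measurableT_comp.
rewrite muleC -lte_pdivlMr ?normr_gt0// => h; apply: (lt_le_trans h).
by rewrite muleC gt0_muley// lte_fin invr_gt0 normr_gt0.
Qed.

Lemma Int_affine (a b : R) f : a != 0 -> integ f ->
  Int (fun x => f (a * x + b)) = `|a|^-1 * Int f.
Proof.
move=> a0; have {}an : `|a| != 0 by rewrite normr_eq0.
have pos g : (forall x, 0 <= g x) -> integ g ->
    Int (fun x => g (a * x + b)) = `|a|^-1 * Int g.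
  move=> g0 hg; rewrite [in RHS]/Int /Rintegral (ge0_integral_affine b a0)//.
  - by rewrite EFin_Int -?EFinM/= ?mulKf//; apply: integ_affine.
  - by apply/measurable_EFinP; apply: integ_mf.
move=> hf.
(* Positive and negative parts of [f], which reduce the claim to nonnegative functions. *)
pose g x := 2^-1 * (`|f x| + f x); pose h x := 2^-1 * (`|f x| - f x).
have ig : integ g.
  by apply: integZ; apply: integD => //; apply: integ_norm.
have ih : integ h.
  by apply: integZ; apply: integB => //; apply: integ_norm.
have g0 x : 0 <= g x by rewrite /g; have := ler_norm (- f x); rewrite normrN; lra.
have h0 x : 0 <= h x by rewrite /h; have := ler_norm (f x); lra.
have fE x : f x = g x - h x by rewrite /g /h; lra.
rewrite (eq_Int fE) (eq_Int (fun x => fE (a * x + b))).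
by rewrite !IntB ?pos ?mulrBr//; apply: integ_affine.
Qed.

Lemma holder (u v : R -> R) p q : 0 < p -> 0 < q -> p^-1 + q^-1 = 1 ->
  measurable_fun setT u -> measurable_fun setT v ->
  (forall x, 0 <= u x) -> (forall x, 0 <= v x) ->
  integ (fun x => u x `^ p) -> integ (fun x => v x `^ q) ->
  integ (fun x => u x * v x) /\
  Int (fun x => u x * v x) <=
    (Int (fun x => u x `^ p)) `^ p^-1 * (Int (fun x => v x `^ q)) `^ q^-1.
Proof.
move=> p0 q0 pq mu_ mv u0 v0 iu iv.
have := hoelder mu mu_ mv p0 q0 pq.
rewrite Lnorm1 unlock /=.
under eq_integral do rewrite ger0_norm ?mulr_ge0//.
under [X in (_ <= X `^ _ * _)%E -> _]eq_integral do rewrite ger0_norm// .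
under [X in (_ <= _ * X `^ _)%E -> _]eq_integral do rewrite ger0_norm//.
rewrite (EFin_Int iu) (EFin_Int iv) !poweR_EFin -EFinM => h.
have i : integ (fun x => u x * v x).
  apply: nneg_integ h; first exact: measurable_funM.
  by move=> x; rewrite mulr_ge0.
by split => //; rewrite -lee_fin -EFin_Int.
Qed.

End RealIntegral.

(* The inner [%R] makes the order symbols of [b] those of the ring. *)
Notation ib b := ((b%R : bool)%:R).

(** * Dyadic intervals, their neighbourhoods, and counting by packing *)

Section Dyadic.
Variable R : realType.
Local Notation mu := (@lebesgue_measure R).

Definition pow2 (k : int) : R := 2 ^ k.
Local Notation sc := pow2.

Lemma sc_gt0 k : 0 < sc k. Proof. by rewrite exprz_gt0. Qed.
Lemma sc_neq0 k : sc k != 0. Proof. by rewrite gt_eqF ?sc_gt0. Qed.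
Lemma sc_ge0 k : 0 <= sc k. Proof. exact/ltW/sc_gt0. Qed.
Lemma le_sc k l : (k <= l)%R -> sc k <= sc l.
Proof. by move=> kl; rewrite ler_weXz2l// ler1n. Qed.
Lemma scS k : sc (k + 1) = 2 * sc k.
Proof. by rewrite /pow2 expfzDr// expr1z mulrC. Qed.
Lemma scN k : sc (- k) = (sc k)^-1.
Proof. by rewrite /pow2 -invr_expz. Qed.
Hint Resolve sc_gt0 sc_ge0 sc_neq0 : core.

Lemma integ_itv (a b : R) : integ (fun x : R => ib (a <= x < b)).
Proof.
apply: (@eq_integ _ (\1_`[a, b[%classic)).
  by move=> x; rewrite indicE mem_setE in_itv.
rewrite /integ; apply/integrable_indic_itv.
Qed.

Lemma Int_itv (a b : R) : a <= b -> Int (fun x : R => ib (a <= x < b)) = b - a.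
Proof.
move=> ab; rewrite (@eq_Int _ _ (\1_`[a, b[%classic)); last first.
  by move=> x; rewrite indicE mem_setE in_itv.
rewrite /Int /Rintegral integral_indic// setIT.
transitivity (fine (mu [set` `[a, b[])); first by [].
rewrite lebesgue_measure_itv /= lte_fin.
by move: ab; rewrite le_eqVlt => /predU1P[->|->]//; rewrite ltxx subrr.
Qed.

(* A pair I = (k, n) stands for the dyadic interval 2^-k [n, n + 1); [stb I] is
   its neighbourhood 2^-k [n - 1, n + 3]. *)
Definition dyb (I : int * int) (x : R) : bool := I.2%:~R <= sc I.1 * x < I.2%:~R + 1.
Definition stb (I : int * int) (x : R) : bool := I.2%:~R - 1 <= sc I.1 * x <= I.2%:~R + 3.

Lemma integ_dyb I : integ (fun x => (dyb I x)%:R).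
Proof.
apply: eq_integ (integ_affine 0 (sc_neq0 I.1) (integ_itv I.2%:~R (I.2%:~R + 1))).
by move=> x; rewrite addr0.
Qed.

Lemma Int_dyb I : Int (fun x => (dyb I x)%:R) = (sc I.1)^-1.
Proof.
have := Int_affine 0 (sc_neq0 I.1) (integ_itv I.2%:~R (I.2%:~R + 1)).
rewrite Int_itv ?lerDl// addrAC subrr add0r mulr1 gtr0_norm// => <-.
by apply: eq_Int => x; rewrite addr0.
Qed.

Lemma measurable_itvb (a b c : R) : measurable_fun setT (fun x : R => a <= c * x <= b).
Proof.
have h : measurable_fun setT (fun x : R => c * x).
  by apply: (eq_measurable_fun (fun x => c * x + 0)) (measurable_aff c 0) => x _; rewrite addr0.
by apply: measurable_and; apply: measurable_fun_ler.
Qed.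

Lemma measurable_stb I : measurable_fun setT (stb I).
Proof. exact: measurable_itvb. Qed.

Lemma measurable_dyb I : measurable_fun setT (dyb I).
Proof.
have h : measurable_fun setT (fun x : R => sc I.1 * x).
  by apply: (eq_measurable_fun (fun x => sc I.1 * x + 0)) (measurable_aff _ 0) => x _; rewrite addr0.
by apply: measurable_and; [apply: measurable_fun_ler|apply: measurable_fun_ltr].
Qed.

Lemma measurable_bR (B : R -> bool) : measurable_fun setT B ->
  measurable_fun setT (fun x => (B x)%:R : R).
Proof. by move=> mB; apply: (measurableT_comp (f := fun b : bool => b%:R : R)). Qed.

Lemma stb_lt5 I x : stb I x -> (I.2%:~R - 1 <= sc I.1 * x < I.2%:~R + 4).
Proof. by move=> /andP[-> h] /=; lra. Qed.

(** The closed neighbourhood has length 4 in units of [I]; it is enclosed in a half-open interval of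
    length 5, to which [Int_itv] applies. *)
Lemma stb_itv5 I : exists2 B : R -> bool, (forall x, stb I x -> B x) &
  integ (fun x => (B x)%:R) /\ Int (fun x => (B x)%:R) = 5 * (sc I.1)^-1.
Proof.
exists (fun x => I.2%:~R - 1 <= sc I.1 * x < I.2%:~R + 4); first exact: stb_lt5.
have i0 := integ_itv (I.2%:~R - 1) (I.2%:~R + 4).
split.
  by apply: eq_integ (integ_affine 0 (sc_neq0 I.1) i0) => x; rewrite addr0.
have := Int_affine 0 (sc_neq0 I.1) i0.
rewrite Int_itv; last lra.
rewrite gtr0_norm// (_ : I.2%:~R + 4 - (I.2%:~R - 1) = 5); last by ring.
by rewrite mulrC => <-; apply: eq_Int => x; rewrite addr0.
Qed.

Lemma integ_stb I : integ (fun x => (stb I x)%:R).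
Proof.
have [B hB [iB _]] := stb_itv5 I.
apply: integ_le iB; first by apply: measurable_bR; exact: measurable_stb.
by move=> x; rewrite normr_nat ler_nat; case: (stb I x) (hB x) => // ->.
Qed.

Lemma Int_stb I : Int (fun x => (stb I x)%:R) <= 5 * (sc I.1)^-1.
Proof.
have [B hB [iB <-]] := stb_itv5 I; apply: Int_le => //; first exact: integ_stb.
by move=> x; rewrite ler_nat; case: (stb I x) (hB x) => // ->.
Qed.

Lemma sum_excl (T : eqType) (s : seq T) (P : T -> bool) : uniq s ->
  (forall a b, a \in s -> b \in s -> P a -> P b -> a = b) ->
  \sum_(a <- s) (P a)%:R <= 1 :> R.
Proof.
elim: s => [|a s ih] /=; first by rewrite big_nil.
move=> /andP[as_ us] h; rewrite big_cons; case Pa: (P a).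
  rewrite big1_seq ?addr0// => b /andP[_ bs].
  case Pb: (P b) => //; exfalso; move/negP: as_; apply.
  by rewrite (h a b) ?inE ?eqxx ?bs ?orbT.
rewrite add0r; apply: ih => // b c bs cs.
by apply: h; rewrite inE ?bs ?cs orbT.
Qed.

Lemma int_unit_uniq (m n : int) (x : R) : m%:~R <= x < m%:~R + 1 -> n%:~R <= x < n%:~R + 1 -> m = n.
Proof.
move=> /andP[h1 h2] /andP[h3 h4].
have : (m < n + 1)%R by rewrite -(ltr_int R) intrD; lra.
have : (n < m + 1)%R by rewrite -(ltr_int R) intrD; lra.
lia.
Qed.

(** Each integer n of [a, b] is charged the interval [n, n + 1). These are disjoint and lie in [a, b
    + 1), so the count is at most the length of the latter. *)
Lemma count_int (ns : seq int) (a b : R) : uniq ns -> a <= b ->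
  \sum_(n <- ns) ib (a <= n%:~R <= b) <= b - a + 1.
Proof.
move=> us ab.
have i1 (n : int) : integ (fun x : R => ib (a <= n%:~R <= b) * ib (n%:~R <= x < n%:~R + 1)).
  exact/integZ/integ_itv.
have -> : \sum_(n <- ns) ib (a <= n%:~R <= b) =
    Int (fun x : R => \sum_(n <- ns) ib (a <= n%:~R <= b) * ib (n%:~R <= x < n%:~R + 1)).
  rewrite Int_sum//; apply: eq_bigr => n _.
  by rewrite IntZ ?Int_itv ?lerDl//; [ring|exact: integ_itv].
have -> : b - a + 1 = Int (fun x : R => ib (a <= x < b + 1)).
  by rewrite Int_itv; lra.
apply: Int_le; [exact: integ_sum|exact: integ_itv|move=> x].
under eq_bigr do rewrite -natrM mulnb.
have [|nx] := boolP (a <= x < b + 1).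
  move=> _; apply: sum_excl => // m n _ _ /andP[_ h] /andP[_ h'].
  exact: int_unit_uniq h h'.
rewrite big1// => n _; case: andP => // -[/andP[h1 h2] /andP[h3 h4]].
by move: nx => /negP[]; lra.
Qed.

(** Packing again: 2^l is the length of [2^l, 2^(l+1)), and for l <= k these intervals are disjoint
    inside [0, 2^(k+1)). *)
Lemma sum_sc (ks : seq int) (k : int) : uniq ks ->
  \sum_(l <- ks) ib (l <= k) * sc l <= 2 * sc k.
Proof.
move=> us.
pose E (l : int) (x : R) : R := ib (l <= k) * ib (sc l <= x < 2 * sc l).
have iE l : integ (E l) by exact/integZ/integ_itv.
have -> : \sum_(l <- ks) ib (l <= k) * sc l = Int (fun x => \sum_(l <- ks) E l x).
  rewrite Int_sum//; apply: eq_bigr => n _.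
  rewrite IntZ ?Int_itv//; last exact: integ_itv.
    by congr (_ * _); ring.
  by have := sc_gt0 n; lra.
have -> : 2 * sc k = Int (fun x : R => ib (0 <= x < 2 * sc k)).
  by rewrite Int_itv; have := sc_gt0 k; lra.
apply: Int_le; [exact: integ_sum|exact: integ_itv|move=> x].
under eq_bigr do rewrite /E -natrM mulnb.
have [|nx] := boolP (0 <= x < 2 * sc k).
  move=> _; apply: sum_excl => // m n _ _ /andP[_ /andP[h1 h2]] /andP[_ /andP[h3 h4]].
  have key m' n' : sc m' <= x -> x < 2 * sc n' -> (m' <= n')%R.
    move=> h5 h6; rewrite leNgt; apply/negP => nm.
    have : sc (n' + 1) <= sc m' by apply: le_sc; lia.
    by rewrite scS; lra.
  by apply/eqP; rewrite eq_le (key _ _ h1 h4) (key _ _ h3 h2).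
rewrite big1// => n _; case: andP => // -[nk /andP[h3 h4]].
move: nx => /negP[]; have := sc_gt0 n; have := le_sc nk.
by move=> h5 h6; apply/andP; split; lra.
Qed.

Lemma sum_scV (ks : seq int) (k : int) : uniq ks ->
  \sum_(l <- ks) ib (k <= l) / sc l <= 2 / sc k.
Proof.
move=> us; have := @sum_sc [seq - l | l <- ks] (- k).
rewrite map_inj_uniq//.
by move=> /(_ us); rewrite big_map scN; under eq_bigr do rewrite lerN2 scN.
Qed.

End Dyadic.

(** * Almost orthogonality of Lipschitz atoms of mean zero *)

Section Kernels.
Variable R : realType.
Local Notation sc := (pow2 R).
#[local] Hint Extern 0 (is_true (0 < sc _)) => exact: sc_gt0 : core.
#[local] Hint Extern 0 (is_true (0 <= sc _)) => exact: sc_ge0 : core.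
#[local] Hint Extern 0 (is_true (sc _ != 0)) => exact: sc_neq0 : core.
Implicit Types (I J : int * int) (psi phi g h : R -> R).

(** Atoms normalised in the sup norm: the Lipschitz constant is the inverse of the length of [I],
    and a bound on the values follows from it and from the support ([kern_bound]). The factor
    [sc I.1] in [bessel] compensates for this normalisation. *)
Definition kern I psi : Prop :=
  [/\ forall x y, `|psi x - psi y| <= sc I.1 * `|x - y|,
      forall x, ~~ stb I x -> psi x = 0 & Int psi = 0].

Lemma kern0 I : kern I (fun=> 0).
Proof.
by split => [x y||] //; rewrite ?Int0// subrr normr0 mulr_ge0.
Qed.

Lemma lipschitz_measurable (L : R) psi :
  (forall x y, `|psi x - psi y| <= L * `|x - y|) -> measurable_fun setT psi.
Proof.
move=> h; apply: continuous_measurable_fun => x.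
have L1 : 0 < `|L| + 1 by rewrite ltr_wpDl.
apply/cvgrPdist_le => e e0; near=> y.
apply: (le_trans (h x y)); apply: (@le_trans _ _ ((`|L| + 1) * `|x - y|)).
  by rewrite ler_wpM2r// (le_trans (ler_norm _))// lerDl.
rewrite mulrC -ler_pdivlMr//; near: y.
by apply: cvgr_dist_le => //; rewrite divr_gt0.
Unshelve. all: by end_near. Qed.

Lemma kern_measurable I psi : kern I psi -> measurable_fun setT psi.
Proof. by case=> h _ _; exact: lipschitz_measurable h. Qed.

Lemma kern_bound I psi x : kern I psi -> `|psi x| <= 5 * ib (stb I x).
Proof.
case=> h h0 _; have [sx|nsx] := boolP (stb I x); last first.
  by rewrite h0// normr0 mulr0.
(* A point just beyond the right end of the support, where [psi] vanishes; every point of the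
   support is within five lengths of it. *)
pose y := (I.2%:~R + 4) / sc I.1.
have yE : sc I.1 * y = I.2%:~R + 4 by rewrite mulrC divfK.
have py : psi y = 0 by rewrite h0// /stb yE negb_and -!ltNge; apply/orP; right; lra.
rewrite mulr1 -[psi x]subr0 -py; apply: (le_trans (h x y)).
rewrite -[X in X * _]gtr0_norm// -normrM mulrBr yE ler_norml.
by move: sx => /andP[h1 h2]; apply/andP; split; lra.
Qed.

Lemma kern_integ I psi : kern I psi -> integ psi.
Proof.
move=> K; apply: integ_le (integZ 5 (integ_stb R I)); first exact: kern_measurable K.
by move=> x; apply: kern_bound.
Qed.

Lemma integM2 g h : measurable_fun setT g -> measurable_fun setT h ->
  integ (fun x => g x ^+ 2) -> integ (fun x => h x ^+ 2) -> integ (fun x => g x * h x).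
Proof.
move=> mg mh ig ih; apply: integ_le (integD ig ih); first exact: measurable_funM.
move=> x; rewrite ler_norml; apply/andP; split.
  by have := sqr_ge0 (g x + h x); rewrite sqrrD; have := sqr_ge0 (g x); have := sqr_ge0 (h x); lra.
by have := sqr_ge0 (g x - h x); rewrite sqrrB; have := sqr_ge0 (g x); have := sqr_ge0 (h x); lra.
Qed.

Lemma kern_sqr_integ I psi : kern I psi -> integ (fun x => psi x ^+ 2).
Proof.
move=> K; have m := kern_measurable K.
apply: integ_le (integZ 25 (integ_stb R I)); first exact: measurable_funX.
move=> x; rewrite normrX; have := kern_bound x K; case: (stb I x) => /= h.
  by have := normr_ge0 (psi x); rewrite mulr1 in h *; nra.
by move: h; rewrite !mulr0 normr_le0 => /eqP ->; rewrite normr0 expr0n.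
Qed.

Definition meet I J : bool := `[< exists x : R, stb I x && stb J x >].

(** For [I] coarser than [J], 75 = 3 * 5 * 5: the coarse atom oscillates by at most
    [3 * (sc I.1 / sc J.1)] over the support of the fine one, the fine one is bounded by 5, and its
    support has measure at most [5 / sc J.1]. *)
Definition gram I J : R := 75 * ib (meet I J) *
  (if I.1 <= J.1 then sc I.1 / sc J.1 ^+ 2 else sc J.1 / sc I.1 ^+ 2).

Lemma kern_inner_coarse I J psi phi : (I.1 <= J.1)%R -> kern I psi -> kern J phi ->
  `|Int (fun x => psi x * phi x)| <= 75 * ib (meet I J) * (sc I.1 / sc J.1 ^+ 2).
Proof.
move=> IJ KI KJ; have [mIJ|nm] := boolP (meet I J); last first.
  rewrite (@eq_Int _ _ (fun=> 0)) ?Int0 ?normr0 ?mulr0 ?mul0r// => x.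
  case: KI KJ => _ I0 _ [_ J0 _].
  have [sx|nsx] := boolP (stb I x); last by rewrite I0// mul0r.
  have [sx'|nsx'] := boolP (stb J x); last by rewrite J0// mulr0.
  by move/negP: nm; case; apply/asboolP; exists x; rewrite sx.
pose y := J.2%:~R / sc J.1.
have yE : sc J.1 * y = J.2%:~R by rewrite mulrC divfK.
have iphi := kern_integ KJ.
have ipp : integ (fun x => psi x * phi x).
  by apply: integM2; [exact: kern_measurable KI|exact: kern_measurable KJ
    |exact: kern_sqr_integ KI|exact: kern_sqr_integ KJ].
(* the mean zero of phi lets one subtract psi y *)
have -> : Int (fun x => psi x * phi x) = Int (fun x => psi x * phi x - psi y * phi x).
  by rewrite IntB//; [rewrite IntZ//; case: KJ => _ _ ->; rewrite mulr0 subr0|exact: integZ].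
have c0 : 0 <= 15 * (sc I.1 / sc J.1) by rewrite mulr_ge0// divr_ge0.
apply: le_trans (_ : Int (fun x => (15 * (sc I.1 / sc J.1)) * ib (stb J x)) <= _).
  apply: Int_abs_le.
  - by apply: integB => //; apply: integZ.
  - by apply: integZ; apply: integ_stb.
  move=> x; rewrite -mulrBl normrM.
  have := kern_bound x KJ; case sx : (stb J x) => /= h; last first.
    by move: h; rewrite !mulr0 normr_le0 => /eqP ->; rewrite normr0 mulr0.
  case: KI => /(_ x y) hI _ _; rewrite mulr1 in h *.
  rewrite (_ : 15 * _ = (3 * (sc I.1 / sc J.1)) * 5); last by ring.
  rewrite mulr1; apply: ler_pM => //; apply: (le_trans hI).
  rewrite (_ : 3 * _ = sc I.1 * (3 / sc J.1)); last by ring.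
  rewrite ler_wpM2l// ler_pdivlMr// mulrC -[X in X * _]gtr0_norm// -normrM mulrBr yE ler_norml.
  by move: sx => /andP[h1 h2]; apply/andP; split; lra.
rewrite IntZ; last exact: integ_stb.
rewrite mulr1 (_ : 75 * _ = (15 * (sc I.1 / sc J.1)) * (5 * (sc J.1)^-1)).
  by apply: ler_wpM2l => //; apply: Int_stb.
by field.
Qed.

Lemma meetC I J : meet I J = meet J I.
Proof. by apply: asbool_equiv_eq; split=> -[x]; rewrite andbC => h; exists x. Qed.

Lemma gramC I J : gram I J = gram J I.
Proof.
rewrite /gram meetC; case: ltgtP => // ->; by [].
Qed.

Lemma gram_ge0 I J : 0 <= gram I J.
Proof.
rewrite /gram mulr_ge0 ?mulr_ge0//.
by case: ifP => _; rewrite divr_ge0 ?exprn_ge0.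
Qed.

Lemma kern_inner I J psi phi : kern I psi -> kern J phi ->
  `|Int (fun x => psi x * phi x)| <= gram I J.
Proof.
move=> KI KJ; case: (leP I.1 J.1) => [IJ|/ltW JI].
  by rewrite /gram IJ; exact: kern_inner_coarse.
rewrite gramC /gram JI (eq_Int (fun x => mulrC (psi x) (phi x))).
exact: kern_inner_coarse.
Qed.

Lemma sum_meet (ns : seq int) k n l : uniq ns ->
  \sum_(v <- ns) ib (meet (k, n) (l, v)) <= 9 * (if k <= l then sc l / sc k else 1).
Proof.
move=> us; pose c := sc l / sc k.
have c0 : 0 < c by rewrite divr_gt0.
(* [c] is the length at scale k in units of that at scale l. The admissible [v] lie in an interval
   of length 4 c + 4, which contains at most 4 c + 5 integers. *)
have lc : 4 * c + 5 <= 9 * (if k <= l then c else 1).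
  case: (leP k l) => kl.
    have : 1 <= c by rewrite ler_pdivlMr// mul1r le_sc.
    by lra.
  have : c <= 1 by rewrite ler_pdivrMr// mul1r le_sc// ltW.
  by lra.
apply: le_trans lc.
pose a := c * (n%:~R - 1) - 3; pose b := c * (n%:~R + 3) + 1.
have -> : 4 * c + 5 = b - a + 1 by rewrite /a /b; ring.
apply: le_trans (count_int us (_ : a <= b)); last by rewrite /a /b; lra.
apply: ler_sum => v _; rewrite ler_nat /meet.
case: asboolP => // -[x /andP[/andP[/= h1 h2] /andP[/= h3 h4]]].
have xE : sc l * x = c * (sc k * x) by rewrite /c; field.
have h5 : c * (n%:~R - 1) <= sc l * x by rewrite xE ler_wpM2l// ltW.
have h6 : sc l * x <= c * (n%:~R + 3) by rewrite xE ler_wpM2l// ltW.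
by rewrite lt0b /a /b; apply/andP; split; lra.
Qed.

Definition box (ks ns : seq int) : seq (int * int) := [seq (k, n) | k <- ks, n <- ns].

(** At a finer scale l there are at most [9 * sc l / sc k] neighbours of weight
    [75 * sc k / sc l ^+ 2], at a coarser one at most 9 of weight [75 * sc l / sc k ^+ 2]. Both
    series are geometric and each sums to at most [2 * 675 / sc k]. *)
Lemma gram_row ks ns I : uniq ks -> uniq ns ->
  \sum_(J <- box ks ns) gram I J <= 2700 / sc I.1.
Proof.
case: I => k n uk un; rewrite big_allpairs /=.
apply: le_trans (_ : \sum_(l <- ks) (675 * (ib (k <= l) / sc l) +
   675 / sc k ^+ 2 * (ib (l <= k) * sc l)) <= _).
  apply: ler_sum => l _; rewrite /gram /= -mulr_suml -mulr_sumr.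
  set w : R := (if k <= l then _ else _).
  have w0 : 0 <= w by rewrite /w; case: ifP => _; rewrite divr_ge0 ?exprn_ge0.
  apply: le_trans (_ : 75 * (9 * (if k <= l then sc l / sc k else 1)) * w <= _).
    by rewrite ler_wpM2r// ler_wpM2l//; exact: sum_meet.
  clear w0; rewrite /w; case: (ltgtP k l) => [kl|kl|->] /=; rewrite ?mulr1 ?mul1r ?mul0r ?mulr0 ?addr0 ?add0r.
  - by rewrite le_eqVlt; apply/orP; left; apply/eqP; field; rewrite !sc_neq0.
  - by rewrite le_eqVlt; apply/orP; left; apply/eqP; field; rewrite !sc_neq0.
  - have -> : 75 * (9 * (sc l / sc l)) * (sc l / sc l ^+ 2) = 675 / sc l by field; rewrite !sc_neq0.
    have -> : 675 / sc l ^+ 2 * sc l = 675 / sc l by field; rewrite !sc_neq0.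
    have h : 0 <= (sc l)^-1 by rewrite invr_ge0.
    by lra.
rewrite big_split /= -!mulr_sumr.
apply: le_trans (_ : 675 * (2 / sc k) + 675 / sc k ^+ 2 * (2 * sc k) <= _).
  apply: lerD; apply: ler_wpM2l; [exact: ler0n|exact: sum_scV| |exact: sum_sc].
  by apply: divr_ge0; [exact: ler0n|exact: exprn_ge0].
by rewrite le_eqVlt; apply/orP; left; apply/eqP; field; rewrite !sc_neq0.
Qed.

Lemma schur (T : Type) (s : seq T) (a : T -> R) (G : T -> T -> R) :
  (forall i j, G i j = G j i) -> (forall i j, 0 <= G i j) ->
  \sum_(i <- s) \sum_(j <- s) `|a i| * `|a j| * G i j <=
  \sum_(i <- s) a i ^+ 2 * \sum_(j <- s) G i j.
Proof.
move=> Gs G0.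
apply: le_trans (_ : \sum_(i <- s) \sum_(j <- s) (2^-1 * (a i ^+ 2 * G i j) + 2^-1 * (a j ^+ 2 * G j i)) <= _).
  apply: ler_sum => i _; apply: ler_sum => j _.
  rewrite (Gs j i) -mulrDr -mulrDl mulrA ler_wpM2r//.
  have := sqr_ge0 (`|a i| - `|a j|); rewrite sqrrB !real_normK ?num_real//.
  by lra.
under eq_bigr do rewrite big_split /=.
rewrite big_split /= [X in _ + X]exchange_big /= -big_split /=.
apply: ler_sum => i _; rewrite -!mulr_sumr -mulrDr mulrC; lra.
Qed.

(* Schur's test for the Gram matrix of the kernels, whose rows are summable since
   mean zero of the finer kernel plays against smoothness of the coarser one. *)
Lemma bessel ks ns (psi : int * int -> R -> R) g : uniq ks -> uniq ns ->
  (forall I, kern I (psi I)) -> measurable_fun setT g -> integ (fun x => g x ^+ 2) ->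
  \sum_(I <- box ks ns) sc I.1 * Int (fun x => g x * psi I x) ^+ 2 <=
    2700 * Int (fun x => g x ^+ 2).
Proof.
move=> uk un K mg ig; set s := box ks ns.
pose a I := sc I.1 * Int (fun x => g x * psi I x).
pose P x := \sum_(I <- s) a I * psi I x.
set A := (X in X <= _).
have mpsi I : measurable_fun setT (psi I) by exact: kern_measurable (K I).
have i2 I J : integ (fun x => psi I x * psi J x).
  by apply: integM2 => //; exact: kern_sqr_integ (K _).
have igp I : integ (fun x => g x * psi I x).
  by apply: integM2 => //; exact: kern_sqr_integ (K _).
have AE : A = Int (fun x => g x * P x).
  rewrite /P; under [RHS]eq_Int do rewrite mulr_sumr.
  rewrite Int_sum.
    apply: eq_bigr => I _; rewrite [RHS](@eq_Int _ _ (fun x => a I * (g x * psi I x))).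
      by rewrite IntZ// /a; ring.
    by move=> x; ring.
  by move=> I; apply: eq_integ (integZ (a I) (igp I)) => x; ring.
have iP2' I J : integ (fun x => a I * a J * (psi I x * psi J x)) by exact: integZ.
have P2 x : P x ^+ 2 = \sum_(I <- s) \sum_(J <- s) a I * a J * (psi I x * psi J x).
  rewrite expr2 /P mulr_suml; apply: eq_bigr => I _.
  by rewrite mulr_sumr; apply: eq_bigr => J _; ring.
have iP2 : integ (fun x => P x ^+ 2).
  by apply: eq_integ (fun x => esym (P2 x)) _; apply: integ_sum => I; apply: integ_sum.
have mP : measurable_fun setT P.
  by apply: measurable_sum => I; apply: measurable_funM.
have IP2 : Int (fun x => P x ^+ 2) <= 2700 * A.
  rewrite (eq_Int P2) Int_sum; last by move=> I; apply: integ_sum.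
  apply: le_trans (_ : \sum_(I <- s) \sum_(J <- s) `|a I| * `|a J| * gram I J <= _).
    apply: ler_sum => I _; rewrite Int_sum//; apply: ler_sum => J _.
    rewrite IntZ// (le_trans (ler_norm _))// !normrM ler_wpM2l ?mulr_ge0//.
    by apply: kern_inner.
  apply: le_trans (schur _ _ gramC gram_ge0) _.
  rewrite mulr_sumr; apply: ler_sum => I _.
  apply: le_trans (_ : a I ^+ 2 * (2700 / sc I.1) <= _).
    by rewrite ler_wpM2l ?sqr_ge0//; apply: gram_row.
  by rewrite le_eqVlt; apply/orP; left; apply/eqP; rewrite /a; field.
have igP : integ (fun x => g x * P x) by apply: integM2.
(* [A] is the pairing of [g] with [P]. The weights in this arithmetic-geometric inequality are
   chosen so that [IP2] makes the last term at most [A / 2], which is then absorbed. *)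
have : A <= 1350 * Int (fun x => g x ^+ 2) + 5400^-1 * Int (fun x => P x ^+ 2).
  rewrite AE -!IntZ// -IntD; [|exact: integZ..].
  apply: Int_le => //; first by apply: integD; apply: integZ.
  by move=> x; have := sqr_ge0 (2700 * g x - P x); rewrite sqrrB exprMn; lra.
by lra.
Qed.

End Kernels.

(** * Covering by maximal intervals and the translated dyadic maximal function *)

Section Maximal.
Variable R : realType.
Local Notation sc := (pow2 R).
#[local] Hint Extern 0 (is_true (0 < sc _)) => exact: sc_gt0 : core.
#[local] Hint Extern 0 (is_true (0 <= sc _)) => exact: sc_ge0 : core.
#[local] Hint Extern 0 (is_true (sc _ != 0)) => exact: sc_neq0 : core.
Implicit Types (I J : int * int) (x y : R).

Lemma scD_nat k (d : nat) : sc (k + d%:Z) = sc k * 2 ^+ d.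
Proof. by rewrite /pow2 expfzDr. Qed.

(** Integrality does the work: a strict inequality [n * 2 ^+ d < v + 1] between integers improves to
    [n * 2 ^+ d <= v], and this is what nests dyadic intervals. *)
Lemma dy_index I J x : (I.1 <= J.1)%R -> dyb I x -> dyb J x ->
  exists2 d : nat, J.1 = I.1 + d%:Z &
    I.2%:~R * 2 ^+ d <= J.2%:~R :> R /\ J.2%:~R + 1 <= (I.2%:~R + 1) * 2 ^+ d :> R.
Proof.
case: I J => [k n] [l v] /= kl /andP[/= h1 h2] /andP[/= h3 h4].
have lE : l = k + `|l - k|%N%:Z by lia.
exists `|l - k|%N => //; move: h3 h4; rewrite lE scD_nat -lE => h3 h4.
set d := `|l - k|%N in lE h3 h4 *.
have p0 : 0 < 2 ^+ d :> R by rewrite exprn_gt0.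
have e : 2 ^+ d = (2 ^+ d : int)%:~R :> R by rewrite rmorphXn.
split.
  have : n%:~R * 2 ^+ d < v%:~R + 1 :> R by nra.
  by rewrite e -intrM -(intrD _ _ 1) ltr_int ler_int; lia.
have : v%:~R < (n%:~R + 1) * 2 ^+ d :> R by nra.
have en (z : int) : z%:~R + 1 = (z + 1)%:~R :> R by rewrite intrD.
by rewrite e !en -intrM ltr_int ler_int; lia.
Qed.

Lemma dy_nested I J x y : (I.1 <= J.1)%R -> dyb I x -> dyb J x -> dyb J y -> dyb I y.
Proof.
move=> IJ Ix Jx; have [d JE [h1 h2]] := dy_index IJ Ix Jx.
have p0 : 0 < 2 ^+ d :> R by rewrite exprn_gt0.
rewrite /dyb JE scD_nat => /andP[h3 h4]; apply/andP; split.
  by rewrite -(ler_pM2r p0); lra.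
by rewrite -(ltr_pM2r p0); lra.
Qed.

Lemma dy_inhab I : dyb I (I.2%:~R / sc I.1).
Proof. by rewrite /dyb mulrC divfK// lexx ltrDl ltr01. Qed.

Definition dysub J I : Prop := (I.1 <= J.1)%R /\ forall x, dyb J x -> dyb I x.

Lemma dysub_trans J I K : dysub K J -> dysub J I -> dysub K I.
Proof. by move=> [a1 a2] [b1 b2]; split; [exact: le_trans a1|move=> x /a2 /b2]. Qed.

(** [D] consists of the maximal intervals, built by insertion: a new interval contained in a member
    of [D] is dropped, any other one replaces the members that it contains. *)
Lemma disjoint_cover (s : seq (int * int)) : exists2 D : seq (int * int),
  [/\ uniq D, {subset D <= s} & forall I J x, I \in D -> J \in D -> dyb I x -> dyb J x -> I = J] &
  forall J, J \in s -> exists2 I, I \in D & dysub J I.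
Proof.
elim: s => [|J s [D [uD Ds dD] cD]]; first by exists [::].
have [[I ID JI]|nJ] := pselect (exists2 I, I \in D & dysub J I).
  exists D => [|K]; first by split => // K /Ds; rewrite inE orbC => ->.
  by rewrite inE => /predU1P[->|/cD//]; exists I.
pose D' := [seq I <- D | ~~ `[< dysub I J >]].
have JD' : J \notin D'.
  by rewrite mem_filter negb_and negbK; apply/orP; left; apply/asboolP; split.
have sub K : K \in D' -> [/\ K \in D, ~ dysub K J & ~ dysub J K].
  rewrite mem_filter => /andP[/asboolP h KD]; split => // JK.
  by apply: nJ; exists K.
have dis K x : K \in D' -> dyb J x -> dyb K x -> False.
  move=> /sub [KD n1 n2] Jx Kx; case: (leP K.1 J.1) => [KJ|/ltW JK].
    by apply: n2; split => // y; apply: dy_nested KJ Kx Jx.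
  by apply: n1; split => // y; apply: dy_nested JK Jx Kx.
exists (J :: D') => [|K].
  split.
  - by rewrite /= JD' filter_uniq.
  - by move=> K; rewrite !inE => /predU1P[->|/sub[/Ds -> _ _]]; rewrite ?eqxx ?orbT.
  - move=> K L x; rewrite !inE => /predU1P[->|KD] /predU1P[->|LD] // h1 h2.
    + by case: (dis L x).
    + by case: (dis K x).
    + by case: (sub K KD) (sub L LD) => [K1 _ _] [L1 _ _]; exact: dD h1 h2.
rewrite inE => /predU1P[->|/cD[I ID KI]].
  by exists J; rewrite ?inE ?eqxx//; split.
have [IJ|nIJ] := pselect (dysub I J).
  by exists J; [rewrite inE eqxx|exact: dysub_trans KI IJ].
exists I => //; rewrite inE mem_filter ID andbT; apply/orP; right.
exact/asboolP.
Qed.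

Lemma measurable_has (T : Type) (s : seq T) (B : T -> R -> bool) :
  (forall i, measurable_fun setT (B i)) -> measurable_fun setT (fun x => has (B ^~ x) s).
Proof.
move=> mB; elim: s => [|i s ih] /=; first exact: measurable_cst.
exact: measurable_or.
Qed.

Lemma ib_has (T : Type) (s : seq T) (b : T -> bool) :
  ib (has b s) <= \sum_(i <- s) ib (b i) :> R.
Proof.
elim: s => [|i s ih]; first by rewrite big_nil.
rewrite big_cons /=; case: (b i) => /=; last by rewrite add0r.
by rewrite lerDl sumr_ge0.
Qed.

Lemma integ_ib_le (B : R -> bool) g : measurable_fun setT B ->
  (forall x, ib (B x) <= g x) -> integ g -> integ (fun x => ib (B x)).
Proof.
move=> mB h; apply: integ_le; first exact: measurable_bR.
by move=> x; rewrite normr_nat.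
Qed.

Lemma integM_ib (B : R -> bool) w : measurable_fun setT B -> integ w ->
  integ (fun x => w x * ib (B x)).
Proof.
move=> mB iw; apply: integ_le (integ_norm iw).
  by apply: measurable_funM; [exact: integ_mf|exact: measurable_bR].
by move=> x; rewrite normrM; case: (B x); rewrite ?normr0 ?mulr0 ?normr1 ?mulr1.
Qed.

Lemma Int_window (c a b e : R) : 0 < c -> a <= b ->
  exists2 B : R -> bool, (forall x, a <= c * x - e <= b -> B x) &
  integ (fun x => ib (B x)) /\ Int (fun x => ib (B x)) = (b - a + 1) / c.
Proof.
move=> c0 ab; exists (fun x => a <= c * x - e < b + 1).
  by move=> x /andP[-> h] /=; lra.
have i0 := integ_itv a (b + 1).
split; first exact: (integ_affine (- e) (lt0r_neq0 c0) i0).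
rewrite (Int_affine (- e) (lt0r_neq0 c0) i0) Int_itv; last lra.
by rewrite gtr0_norm// mulrC addrAC.
Qed.

Section Fixed.
Variables (w : R -> R) (t : R) (s : seq (int * int)).
Hypotheses (w0 : forall x, 0 <= w x) (iw : integ w) (t0 : 0 < t).
Hypothesis avg : forall J, J \in s -> t / sc J.1 <= Int (fun x => w x * ib (dyb J x)).

Local Notation U x := (has (fun I => dyb I x) s).

Lemma measurable_cover : measurable_fun setT (fun x : R => U x).
Proof. by apply: measurable_has => I; exact: measurable_dyb. Qed.

Lemma disjoint_sum_le (D : seq (int * int)) : uniq D -> {subset D <= s} ->
  (forall I J x, I \in D -> J \in D -> dyb I x -> dyb J x -> I = J) ->
  t * \sum_(I <- D) (sc I.1)^-1 <= Int (fun x => w x * ib (U x)).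
Proof.
move=> uD Ds dD.
apply: le_trans (_ : \sum_(I <- D) Int (fun x => w x * ib (dyb I x)) <= _).
  by rewrite mulr_sumr big_seq [leRHS]big_seq; apply: ler_sum => I /Ds; exact: avg.
have iI I : integ (fun x => w x * ib (dyb I x)).
  by apply: integM_ib => //; exact: measurable_dyb.
rewrite -Int_sum//; apply: Int_le; first exact: integ_sum.
  by apply: integM_ib => //; exact: measurable_cover.
move=> x; rewrite -mulr_sumr ler_wpM2l//.
have [|/hasPn nU] := boolP (U x).
  by move=> _; apply: sum_excl => // I J ID JD; apply: dD.
by rewrite big1_seq// => I /andP[_ /Ds /nU /negbTE ->].
Qed.

(** The integral of [w] extends over the superlevel set only, not over the line. This is Doob's form
    of the weak type bound; it is strong enough to be summed over all levels and absorbed later. *)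
Lemma maximal_weak : t * Int (fun x => ib (U x)) <= Int (fun x => w x * ib (U x)).
Proof.
have [D [uD Ds dD] cD] := disjoint_cover s.
apply: le_trans (disjoint_sum_le uD Ds dD); rewrite ler_wpM2l ?(ltW t0)//.
have iD : integ (fun x => \sum_(I <- D) ib (dyb I x)).
  by apply: integ_sum => I; exact: integ_dyb.
have le x : ib (U x) <= \sum_(I <- D) ib (dyb I x) :> R.
  apply: le_trans (ib_has _ _); rewrite ler_nat.
  case: hasP => // -[J /cD[I ID [_ JI]] /JI Ix].
  by case: hasP => // -[]; exists I.
under [leRHS]eq_bigr do rewrite -Int_dyb.
rewrite -Int_sum; last by move=> I; exact: integ_dyb.
by apply: Int_le => //; apply: integ_ib_le le iD; exact: measurable_cover.
Qed.

(* Moving a subinterval of I at relative depth d by N of its lengths moves it by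
   N / 2^d lengths of I, less than one length once d >= D: so D + 1 windows
   around I contain all these translates. *)
Lemma shifted_window I J (N : int) (D : nat) x : `|N| < 2 ^+ D -> dysub J I ->
  stb (J.1, J.2 + N) x ->
  ib (- 2 <= sc I.1 * x - I.2%:~R <= 4) +
  \sum_(d < D) ib (- 1 <= sc I.1 * x - (I.2%:~R + N%:~R / 2 ^+ d) <= 3) >= 1 :> R.
Proof.
move=> ND [IJ JI] /andP[/= h1 h2].
have [d JE [h3 h4]] := dy_index IJ (JI _ (dy_inhab J)) (dy_inhab J).
move: h1 h2; rewrite JE scD_nat intrD => h1 h2.
set z := sc I.1 * x; set n : R := I.2%:~R in h3 h4 *; set v : R := J.2%:~R in h1 h2 h3 h4.
set N' : R := N%:~R in h1 h2 *.
pose p : R := 2 ^+ d.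
have p0 : 0 < p by rewrite exprn_gt0.
have p1 : 1 <= p by rewrite exprn_ege1// ler1n.
have [dD|Dd] := ltnP d D; last first.
  have ND' : `|N'| < p.
    apply: (@lt_le_trans _ _ (2 ^+ D)); last by rewrite ler_weXn2l// ler1n.
    by move: ND; rewrite -(ltr_int R) intr_norm rmorphXn.
  move: ND'; rewrite ltr_norml => /andP[N1 N2].
  have -> : - 2 <= z - n <= 4.
    rewrite -/p in h1 h2 h3 h4; rewrite mulrAC -/z in h1 h2.
    by apply/andP; split; rewrite -(ler_pM2r p0) mulrBl; lra.
  by rewrite lerDl sumr_ge0.
rewrite (bigD1 (Ordinal dD))//= -/p.
have -> : - 1 <= z - (n + N' / p) <= 3.
  rewrite -/p in h1 h2 h3 h4; rewrite mulrAC -/z in h1 h2.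
  by apply/andP; split; rewrite -(ler_pM2r p0) mulrBl mulrDl divfK ?gt_eqF//; lra.
by rewrite addrCA lerDl addr_ge0// sumr_ge0.
Qed.

(** Only maximal intervals are charged: by [shifted_window], all translated neighbourhoods coming
    from inside one of them lie in one window of 7 times its length and [D] windows of 5 times its
    length, and 7 + 5 D <= 7 (D + 1). *)
Lemma shifted_maximal_weak (N : int) (D : nat) : `|N| < 2 ^+ D ->
  t * Int (fun x => ib (has (fun J => stb (J.1, J.2 + N) x) s)) <=
  7 * D.+1%:R * Int (fun x => w x * ib (U x)).
Proof.
move=> ND; have [E [uE Es dE] cE] := disjoint_cover s.
pose U' x := has (fun J => stb (J.1, J.2 + N) x) s.
have mU' : measurable_fun setT U' by apply: measurable_has => J; exact: measurable_stb.
have a1 : - 2 <= 4 :> R by lra.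
have a2 : - 1 <= 3 :> R by lra.
pose win0 I := sval (cid2 (Int_window (I.2%:~R) (sc_gt0 R I.1) a1)).
pose win I (d : nat) := sval (cid2 (Int_window (I.2%:~R + N%:~R / 2 ^+ d) (sc_gt0 R I.1)
   a2)).
have w0P I : (forall x, - 2 <= sc I.1 * x - I.2%:~R <= 4 -> win0 I x) /\
    (integ (fun x => ib (win0 I x)) /\ Int (fun x => ib (win0 I x)) = 7 / sc I.1).
  rewrite /win0; case: cid2 => B /= h1 [h2 h3]; split => //; split => //.
  by rewrite h3; congr (_ / _); ring.
have wP I d : (forall x, - 1 <= sc I.1 * x - (I.2%:~R + N%:~R / 2 ^+ d) <= 3 -> win I d x) /\
    (integ (fun x => ib (win I d x)) /\ Int (fun x => ib (win I d x)) = 5 / sc I.1).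
  rewrite /win; case: cid2 => B /= h1 [h2 h3]; split => //; split => //.
  by rewrite h3; congr (_ / _); ring.
pose F I x : R := ib (win0 I x) + \sum_(d < D) ib (win I d x).
have iF I : integ (F I).
  by apply: integD; [exact: (w0P I).2.1|apply: integ_sum => d; exact: (wP I d).2.1].
have le x : ib (U' x) <= \sum_(I <- E) F I x.
  have F0 I : 0 <= F I x by rewrite /F addr_ge0// sumr_ge0.
  have [/hasP[J /cE[I IE JI] Jx]|] := boolP (U' x); last by rewrite sumr_ge0.
  rewrite (bigD1_seq I)//= (le_trans (shifted_window ND JI Jx))//.
  apply: (@le_trans _ _ (F I x)); last by rewrite lerDl sumr_ge0.
  apply: lerD; first by rewrite ler_nat; case: (boolP (- 2 <= _ <= 4)) => // /((w0P I).1 x) ->.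
  apply: ler_sum => d _.
  by rewrite ler_nat; case: (boolP (- 1 <= _ <= 3)) => // /((wP I d).1 x) ->.
apply: le_trans (_ : t * \sum_(I <- E) (7 * D.+1%:R) * (sc I.1)^-1 <= _); last first.
  rewrite -mulr_sumr mulrCA ler_wpM2l//; exact: disjoint_sum_le.
rewrite ler_wpM2l ?(ltW t0)//.
apply: le_trans (_ : Int (fun x => \sum_(I <- E) F I x) <= _).
  apply: Int_le => //; last exact: integ_sum.
  by apply: integ_ib_le le (integ_sum _ iF).
rewrite Int_sum//; apply: ler_sum => I _.
rewrite /F IntD; [|exact: (w0P I).2.1|by apply: integ_sum => d; exact: (wP I d).2.1].
rewrite Int_sum; last by move=> d; exact: (wP I d).2.1.
rewrite (w0P I).2.2; under eq_bigr do rewrite (wP I _).2.2.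
have c0 : 0 <= (sc I.1)^-1 by rewrite invr_ge0.
have Dc0 : 0 <= D%:R * (sc I.1)^-1 by rewrite mulr_ge0.
by rewrite sumr_const card_ord -mulr_natl -natr1; lra.
Qed.

End Fixed.
End Maximal.

(** * Weighted square sums through the level sets of averages of the weight *)

Section Weighted.
Variable R : realType.
Local Notation sc := (pow2 R).
#[local] Hint Extern 0 (is_true (0 < sc _)) => exact: sc_gt0 : core.
#[local] Hint Extern 0 (is_true (0 <= sc _)) => exact: sc_ge0 : core.
#[local] Hint Extern 0 (is_true (sc _ != 0)) => exact: sc_neq0 : core.
Implicit Types (I J : int * int) (x y : R).

(** A lacunary sum is comparable to its last term. If m is the last index with [b m], the sum is at
    most [K * c m], and the power of [c m] is among the terms on the right. *)
Lemma powR_sum_geo (c : nat -> R) K a (b : nat -> bool) M : 0 <= K -> 0 < a ->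
  (forall i, 0 <= c i) -> (forall m, \sum_(i < m.+1) c i <= K * c m) ->
  (\sum_(i < M) c i * ib (b i)) `^ a <= K `^ a * \sum_(i < M) c i `^ a * ib (b i).
Proof.
move=> K0 a0 c0 cK; elim: M => [|M ih].
  by rewrite !big_ord0 mulr0 powR0// gt_eqF.
have s0 (u : nat -> R) m : (forall i, 0 <= u i) -> 0 <= \sum_(i < m) u i * ib (b i).
  by move=> u0; apply: sumr_ge0 => i _; rewrite mulr_ge0.
case bM : (b M); last by rewrite !big_ord_recr /= bM !mulr0 !addr0.
apply: le_trans (_ : (K * c M) `^ a <= _).
  rewrite ge0_ler_powR ?nnegrE ?(ltW a0) ?s0 ?mulr_ge0//.
  apply: le_trans (cK M); apply: ler_sum => i _.
  by rewrite ler_piMr//; case: (b i).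
rewrite powRM// ler_wpM2l ?powR_ge0// big_ord_recr /= bM mulr1 lerDr.
by apply: (s0 (fun i => c i `^ a)) => i; exact: powR_ge0.
Qed.

(** A discrete layer cake formula: the largest power of 2 strictly below [W] is already at least
    [W / 2]. *)
Lemma dyadic_layer (W : R) (N M : nat) : sc (- N%:Z) < W -> W <= sc (M%:Z - N%:Z) ->
  W <= 2 * \sum_(i < M) sc (i%:Z - N%:Z) * ib (sc (i%:Z - N%:Z) < W).
Proof.
move=> lo; elim: M => [|M ih] hi.
  by move: (lt_le_trans lo hi); rewrite sub0r ltxx.
rewrite big_ord_recr /=; case: (leP W (sc (M%:Z - N%:Z))) => h.
  by rewrite mulr0 addr0; exact: ih.
rewrite mulr1; move: hi.
have -> : M.+1%:Z - N%:Z = M%:Z - N%:Z + 1 by lia.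
rewrite scS => hi.
apply: (le_trans hi); rewrite ler_wpM2l// lerDr.
by apply: sumr_ge0 => i _; rewrite mulr_ge0.
Qed.

Lemma dyadic_range (T : eqType) (s : seq T) (W : T -> R) : (forall i, 0 <= W i) ->
  exists N : nat, forall i, i \in s -> W i = 0 \/ sc (- N%:Z) < W i <= sc N%:Z.
Proof.
move=> W0; elim: s => [|a s [N ih]]; first by exists 0%N.
have big (u : R) : exists n : nat, u < sc n%:Z.
  exists (Num.bound `|u|); apply: (le_lt_trans (ler_norm u)).
  apply: (lt_le_trans (archi_boundP (normr_ge0 u))).
  by rewrite /pow2 -exprnP -natrX ler_nat ltnW// ltn_expl.
have [n1 h1] := big (W a); have [n2 h2] := big (W a)^-1.
exists (maxn N (maxn n1 n2)) => i; rewrite inE => /predU1P[->|/ih[|/andP[h3 h4]]]; last 2 first.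
- by left.
- right; apply/andP; split.
    by apply: le_lt_trans h3; apply: le_sc; rewrite lerN2 lez_nat leq_maxl.
  by apply: (le_trans h4); apply: le_sc; rewrite lez_nat leq_maxl.
have [->|Wa] := eqVneq (W a) 0; [by left|right].
have {}Wa : 0 < W a by rewrite lt_def Wa W0.
apply/andP; split; last first.
  by apply: (le_trans (ltW h1)); apply: le_sc; rewrite lez_nat; lia.
rewrite scN invf_plt ?posrE//; apply: (lt_le_trans h2).
by apply: le_sc; rewrite lez_nat; lia.
Qed.

Lemma sqr_le_powR (x p : R) : 2 < p -> x ^+ 2 <= 1 + `|x| `^ p.
Proof.
move=> p2; have [x1|x1] := leP `|x| 1.
  rewrite -[leLHS]real_normK ?num_real//.
  by apply: (@le_trans _ _ 1); [rewrite exprn_ile1|rewrite lerDl powR_ge0].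
rewrite -real_normK ?num_real// -powR_mulrn//.
apply: (@le_trans _ _ (`|x| `^ p)); last by rewrite lerDr.
by rewrite ler_powR// ltW.
Qed.

(** The power of [X] is divided out, [X] being a real number. In the applications, finiteness of the
    family of intervals makes [X] the value of a finite integral. *)
Lemma absorb (X L q : R) : 0 < q -> 0 <= X -> 0 <= L -> X <= L * X `^ (1 - q^-1) -> X <= L `^ q.
Proof.
move=> q0; rewrite le_eqVlt => /predU1P[<- *|X0 L0 h]; first exact: powR_ge0.
have h1 : X `^ q^-1 <= L.
  rewrite -(ler_pM2r (powR_gt0 (1 - q^-1) X0)) -powRD; last first.
    by apply/implyP => _; rewrite gt_eqF.
  by rewrite addrC subrK powRr1// ltW.
have := @ge0_ler_powR _ q (ltW q0) (X `^ q^-1) L.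
by rewrite !nnegrE powR_ge0 -powRrM mulVf ?gt_eqF// powRr1 ?(ltW X0)//; exact.
Qed.

Lemma powR_root_le (G B X q : R) : 0 <= G -> 0 <= B -> B <= X -> 0 < q ->
  (G `^ q * B) `^ q^-1 <= G * X `^ q^-1.
Proof.
move=> G0 B0 BX q0; rewrite powRM ?powR_ge0// -powRrM mulfV ?gt_eqF// powRr1//.
rewrite ler_wpM2l// ge0_ler_powR ?nnegrE ?invr_ge0 ?(ltW q0)//.
exact: le_trans BX.
Qed.

Lemma geometric_le (c : nat -> R) rho : 1 < rho -> (forall i, 0 <= c i) ->
  (forall i, c i.+1 = rho * c i) ->
  forall m, \sum_(i < m.+1) c i <= (1 - rho^-1)^-1 * c m.
Proof.
move=> r1 c0 cS; have r0 : 0 < rho by lra.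
have ri : rho^-1 < 1 by rewrite invf_lt1.
have ri0 : 0 < rho^-1 by rewrite invr_gt0.
elim=> [|m ih].
  by rewrite big_ord1 ler_peMl// -[leLHS]invr1 lef_pV2 ?posrE; lra.
rewrite big_ord_recr /=; apply: (le_trans (lerD ih (lexx _))).
rewrite cS le_eqVlt; apply/orP; left; apply/eqP.
field; apply/andP; split; lra.
Qed.

Section Fixed.
Variables (ks ns : seq int) (psi : int * int -> R -> R) (f w : R -> R).
Variables (p q : R) (N : int) (D : nat).
Hypotheses (uk : uniq ks) (un : uniq ns) (K : forall I, kern I (psi I)).
Hypotheses (p2 : 2 < p) (q1 : 1 < q) (pq : (p / 2)^-1 + q^-1 = 1).
Hypotheses (mf : measurable_fun setT f) (ifp : integ (fun x => `|f x| `^ p)).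
Hypotheses (w0 : forall x, 0 <= w x) (iw : integ w) (iwq : integ (fun x => w x `^ q)).
Hypothesis ND : `|N| < 2 ^+ D.

Let s := box ks ns.
(** [W I] averages the weight over the translate of [I] by [-N], and [lev t] lists the translates of
    average above [t]. [Od t] is the union of these translates, [Om t] that of the neighbourhoods of
    the original intervals, where the atoms live. *)
Let W I := sc I.1 * Int (fun x => w x * ib (dyb (I.1, I.2 - N) x)).
Let lev (t : R) := map (fun I => (I.1, I.2 - N)) (seq.filter (fun I => t < W I) s).
Let Om t x := has (fun J => stb (J.1, J.2 + N) x) (lev t).
Let Od t x := has (fun J => dyb J x) (lev t).

Let q0 : 0 < q. Proof. exact: lt_trans q1. Qed.

Lemma level_avg t J : J \in lev t -> t / sc J.1 <= Int (fun x => w x * ib (dyb J x)).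
Proof.
move=> /mapP[I]; rewrite mem_filter => /andP[tW _] -> /=.
by rewrite ler_pdivrMr// mulrC ltW.
Qed.

Lemma measurable_Om t : measurable_fun setT (Om t).
Proof. by apply: measurable_has => J; exact: measurable_stb. Qed.

Lemma measurable_Od t : measurable_fun setT (Od t).
Proof. by apply: measurable_has => J; exact: measurable_dyb. Qed.

Lemma integ_Om t : integ (fun x => ib (Om t x)).
Proof.
apply: (@integ_ib_le _ _ (fun x => \sum_(J <- lev t) ib (stb (J.1, J.2 + N) x))).
- exact: measurable_Om.
- by move=> x; exact: ib_has.
- by apply: integ_sum => J; exact: integ_stb.
Qed.

Lemma integ_Od t : integ (fun x => ib (Od t x)).
Proof.
apply: (@integ_ib_le _ _ (fun x => \sum_(J <- lev t) ib (dyb J x))).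
- exact: measurable_Od.
- by move=> x; exact: ib_has.
- by apply: integ_sum => J; exact: integ_dyb.
Qed.

Lemma integ_wOd t : integ (fun x => w x * ib (Od t x)).
Proof. by apply: integM_ib => //; exact: measurable_Od. Qed.

Lemma integ_f2Om t : integ (fun x => f x ^+ 2 * ib (Om t x)).
Proof.
apply: integ_le (integD (integ_Om t) ifp).
  by apply: measurable_funM; [exact: measurable_funX|apply: measurable_bR; exact: measurable_Om].
move=> x; rewrite normrM normrX real_normK ?num_real//.
have := sqr_le_powR (f x) p2; case: (Om t x) => h /=.
  by rewrite normr1 mulr1.
by rewrite normr0 mulr0 add0r powR_ge0.
Qed.

(* The pairing with psi_I only sees f on the star of I, so Bessel applies to f
   restricted to the superlevel set. *)
Lemma bessel_level t :
  \sum_(I <- s) sc I.1 * Int (fun x => f x * psi I x) ^+ 2 * ib (t < W I) <=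
  2700 * Int (fun x => f x ^+ 2 * ib (Om t x)).
Proof.
pose psi' I := if t < W I then psi I else fun=> 0.
have K' I : kern I (psi' I) by rewrite /psi'; case: ifP => // _; exact: kern0.
pose g x := f x * ib (Om t x).
have mg : measurable_fun setT g.
  by apply: measurable_funM => //; apply: measurable_bR; exact: measurable_Om.
have g2 x : f x ^+ 2 * ib (Om t x) = g x ^+ 2.
  by rewrite /g exprMn; case: (Om t x); rewrite ?expr1n ?expr0n.
have ig2 : integ (fun x => g x ^+ 2) by apply: eq_integ g2 (integ_f2Om t).
have := bessel uk un K' mg ig2; rewrite (eq_Int g2); apply: le_trans.
rewrite big_seq [leRHS]big_seq; apply: ler_sum => I Is.
rewrite /psi'; case: ifPn => [tW|_]; last first.
  by rewrite mulr0 mulr_ge0// sqr_ge0.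
rewrite mulr1 (@eq_Int _ _ (fun x => g x * psi I x))// => x.
rewrite /g; case: (K I) => _ z _.
have [sx|nsx] := boolP (stb I x); last by rewrite z// !mulr0.
suff -> : Om t x by rewrite mulr1.
apply/hasP; exists (I.1, I.2 - N); last by rewrite /= subrK; case: (I) sx.
by apply/mapP; exists I; rewrite ?mem_filter ?tW.
Qed.

Section Layers.
Variables (N0 M : nat).
Let c (i : nat) : R := sc (i%:Z - N0%:Z).
(** Up to constants and the truncation of levels, [U] is the translated maximal function of [w], and
    [V] the power q - 1 of the untranslated one. [G] is the sum of the geometric series of ratio
    2^(1-q). *)
Let U x := \sum_(i < M) c i * ib (Om (c i) x).
Let V x := \sum_(i < M) c i `^ (q - 1) * ib (Od (c i) x).
Let G := (1 - (2 `^ (q - 1))^-1)^-1.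
Let A := Int (fun x => w x `^ q) `^ q^-1.

Let c0 i : 0 < c i. Proof. exact: sc_gt0. Qed.
Let cS i : c i.+1 = 2 * c i.
Proof.
by rewrite /c (_ : i.+1%:Z - N0%:Z = i%:Z - N0%:Z + 1) ?scS//; lia.
Qed.
Let rho1 : 1 < 2 `^ (q - 1) :> R.
Proof.
suff : 1 `^ (q - 1) < 2 `^ (q - 1) :> R by rewrite powR1.
by apply: gt0_ltr_powR; rewrite ?subr_gt0 ?nnegrE ?ltr1n.
Qed.
Let G0 : 0 <= G.
Proof. by rewrite /G invr_ge0 subr_ge0 invf_le1 ?(lt_trans ltr01 rho1)// (ltW rho1). Qed.
Let A0 : 0 <= A. Proof. exact: powR_ge0. Qed.

Let cq i : c i `^ q = c i `^ (q - 1) * c i.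
Proof. by rewrite mulrC mulr_powRB1// ltW. Qed.

Let integ_wV : integ (fun x => w x * V x).
Proof.
apply: (@eq_integ _ (fun x => \sum_(i < M) c i `^ (q - 1) * (w x * ib (Od (c i) x)))).
  by move=> x; rewrite mulr_sumr; apply: eq_bigr => i _; rewrite mulrCA.
by apply: integ_sum => i; apply: integZ; exact: integ_wOd.
Qed.

Let Int_wV : Int (fun x => w x * V x) = \sum_(i < M) c i `^ (q - 1) * Int (fun x => w x * ib (Od (c i) x)).
Proof.
rewrite (@eq_Int _ _ (fun x => \sum_(i < M) c i `^ (q - 1) * (w x * ib (Od (c i) x)))).
  rewrite Int_sum; last by move=> i; apply: integZ; exact: integ_wOd.
  by apply: eq_bigr => i _; rewrite IntZ//; exact: integ_wOd.
by move=> x; rewrite mulr_sumr; apply: eq_bigr => i _; rewrite mulrCA.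
Qed.

(** Doob's argument. By Hoelder, [X] is at most [A] times the L^q' norm of [V]; by lacunarity this
    norm is at most [G * B ^ (1/q')]; and the weak type bound at each level gives [B <= X], so that
    [X] can be absorbed. *)
Lemma dyadic_maximal_dual : Int (fun x => w x * V x) <= (A * G) `^ q.
Proof.
set X := Int _; pose q' := q / (q - 1).
have qm0 : 0 < q - 1 by rewrite subr_gt0.
have q'0 : 0 < q' by rewrite divr_gt0.
have qq' : q^-1 + q'^-1 = 1 by rewrite /q'; field; rewrite !gt_eqF.
have V0 x : 0 <= V x by apply: sumr_ge0 => i _; rewrite mulr_ge0 ?powR_ge0.
have mV : measurable_fun setT V.
  apply: measurable_sum => i; apply: measurable_funM => //.
  by apply: measurable_bR; exact: measurable_Od.
have Vq x : V x `^ q' <= G `^ q' * \sum_(i < M) c i `^ q * ib (Od (c i) x).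
  apply: le_trans (@powR_sum_geo (fun i => c i `^ (q - 1)) G q' (fun i => Od (c i) x) M G0 q'0 _ _) _.
  - by move=> i; exact: powR_ge0.
  - apply: geometric_le => // [i|i]; first exact: powR_ge0.
    by rewrite cS powRM// ltW.
  have e : (q - 1) * q' = q by rewrite /q' mulrC divfK ?gt_eqF.
  by under eq_bigr do rewrite -powRrM e.
have iS : integ (fun x => \sum_(i < M) c i `^ q * ib (Od (c i) x)).
  by apply: integ_sum => i; apply: integZ; exact: integ_Od.
pose B := \sum_(i < M) c i `^ q * Int (fun x => ib (Od (c i) x)).
have B0 : 0 <= B by apply: sumr_ge0 => i _; rewrite mulr_ge0 ?powR_ge0 ?Int_ge0.
have X0 : 0 <= X by apply: Int_ge0 => x; rewrite mulr_ge0.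
have iVq : integ (fun x => V x `^ q').
  apply: integ_le (integZ (G `^ q') iS); first exact: (measurableT_comp (measurable_powR _) mV).
  by move=> x; rewrite ger0_norm ?powR_ge0.
have IVq : Int (fun x => V x `^ q') <= G `^ q' * B.
  apply: le_trans (Int_le iVq (integZ _ iS) Vq) _.
  rewrite IntZ// Int_sum; last by move=> i; apply: integZ; exact: integ_Od.
  by under eq_bigr do rewrite IntZ ?(integ_Od)//.
have BX : B <= X.
  rewrite /X Int_wV; apply: ler_sum => i _; rewrite cq -mulrA ler_wpM2l ?powR_ge0//.
  exact: maximal_weak (@level_avg (c i)).
apply: absorb => //; first exact: mulr_ge0.
have [_] := holder q0 q'0 qq' (integ_mf iw) mV w0 V0 iwq iVq.
rewrite -/X -/A => h.
have hT : Int (fun x => V x `^ q') `^ q'^-1 <= G * X `^ (1 - q^-1).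
  have -> : 1 - q^-1 = q'^-1 by rewrite -qq' addrC addKr.
  apply: le_trans (_ : (G `^ q' * B) `^ q'^-1 <= _).
    rewrite ge0_ler_powR ?nnegrE ?invr_ge0 ?(ltW q'0) ?mulr_ge0 ?powR_ge0//.
    by apply: Int_ge0 => x; rewrite powR_ge0.
  exact: powR_root_le.
by rewrite -mulrA; exact: le_trans h (ler_wpM2l A0 hT).
Qed.

(** Summing the translated weak type bounds with weights [c i ^ (q - 1)] rebuilds the integral of
    [w * V]. The translation thus costs only the q-th root of [7 * D.+1], which is bounded by
    [7 * D.+1] itself. *)
Lemma shifted_maximal_strong : integ (fun x => U x `^ q) /\
  Int (fun x => U x `^ q) `^ q^-1 <= 2 * (7 * D.+1%:R) * (A * G).
Proof.
have iS : integ (fun x => \sum_(i < M) c i `^ q * ib (Om (c i) x)).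
  by apply: integ_sum => i; apply: integZ; exact: integ_Om.
have Uq x : U x `^ q <= 2 `^ q * \sum_(i < M) c i `^ q * ib (Om (c i) x).
  apply: (@powR_sum_geo c 2 q (fun i => Om (c i) x)) => // [i|m]; first exact: ltW.
  have -> : 2 = (1 - 2^-1)^-1 :> R by field.
  by apply: geometric_le => //; [rewrite ltr1n|move=> i; exact: ltW].
have mU : measurable_fun setT U.
  apply: measurable_sum => i; apply: measurable_funM => //.
  by apply: measurable_bR; exact: measurable_Om.
have iU : integ (fun x => U x `^ q).
  apply: integ_le (integZ (2 `^ q) iS); first exact: (measurableT_comp (measurable_powR _) mU).
  by move=> x; rewrite ger0_norm ?powR_ge0.
split => //.
have D0 : 0 <= 7 * D.+1%:R :> R by rewrite mulr_ge0.
have AG : 0 <= A * G by rewrite mulr_ge0.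
have h : Int (fun x => U x `^ q) <= 2 `^ q * (7 * D.+1%:R * (A * G) `^ q).
  apply: le_trans (Int_le iU (integZ _ iS) Uq) _.
  rewrite IntZ// ler_wpM2l ?powR_ge0//.
  apply: le_trans (_ : 7 * D.+1%:R * Int (fun x => w x * V x) <= _); last first.
    by rewrite ler_wpM2l//; exact: dyadic_maximal_dual.
  rewrite Int_wV Int_sum; last by move=> i; apply: integZ; exact: integ_Om.
  rewrite mulr_sumr; apply: ler_sum => i _; rewrite IntZ; last exact: integ_Om.
  rewrite cq -mulrA [leRHS]mulrCA ler_wpM2l ?powR_ge0//.
  exact: shifted_maximal_weak (@level_avg (c i)) _ _ ND.
have D7 : 1 <= 7 * D.+1%:R :> R by rewrite -natrM ler1n.
have I0 : 0 <= Int (fun x => U x `^ q) by apply: Int_ge0 => x; exact: powR_ge0.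
move: h I0; move: (Int _) (A * G) AG (7 * D.+1%:R) D0 D7 => J P P0 d d0 d1 h J0.
apply: le_trans (_ : (2 `^ q * (d * P `^ q)) `^ q^-1 <= _).
  by rewrite ge0_ler_powR ?nnegrE ?invr_ge0 ?(ltW q0) ?mulr_ge0 ?powR_ge0.
rewrite !powRM ?mulr_ge0 ?powR_ge0// -!powRrM mulfV ?gt_eqF// !powRr1//.
rewrite mulrA; apply: ler_wpM2r => //; apply: ler_wpM2l => //.
by apply: ler1_powR => //; rewrite invf_le1// ltW.
Qed.

(** On each layer [bessel_level] leaves the integral of [f ^+ 2] over [Om (c i)]. These add up to
    the integral of [f ^+ 2 * U], and Hoelder with exponents [p / 2] and [q] separates the two
    factors. *)
Lemma weighted_layers :
  (forall I, I \in s -> W I <= 2 * \sum_(i < M) c i * ib (c i < W I)) ->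
  \sum_(I <- s) sc I.1 * Int (fun x => f x * psi I x) ^+ 2 * W I <=
  2 * 2700 * (Int (fun x => `|f x| `^ p) `^ (p / 2)^-1 * (2 * (7 * D.+1%:R) * (A * G))).
Proof.
move=> lay.
have p20 : 0 < p / 2 by rewrite divr_gt0// (lt_trans _ p2).
have [iU IU] := shifted_maximal_strong.
have U0 x : 0 <= U x by apply: sumr_ge0 => i _; rewrite mulr_ge0// ltW.
have mU : measurable_fun setT U.
  apply: measurable_sum => i; apply: measurable_funM => //.
  by apply: measurable_bR; exact: measurable_Om.
have fp x : (f x ^+ 2) `^ (p / 2) = `|f x| `^ p.
  rewrite -[f x ^+ 2]real_normK ?num_real// -powR_mulrn// -powRrM.
  by congr (_ `^ _); field.
have if2 : integ (fun x => (f x ^+ 2) `^ (p / 2)) by apply: eq_integ ifp => x; rewrite fp.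
have [ifU] := holder p20 q0 pq (measurable_funX 2 mf) mU (fun x => sqr_ge0 (f x)) U0 if2 iU.
rewrite (eq_Int fp) => hf.
apply: le_trans (_ : 2 * 2700 * Int (fun x => f x ^+ 2 * U x) <= _); last first.
  apply: ler_wpM2l; first exact: mulr_ge0 (ler0n _ _) (ler0n _ _).
  exact: le_trans hf (ler_wpM2l (powR_ge0 _ _) IU).
have -> : Int (fun x => f x ^+ 2 * U x) = \sum_(i < M) c i * Int (fun x => f x ^+ 2 * ib (Om (c i) x)).
  rewrite (@eq_Int _ _ (fun x => \sum_(i < M) c i * (f x ^+ 2 * ib (Om (c i) x)))).
    rewrite Int_sum; last by move=> i; apply: integZ; exact: integ_f2Om.
    by apply: eq_bigr => i _; rewrite IntZ//; exact: integ_f2Om.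
  by move=> x; rewrite mulr_sumr; apply: eq_bigr => i _; rewrite mulrCA.
apply: le_trans (_ : \sum_(I <- s) \sum_(i < M) 2 * (c i *
   (sc I.1 * Int (fun x => f x * psi I x) ^+ 2 * ib (c i < W I))) <= _).
  rewrite big_seq [leRHS]big_seq; apply: ler_sum => I /lay h.
  apply: le_trans (ler_wpM2l _ h) _; first by rewrite mulr_ge0 ?sqr_ge0.
  rewrite !mulr_sumr le_eqVlt; apply/orP; left; apply/eqP.
  by apply: eq_bigr => i _; ring.
rewrite exchange_big /= mulr_sumr; apply: ler_sum => i _.
rewrite -!mulr_sumr -[2 * 2700 * _]mulrA [2700 * _]mulrCA.
by rewrite !ler_wpM2l ?(ltW (c0 i))//; exact: bessel_level.
Qed.

End Layers.

Lemma weighted_square :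
  \sum_(I <- s) sc I.1 * Int (fun x => f x * psi I x) ^+ 2 * W I <=
  2 * 2700 * (Int (fun x => `|f x| `^ p) `^ (p / 2)^-1 *
    (2 * (7 * D.+1%:R) * (Int (fun x => w x `^ q) `^ q^-1 * (1 - (2 `^ (q - 1))^-1)^-1))).
Proof.
have W0 I : 0 <= W I.
  by rewrite mulr_ge0// Int_ge0// => x; rewrite mulr_ge0.
have [N0 hN] := dyadic_range s W0.
have lay I : I \in s -> W I <= 2 * \sum_(i < (N0 + N0)%N) sc (i%:Z - N0%:Z) * ib (sc (i%:Z - N0%:Z) < W I).
  move=> /hN [->|/andP[h1 h2]].
    by rewrite mulr_ge0// sumr_ge0// => i _; rewrite mulr_ge0.
  by apply: dyadic_layer => //; rewrite PoszD addrK.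
exact: weighted_layers lay.
Qed.

End Fixed.
End Weighted.

(** * Decomposition of a decaying function of integral zero into localised pieces *)

Section Molecule.
Variable R : realType.
Implicit Types (x y : R) (n : int).

(** All decay is measured in powers of this weight: it is integrable, varies by at most a factor 3
    over distance 1, and is also the limit of the Poisson kernels in the uniqueness argument for the
    Fourier transform. *)
Definition th x : R := (1 + x ^+ 2)^-1.

Lemma den_gt0 x : 0 < 1 + x ^+ 2.
Proof. by rewrite ltr_pwDl// sqr_ge0. Qed.

Lemma th_gt0 x : 0 < th x. Proof. by rewrite invr_gt0 den_gt0. Qed.
Lemma th_ge0 x : 0 <= th x. Proof. exact/ltW/th_gt0. Qed.

Lemma th_le1 x : th x <= 1.
Proof. by rewrite invf_le1 ?den_gt0// lerDl sqr_ge0. Qed.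

Lemma th_le x y : `|y| <= `|x| -> th x <= th y.
Proof.
move=> h; rewrite lef_pV2 ?posrE ?den_gt0// lerD2l.
by rewrite -(real_normK (num_real x)) -(real_normK (num_real y)) lerXn2r ?nnegrE.
Qed.

Lemma th_near x y : `|x - y| <= 1 -> th x <= 3 * th y.
Proof.
rewrite ler_norml => /andP[h1 h2].
rewrite -[3]invrK -invfM lef_pV2 ?posrE ?mulr_gt0 ?invr_gt0 ?den_gt0//.
have h3 : (x - y) ^+ 2 <= 1 by rewrite -real_normK ?num_real// exprn_ile1// ler_norml h1.
by rewrite mulrC ler_pdivrMr//; have := sqr_ge0 (2 * x - y); nra.
Qed.

Lemma measurable_th : measurable_fun setT th.
Proof.
apply: continuous_measurable_fun => x; apply: cvgV; first by rewrite gt_eqF ?den_gt0.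
by apply: cvgD; [exact: cvg_cst|exact: exprn_continuous].
Qed.

Lemma integ_th : integ th.
Proof.
apply: (@nneg_integ _ _ pi); first exact: measurable_th.
  exact: th_ge0.
rewrite ge0_symfun_integralT.
- rewrite (_ : [set x | 0 <= x] = `[0, +oo[%classic); last by rewrite set_itvcy.
  have := @integral0y_oneDsqr R; rewrite /oneDsqr /th => ->.
  by rewrite -EFinM mulrC divfK.
- exact: th_ge0.
- move=> x; apply: cvgV; first by rewrite gt_eqF ?den_gt0.
  by apply: cvgD; [exact: cvg_cst|exact: exprn_continuous].
- by move=> x /=; rewrite /th sqrrN.
Qed.

Lemma Int_th_gt0 : 0 < Int th.
Proof.
apply: (@lt_le_trans _ _ (Int (fun x => 2^-1 * ib (0 <= x < 1)))).
  by rewrite IntZ ?Int_itv ?subr0 ?mulr1//; exact: integ_itv.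
apply: Int_le; [exact/integZ/integ_itv|exact: integ_th|move=> x].
case: andP => [[x0 x1]|_]; last by rewrite mulr0 th_ge0.
by rewrite mulr1 lef_pV2 ?posrE ?den_gt0//; nra.
Qed.

(** The partition of unity into tents is expressed through ramps so that sums of consecutive [tau n]
    telescope. *)
Definition ramp y : R := if y <= 0 then 1 else if y <= 1 then 1 - y else 0.
Definition tent y : R := ramp y - ramp (y + 1).

Lemma ramp_lip x y : `|ramp x - ramp y| <= `|x - y|.
Proof.
rewrite ler_norml /ramp; have := ler_norm (x - y); have := ler_norm (y - x).
rewrite (distrC y x) => h1 h2.
by case: (leP x 0) => ?; case: (leP y 0) => ?; case: (leP x 1) => ?; case: (leP y 1) => ?;
  apply/andP; split; lra.
Qed.

Lemma ramp_ge0 x : 0 <= ramp x.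
Proof. by rewrite /ramp; case: (leP x 0) => ?; case: (leP x 1) => ?; lra. Qed.

Lemma ramp_le1 x : ramp x <= 1.
Proof. by rewrite /ramp; case: (leP x 0) => ?; case: (leP x 1) => ?; lra. Qed.

Lemma tent_lip x y : `|tent x - tent y| <= 2 * `|x - y|.
Proof.
rewrite (_ : _ - _ = (ramp x - ramp y) - (ramp (x + 1) - ramp (y + 1))); last by rewrite /tent; ring.
rewrite (le_trans (ler_normB _ _))// mulr_natl mulr2n lerD ?ramp_lip//.
by rewrite (le_trans (ramp_lip _ _))// (_ : _ - _ = x - y)//; ring.
Qed.

Lemma tent_ge0 x : 0 <= tent x.
Proof.
rewrite /tent /ramp; case: (leP x 0) => ?; case: (leP x 1) => ?;
  case: (leP (x + 1) 0) => ?; case: (leP (x + 1) 1) => ?; lra.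
Qed.

Lemma tent_le1 x : tent x <= 1.
Proof. by rewrite /tent; have := ramp_ge0 (x + 1); have := ramp_le1 x; lra. Qed.

Lemma tent_norm x : `|tent x| <= 1.
Proof. by rewrite ger0_norm ?tent_ge0 ?tent_le1. Qed.

Lemma tent_out x : 1 <= `|x| -> tent x = 0.
Proof.
rewrite ler_normr /tent /ramp => /orP[] h; case: (leP x 0) => ?; case: (leP x 1) => ?;
  case: (leP (x + 1) 0) => ?; case: (leP (x + 1) 1) => ?; lra.
Qed.

Lemma measurable_ramp : measurable_fun setT ramp.
Proof. by apply: (@lipschitz_measurable _ 1) => x y; rewrite mul1r ramp_lip. Qed.

Lemma measurable_tent : measurable_fun setT tent.
Proof. exact: lipschitz_measurable tent_lip. Qed.

Lemma integ_tent : integ tent.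
Proof.
apply: integ_le (integ_itv (-1) 1); first exact: measurable_tent.
move=> x; have [h|h] := boolP (-1 <= x < 1); first exact: tent_norm.
rewrite tent_out ?normr0//; move: h; rewrite negb_and -ltNge -leNgt ler_normr.
by case/orP => h; apply/orP; [right|left]; lra.
Qed.

(** Kept symbolic; the lower bound 1/2 controls the divisions by it. *)
Definition kap := Int tent.

Lemma kap_ge : 2^-1 <= kap.
Proof.
apply: (@le_trans _ _ (Int (fun x => 2^-1 * ib (- 2^-1 <= x < 2^-1)))).
  rewrite IntZ ?Int_itv; [lra|lra|exact: integ_itv].
apply: Int_le; [exact/integZ/integ_itv|exact: integ_tent|move=> x].
case: andP => [[h1 h2]|_]; last by rewrite mulr0 tent_ge0.
rewrite mulr1 /tent /ramp; case: (leP x 0) => ?; case: (leP x 1) => ?;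
  case: (leP (x + 1) 0) => ?; case: (leP (x + 1) 1) => ?; lra.
Qed.

Lemma kap_gt0 : 0 < kap. Proof. by apply: lt_le_trans kap_ge. Qed.

Lemma kapV_le2 : kap^-1 <= 2.
Proof. by rewrite -[2]invrK lef_pV2 ?posrE ?kap_gt0 ?kap_ge. Qed.

Definition tau n x : R := tent (x - n%:~R).
Definition rho n x : R := ramp (x - n%:~R).

Lemma tauE n x : tau n x = rho n x - rho (n - 1) x.
Proof. by rewrite /tau /tent /rho intrB; congr (_ - ramp _); ring. Qed.

Lemma measurable_shift (g : R -> R) b : measurable_fun setT g -> measurable_fun setT (fun x => g (x - b)).
Proof.
move=> mg; have := measurable_affine 1 (- b) mg.
by apply: eq_measurable_fun => x _; rewrite mul1r.
Qed.

Lemma measurable_tau n : measurable_fun setT (tau n).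
Proof. by apply: measurable_shift; exact: measurable_tent. Qed.

Lemma measurable_rho n : measurable_fun setT (rho n).
Proof. by apply: measurable_shift; exact: measurable_ramp. Qed.

Lemma integ_tau n : integ (tau n).
Proof.
apply: eq_integ (integ_affine (- n%:~R) (oner_neq0 _) integ_tent).
by move=> x; rewrite mul1r.
Qed.

Lemma Int_tau n : Int (tau n) = kap.
Proof.
rewrite /kap -[RHS]mul1r -[X in X * _](invr1) -[X in X^-1 * _](normr1 R).
rewrite -(Int_affine (- n%:~R) (oner_neq0 _) integ_tent).
by apply: eq_Int => x; rewrite mul1r.
Qed.

(** Of the three powers of decay, one is spent on integrating tails ([tailmass_le]), which leaves
    [th n ^+ 2] for the n-th piece. Of these two, one pays for the translation by 2^m - n and the
    other makes the sum over n converge. *)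
Definition molecule (C : R) (Phi : R -> R) : Prop :=
  [/\ measurable_fun setT Phi, forall x, `|Phi x| <= C * th x ^+ 3,
      forall n x y, `|x - n%:~R| <= 1 -> `|y - n%:~R| <= 1 ->
        `|Phi x - Phi y| <= C * th n%:~R ^+ 2 * `|x - y|
    & Int Phi = 0].

Section Fixed.
Variables (C : R) (Phi : R -> R).
Hypothesis mol : molecule C Phi.

Let C0 : 0 <= C.
Proof.
case: mol => _ /(_ 0) h _ _; move: h; rewrite /th expr0n addr0 invr1 expr1n mulr1.
exact: le_trans.
Qed.

Lemma molecule_integ : integ Phi.
Proof.
case: mol => m h _ _; apply: integ_le (integZ C integ_th) => // x.
rewrite (le_trans (h x))// ler_wpM2l// exprS ler_piMr ?th_ge0//.
by rewrite exprn_ile1 ?th_ge0 ?th_le1.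
Qed.

Lemma molecule_le x (t : R) : th x <= t -> `|Phi x| <= C * t ^+ 2 * th x.
Proof.
move=> h; case: mol => _ /(_ x) h1 _ _; apply: (le_trans h1).
rewrite -mulrA ler_wpM2l// exprSr ler_wpM2r ?th_ge0// lerXn2r ?nnegrE ?th_ge0//.
exact: le_trans (th_ge0 x) h.
Qed.

Let integM_bdd (h : R -> R) : measurable_fun setT h -> (forall x, `|h x| <= 1) ->
  integ (fun x => Phi x * h x).
Proof.
move=> mh h1; apply: integ_le (integ_norm molecule_integ).
  by apply: measurable_funM => //; exact: integ_mf molecule_integ.
by move=> x; rewrite normrM ler_piMr.
Qed.

Lemma integ_rho n : integ (fun x => Phi x * rho n x).
Proof.
apply: integM_bdd; first exact: measurable_rho.
by move=> x; rewrite ger0_norm ?ramp_ge0 ?ramp_le1.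
Qed.

Lemma integ_Phitau n : integ (fun x => Phi x * tau n x).
Proof. by apply: integM_bdd; [exact: measurable_tau|move=> x; exact: tent_norm]. Qed.

Definition tailmass n := Int (fun x => Phi x * rho n x).

Lemma tailmassB n : Int (fun x => Phi x * tau n x) = tailmass n - tailmass (n - 1).
Proof.
rewrite /tailmass -IntB; [|exact: integ_rho..].
by apply: eq_Int => x; rewrite tauE mulrBr.
Qed.

(** For n < 0 the ramp confines the integral to x <= n + 1. For n >= 0 the vanishing integral of
    [Phi] allows [rho n] to be replaced by [1 - rho n], which lives on x >= n. *)
Lemma tailmass_le n : `|tailmass n| <= 9 * C * Int th * th n%:~R ^+ 2.
Proof.
have key (h : R -> R) : integ (fun x => Phi x * h x) ->
    (forall x, `|h x| <= 1) -> (forall x, h x != 0 -> th x <= 3 * th n%:~R) ->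
    `|Int (fun x => Phi x * h x)| <= 9 * C * Int th * th n%:~R ^+ 2.
  move=> ih h1 hz.
  rewrite (_ : _ * _ = (C * (3 * th n%:~R) ^+ 2) * Int th); last by rewrite exprMn; ring.
  rewrite -IntZ; last exact: integ_th.
  apply: Int_abs_le => //; first exact/integZ/integ_th.
  move=> x; rewrite normrM; have [->|/hz hx] := eqVneq (h x) 0.
    by rewrite normr0 mulr0 !mulr_ge0 ?exprn_ge0 ?mulr_ge0 ?th_ge0.
  by apply: le_trans (molecule_le hx); rewrite ler_piMr.
have [n0|n0] := leP 0 n; last first.
  apply: key; first exact: integ_rho.
    by move=> x; rewrite ger0_norm ?ramp_ge0 ?ramp_le1.
  move=> x; rewrite /rho /ramp => hx.
  have {hx} : x <= n%:~R + 1.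
    by move: hx; case: leP => ?; [lra|case: leP => ?; [lra|rewrite eqxx]].
  have n1 : n%:~R + 1 <= 0 :> R by rewrite -(intrD _ _ 1) lerz0; lia.
  move=> hx; apply: le_trans (_ : th (n%:~R + 1) <= _).
    by apply: th_le; rewrite !ler0_norm; lra.
  by apply: th_near; rewrite addrAC subrr add0r normr1.
have -> : tailmass n = - Int (fun x => Phi x * (1 - rho n x)).
  rewrite (@eq_Int _ _ (fun x => Phi x - Phi x * rho n x)) ?IntB.
  - by case: mol => _ _ _ ->; rewrite sub0r opprK.
  - exact: molecule_integ.
  - exact: integ_rho.
  - by move=> x; rewrite mulrBr mulr1.
have nr0 : 0 <= n%:~R :> R by rewrite ler0z.
rewrite normrN; apply: key.
- apply: integM_bdd; first by apply: measurable_funB => //; exact: measurable_rho.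
  by move=> x; rewrite ger0_norm; have := ramp_ge0 (x - n%:~R); have := ramp_le1 (x - n%:~R); rewrite /rho; lra.
- by move=> x; rewrite ger0_norm; have := ramp_ge0 (x - n%:~R); have := ramp_le1 (x - n%:~R); rewrite /rho; lra.
move=> x; rewrite /rho /ramp => hx.
have {}hx : n%:~R <= x.
  by move: hx; case: leP => ?; [rewrite subrr eqxx|lra].
apply: (@le_trans _ _ (th n%:~R)); first by apply: th_le; rewrite !ger0_norm; lra.
by have := th_ge0 n%:~R; lra.
Qed.

(* The corrections carry the mass of [Phi * tau n] to the neighbouring tents, so
   that each piece has mean zero; they telescope, and what is left of them tends to
   0 because [Int Phi = 0]. *)
Definition piece n x := Phi x * tau n x - kap^-1 * tailmass n * tau n x
  + kap^-1 * tailmass (n - 1) * tau (n - 1) x.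

Lemma piece_integ n : integ (piece n).
Proof.
apply: integD; last exact/integZ/integ_tau.
by apply: integB; [exact: integ_Phitau|exact/integZ/integ_tau].
Qed.

Lemma Int_piece n : Int (piece n) = 0.
Proof.
rewrite /piece IntD; last 2 first.
- by apply: integB; [exact: integ_Phitau|exact/integZ/integ_tau].
- exact/integZ/integ_tau.
rewrite IntB; last 2 first.
- exact: integ_Phitau.
- exact/integZ/integ_tau.
rewrite !IntZ; [|exact: integ_tau..].
by rewrite !Int_tau tailmassB; field; rewrite gt_eqF// kap_gt0.
Qed.

Lemma piece_out n x : ~~ (n%:~R - 2 <= x <= n%:~R + 1) -> piece n x = 0.
Proof.
rewrite negb_and -!ltNge => h; rewrite /piece.
have -> : tau n x = 0.
  by apply: tent_out; rewrite ler_normr; case/orP: h => h; apply/orP; [right|left]; lra.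
have -> : tau (n - 1) x = 0.
  by apply: tent_out; rewrite intrB ler_normr; case/orP: h => h; apply/orP; [right|left]; lra.
by ring.
Qed.

(** 55 = 1 + 2 * 27 comes from the product [Phi * tau n], and 360 = 36 + 9 * 36 from the two
    corrections, the second one being centred at n - 1. *)
Definition piece_const := C * (55 + 360 * Int th).

Lemma Phitau_lip n x y :
  `|Phi x * tau n x - Phi y * tau n y| <= 55 * C * th n%:~R ^+ 2 * `|x - y|.
Proof.
have t2 : th n%:~R ^+ 3 <= th (n%:~R : R) ^+ 2.
  by rewrite exprSr ler_piMr ?th_le1 ?exprn_ge0 ?th_ge0.
have tau_lip : `|tau n x - tau n y| <= 2 * `|x - y|.
  rewrite (le_trans (tent_lip _ _))// (_ : _ - _ = x - y)//; ring.
have Ct0 : 0 <= C * th n%:~R ^+ 2 * `|x - y| by rewrite !mulr_ge0 ?exprn_ge0 ?th_ge0.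
have sz z : `|z - n%:~R| <= 1 -> `|Phi z| <= 27 * C * th n%:~R ^+ 2.
  move=> hz; case: mol => _ /(_ z) h _ _; apply: (le_trans h).
  apply: le_trans (_ : C * (3 * th n%:~R) ^+ 3 <= _).
    by rewrite ler_wpM2l// lerXn2r ?nnegrE ?mulr_ge0 ?th_ge0// th_near.
  rewrite exprMn (_ : C * _ = 27 * C * th n%:~R ^+ 3); last by ring.
  by apply: ler_wpM2l => //; apply: mulr_ge0.
have one u v : `|u - n%:~R| <= 1 -> 1 <= `|v - n%:~R| -> `|tau n u - tau n v| <= 2 * `|u - v| ->
    `|Phi u * tau n u - Phi v * tau n v| <= 54 * C * th n%:~R ^+ 2 * `|u - v|.
  move=> hu hv ht; have tv : tau n v = 0 by exact: tent_out.
  rewrite tv mulr0 subr0 -[tau n u]subr0 -{1}tv normrM.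
  apply: le_trans (ler_pM _ _ (sz _ hu) ht) _ => //.
  by rewrite le_eqVlt; apply/orP; left; apply/eqP; ring.
have [hx|hx] := leP `|x - n%:~R| 1; have [hy|hy] := leP `|y - n%:~R| 1.
- rewrite (_ : _ - _ = (Phi x - Phi y) * tau n x + Phi y * (tau n x - tau n y)); last by ring.
  rewrite (le_trans (ler_normD _ _))// !normrM.
  case: mol => _ _ /(_ n x y hx hy) h _.
  have h1 : `|Phi x - Phi y| * `|tau n x| <= C * th n%:~R ^+ 2 * `|x - y|.
    by apply: le_trans h; rewrite ler_piMr// tent_norm.
  have h2 : `|Phi y| * `|tau n x - tau n y| <= 27 * C * th n%:~R ^+ 2 * (2 * `|x - y|).
    by apply: ler_pM => //; exact: sz.
  by move: h1 h2; lra.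
- by apply: (le_trans (one x y hx (ltW hy) tau_lip)); lra.
- rewrite distrC; apply: (le_trans (one y x hy (ltW hx) _)); first by rewrite distrC (distrC y).
  by rewrite (distrC y); lra.
- rewrite /tau !tent_out ?(ltW hx) ?(ltW hy)// !mulr0 subrr normr0.
  by lra.
Qed.

Lemma piece_lip n x y : `|piece n x - piece n y| <= piece_const * th n%:~R ^+ 2 * `|x - y|.
Proof.
have I0 := ltW Int_th_gt0.
have kk := kapV_le2; have k0 : 0 <= kap^-1 by rewrite invr_ge0 ltW ?kap_gt0.
have tau_lip k : `|tau k x - tau k y| <= 2 * `|x - y|.
  rewrite (le_trans (tent_lip _ _))// (_ : _ - _ = x - y)//; ring.
have t1 : th (n - 1)%:~R ^+ 2 <= 9 * th (n%:~R : R) ^+ 2.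
  rewrite (_ : 9 * _ = (3 * th n%:~R) ^+ 2); last by ring.
  rewrite lerXn2r ?nnegrE ?mulr_ge0 ?th_ge0// th_near//.
  by rewrite intrB addrAC subrr add0r normrN normr1.
have CI0 : 0 <= C * Int th by rewrite mulr_ge0.
have tm k : `|kap^-1 * tailmass k * (tau k x - tau k y)| <= 36 * (C * Int th) * th k%:~R ^+ 2 * `|x - y|.
  rewrite !normrM (ger0_norm k0).
  apply: le_trans (_ : 2 * (9 * C * Int th * th k%:~R ^+ 2) * (2 * `|x - y|) <= _).
    by apply: ler_pM; rewrite ?mulr_ge0//; apply: ler_pM => //; exact: tailmass_le.
  by rewrite le_eqVlt; apply/orP; left; apply/eqP; ring.
rewrite (_ : _ - _ = (Phi x * tau n x - Phi y * tau n y)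
   - kap^-1 * tailmass n * (tau n x - tau n y)
   + kap^-1 * tailmass (n - 1) * (tau (n - 1) x - tau (n - 1) y)); last by rewrite /piece; ring.
rewrite (le_trans (ler_normD _ _))//.
rewrite (le_trans (lerD (ler_normB _ _) (lexx _)))//.
apply: le_trans (lerD (lerD (Phitau_lip n x y) (tm n)) (tm (n - 1))) _.
have h : 36 * (C * Int th) * `|x - y| * th (n - 1)%:~R ^+ 2 <= 36 * (C * Int th) * `|x - y| * (9 * th n%:~R ^+ 2).
  by apply: ler_wpM2l => //; rewrite !mulr_ge0.
rewrite /piece_const; move: h; lra.
Qed.

Lemma sum_piece (N : nat) x : \sum_(i < (N + N)%N) piece (i%:Z - N%:Z + 1) x =
  Phi x * (rho N%:Z x - rho (- N%:Z) x)
  - kap^-1 * (tailmass N%:Z * tau N%:Z x - tailmass (- N%:Z) * tau (- N%:Z) x).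
Proof.
pose u (i : nat) := Phi x * rho (i%:Z - N%:Z) x - kap^-1 * (tailmass (i%:Z - N%:Z) * tau (i%:Z - N%:Z) x).
transitivity (\sum_(0 <= i < (N + N)%N) (u i.+1 - u i)).
  rewrite big_mkord; apply: eq_bigr => i _; rewrite /piece /u.
  have e : i.+1%:Z - N%:Z = i%:Z - N%:Z + 1 by lia.
  rewrite -e tauE e addrK; ring.
by rewrite telescope_sumr// /u PoszD addrK sub0r; ring.
Qed.

(** What is left over lives where [|x|] is at least about N. One power of decay gives the factor
    [th N], and another is kept so that the error remains integrable against [f]. *)
Lemma sum_piece_error (N : nat) x :
  `|Phi x - \sum_(i < (N + N)%N) piece (i%:Z - N%:Z + 1) x| <=
  C * (6 + 108 * Int th) * (th N%:R * th x).
Proof.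
have I0 := ltW Int_th_gt0.
have CI0 : 0 <= C * Int th by rewrite mulr_ge0.
have thx := th_ge0 x; have thN : 0 <= th (N%:R : R) by exact: th_ge0.
have k0 : 0 <= kap^-1 by rewrite invr_ge0 ltW ?kap_gt0.
have NE : N%:Z%:~R = N%:R :> R by [].
have NNE : (- N%:Z)%:~R = - N%:R :> R by rewrite intrN.
have N0 : 0 <= N%:R :> R by [].
have thNN : th (- N%:R : R) = th N%:R by rewrite /th sqrrN.
rewrite sum_piece.
rewrite (_ : _ - _ = Phi x * ((1 - rho N%:Z x) + rho (- N%:Z) x)
  + kap^-1 * (tailmass N%:Z * tau N%:Z x) - kap^-1 * (tailmass (- N%:Z) * tau (- N%:Z) x)); last by ring.
have tm k : th k%:~R = th (N%:R : R) ->
    `|kap^-1 * (tailmass k * tau k x)| <= 54 * (C * Int th) * (th N%:R * th x).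
  move=> kN; have [h|h] := leP 1 `|x - k%:~R|.
    by rewrite /tau tent_out// !mulr0 normr0 !mulr_ge0.
  have hx : th N%:R <= 3 * th x by rewrite -kN th_near// distrC ltW.
  rewrite !normrM (ger0_norm k0).
  apply: le_trans (_ : 2 * ((9 * C * Int th * th N%:R ^+ 2) * 1) <= _).
    apply: ler_pM; rewrite ?mulr_ge0 ?kapV_le2//.
    by apply: ler_pM => //; [rewrite -kN tailmass_le|exact: tent_norm].
  have : C * Int th * th N%:R * th N%:R <= C * Int th * th N%:R * (3 * th x).
    by apply: ler_wpM2l => //; rewrite mulr_ge0.
  by rewrite expr2; lra.
have main : `|Phi x * ((1 - rho N%:Z x) + rho (- N%:Z) x)| <= 6 * C * (th N%:R * th x).
  rewrite normrM; set r := _ + _.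
  have r2 : `|r| <= 2.
    rewrite ger0_norm /r /rho; have := ramp_ge0 (x - N%:Z%:~R); have := ramp_le1 (x - N%:Z%:~R);
    have := ramp_ge0 (x - (- N%:Z)%:~R); have := ramp_le1 (x - (- N%:Z)%:~R); lra.
  have [r0|r0] := eqVneq r 0; first by rewrite r0 normr0 mulr0 !mulr_ge0.
  have hx : th x <= 3 * th N%:R.
    have [hN|hN] := leP N%:R x.
      apply: (@le_trans _ _ (th N%:R)); last by lra.
      by apply: th_le; rewrite !ger0_norm//; lra.
    have hN' : x <= - N%:R + 1.
      rewrite leNgt; apply/negP => h; move/eqP: r0; apply.
      rewrite /r /rho /ramp NE NNE; case: (leP (x - N%:R) 0) => ?; [|lra].
      case: leP => ?; [lra|]; case: leP => ?; [lra|ring].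
    have [hx0|hx0] := leP x 0; last first.
      by apply: th_near; rewrite ler_norml; apply/andP; split; lra.
    have [hh|hh] := leP x (- N%:R).
      apply: (@le_trans _ _ (th N%:R)); last by lra.
      by apply: th_le; rewrite (ler0_norm hx0) ger0_norm//; lra.
    rewrite -thNN; apply: th_near; rewrite ler_norml; apply/andP; split; lra.
  case: mol => _ /(_ x) h _ _.
  have h2 : th x ^+ 3 <= 3 * th N%:R * th x.
    rewrite exprSr; apply: ler_wpM2r => //; apply: le_trans hx.
    by rewrite expr2 ler_piMr// th_le1.
  have h3 : `|Phi x| <= C * (3 * th N%:R * th x).
    by apply: (le_trans h); exact: ler_wpM2l.
  apply: le_trans (ler_pM _ _ h3 r2) _ => //.
  by rewrite le_eqVlt; apply/orP; left; apply/eqP; ring.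
have tm1 := tm N%:Z (congr1 th NE).
have tm2 := tm (- N%:Z) (etrans (congr1 th NNE) thNN).
rewrite (le_trans (ler_normB _ _))// (le_trans (lerD (ler_normD _ _) (lexx _)))//.
by apply: le_trans (lerD (lerD main tm1) tm2) _; lra.
Qed.

End Fixed.
End Molecule.

(** * Duality, convolutions with molecules, and the weighted square estimate *)

Section SquareFunction.
Variable R : realType.
Local Notation sc := (pow2 R).
#[local] Hint Extern 0 (is_true (0 < sc _)) => exact: sc_gt0 : core.
#[local] Hint Extern 0 (is_true (0 <= sc _)) => exact: sc_ge0 : core.
#[local] Hint Extern 0 (is_true (sc _ != 0)) => exact: sc_neq0 : core.
Implicit Types (I J : int * int) (x y : R).

(* Test the hypothesis on the (P - 1)-st power of the step function itself. *)
Lemma duality (s : seq (int * int)) (b : int * int -> R) (P q L : R) :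
  1 < P -> 0 < q -> P^-1 + q^-1 = 1 -> (forall I, 0 <= b I) -> 0 <= L ->
  (forall w : R -> R, (forall x, 0 <= w x) -> integ w -> integ (fun x => w x `^ q) ->
    \sum_(I <- s) b I * Int (fun x => w x * ib (dyb I x)) <= L * Int (fun x => w x `^ q) `^ q^-1) ->
  integ (fun x => (\sum_(I <- s) b I * ib (dyb I x)) `^ P) /\
  Int (fun x => (\sum_(I <- s) b I * ib (dyb I x)) `^ P) <= L `^ P.
Proof.
move=> P1 q0 Pq b0 L0 h; have P0 : 0 < P by exact: lt_trans P1.
pose S x := \sum_(I <- s) b I * ib (dyb I x).
have S0 x : 0 <= S x by apply: sumr_ge0 => I _; rewrite mulr_ge0.
have mS : measurable_fun setT S.
  apply: measurable_sum => I; apply: measurable_funM => //.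
  by apply: measurable_bR; exact: measurable_dyb.
have iS a : 0 < a -> integ (fun x => S x `^ a).
  move=> a0; pose B := \sum_(I <- s) b I.
  have iD : integ (fun x => B `^ a * \sum_(I <- s) ib (dyb I x)).
    by apply: integZ; apply: integ_sum => I; exact: integ_dyb.
  apply: integ_le iD; first exact: (measurableT_comp (measurable_powR _) mS).
  move=> x; rewrite ger0_norm ?powR_ge0//.
  have [hs|/hasPn hs] := boolP (has (fun I => dyb I x) s); last first.
    rewrite /S big1_seq; first by rewrite powR0 ?gt_eqF// mulr_ge0 ?powR_ge0 ?sumr_ge0.
    by move=> I /andP[_ /hs /negbTE ->]; rewrite mulr0.
  apply: le_trans (_ : B `^ a * 1 <= _).
    have B0 : 0 <= B by apply: sumr_ge0.
    rewrite mulr1 ge0_ler_powR ?nnegrE ?(ltW a0) ?S0 ?B0//.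
    by apply: ler_sum => I _; rewrite ler_piMr//; case: (dyb I x).
  rewrite ler_wpM2l ?powR_ge0//; apply: le_trans (ib_has _ _ _).
  by rewrite hs.
have Pm : 0 < P - 1 by rewrite subr_gt0.
have Pq' : (P - 1) * q = P.
  have : (P^-1 + q^-1) * (P * q) = P * q by rewrite Pq mul1r.
  rewrite (_ : (P^-1 + q^-1) * _ = q + P); first by move=> e; rewrite mulrBl mul1r -e; ring.
  by field; rewrite !gt_eqF.
pose w x := S x `^ (P - 1).
have wq x : w x `^ q = S x `^ P by rewrite /w -powRrM Pq'.
have w0 x : 0 <= w x by exact: powR_ge0.
have iw : integ w by exact: iS.
have iwq : integ (fun x => w x `^ q) by apply: eq_integ (iS P P0) => x.
split; first exact: iS.
have := h w w0 iw iwq; rewrite (eq_Int wq).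
have -> : \sum_(I <- s) b I * Int (fun x => w x * ib (dyb I x)) = Int (fun x => S x `^ P).
  rewrite [RHS](@eq_Int _ _ (fun x => \sum_(I <- s) b I * (w x * ib (dyb I x)))).
    rewrite Int_sum => [|I]; last by apply: integZ; apply: integM_ib => //; exact: measurable_dyb.
    by apply: eq_bigr => I _; rewrite IntZ//; apply: integM_ib => //; exact: measurable_dyb.
  move=> x; rewrite -mulr_powRB1// -/(w x) mulr_suml.
  by apply: eq_bigr => I _; rewrite mulrAC mulrA.
have -> : q^-1 = 1 - P^-1 by rewrite -Pq addrC addKr.
by move=> hA; apply: absorb hA => //; apply: Int_ge0 => x; exact: powR_ge0.
Qed.

Section Conv.
Variables (p : R) (f : R -> R).
Hypotheses (p2 : 2 < p) (mf : measurable_fun setT f) (ifp : integ (fun x => `|f x| `^ p)).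

Lemma norm_le_powR x : `|x| <= 1 + `|x| `^ p.
Proof.
have [x1|x1] := leP `|x| 1.
  by apply: (le_trans x1); rewrite lerDl powR_ge0.
apply: le_trans (_ : `|x| `^ p <= _); last by rewrite lerDr.
rewrite -[leLHS]powRr1//; apply: ler_powR; first exact: ltW.
by apply: ltW; apply: lt_trans p2; rewrite ltr1n.
Qed.

Lemma affE k x y b : sc k * (x - y) + b = (- sc k) * y + (sc k * x + b).
Proof. by ring. Qed.

Lemma scN_neq0 k : - sc k != 0.
Proof. by rewrite oppr_eq0. Qed.

(** Since [|f| <= 1 + |f| ^ p] and [th <= 1], the product is dominated by the sum of two integrable
    functions. This crude bound serves for integrability and boundedness only; no norm estimate
    passes through it. *)
Lemma conv_dom (h : R -> R) (B : R) y z : (forall z, `|h z| <= B * th z) ->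
  `|f y * h z| <= B * (th z + `|f y| `^ p).
Proof.
move=> hB; have B0 : 0 <= B by have := hB 0; rewrite /th expr0n addr0 invr1 mulr1; exact: le_trans.
rewrite normrM; have t1 := th_le1 z; have t0 := th_ge0 z.
have F0 : 0 <= `|f y| `^ p by exact: powR_ge0.
apply: le_trans (ler_pM _ _ (norm_le_powR (f y)) (hB z)) _ => //.
rewrite mulrCA; apply: ler_wpM2l => //; rewrite mulrDl mul1r lerD2l.
by rewrite ler_piMr.
Qed.

Lemma integ_conv (h : R -> R) (B : R) k x b : measurable_fun setT h -> (forall z, `|h z| <= B * th z) ->
  integ (fun y => f y * h (sc k * (x - y) + b)).
Proof.
move=> mh hB; under [X in integ X]funext do rewrite affE.
have i1 := integ_affine (sc k * x + b) (scN_neq0 k) (integ_th R).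
apply: integ_le (integZ B (integD i1 ifp)).
  by apply: measurable_funM => //; exact: measurable_affine.
by move=> y; exact: conv_dom.
Qed.

Definition cv (h : R -> R) (m : nat) k x : R :=
  Int (fun y => f y * (sc k * h (sc k * (x - y) + 2 ^+ m))).

Lemma cvE (h : R -> R) B m k x : measurable_fun setT h -> (forall z, `|h z| <= B * th z) ->
  cv h m k x = sc k * Int (fun y => f y * h (sc k * (x - y) + 2 ^+ m)).
Proof.
move=> mh hB; rewrite -IntZ; last exact: integ_conv hB.
by apply: eq_Int => y; rewrite mulrCA.
Qed.

Lemma cv_bounded (h : R -> R) B m k : measurable_fun setT h -> (forall z, `|h z| <= B * th z) ->
  exists D, forall x, `|cv h m k x| <= D.
Proof.
move=> mh hB; exists (sc k * (B * ((sc k)^-1 * Int (@th R) + Int (fun y => `|f y| `^ p)))) => x.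
have i1 := integ_affine (sc k * x + 2 ^+ m) (scN_neq0 k) (integ_th R).
rewrite (cvE m k x mh hB) normrM gtr0_norm//; apply: ler_wpM2l => //.
have -> : (sc k)^-1 * Int (@th R) = Int (fun y => th (- sc k * y + (sc k * x + 2 ^+ m))).
  by rewrite (Int_affine _ (scN_neq0 k) (integ_th R)) normrN gtr0_norm.
rewrite -IntD// -IntZ; last exact: integD.
apply: Int_abs_le; [exact: integ_conv hB|by apply: integZ; exact: integD|move=> y].
by rewrite affE; exact: conv_dom.
Qed.

End Conv.

Lemma piece_const_gt0 (C : R) : 0 < C -> 0 < piece_const C.
Proof.
move=> C0; apply: mulr_gt0; first by [].
apply: ltr_pwDl; first exact: ltr0n.
exact: mulr_ge0 (ler0n _ _) (ltW (Int_th_gt0 R)).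
Qed.

(** With s x within one unit of I.2 - 2^m + n, the support [n - 2, n + 1] of the piece turns into
    I.2 - 1 <= s y <= I.2 + 3, which is what dictates the shape of [stb]. The point x of the
    translated interval is arbitrary. *)
Lemma kern_piece (C : R) (Phi : R -> R) (n : int) (m : nat) I x : molecule C Phi -> 0 < C ->
  dyb (I.1, I.2 - ((2 ^ m)%N%:Z - n)) x ->
  kern I (fun y => (piece_const C * th n%:~R ^+ 2)^-1 * piece Phi n (sc I.1 * (x - y) + 2 ^+ m)).
Proof.
move=> mol C0 /andP[/= h1 h2].
have K0 : 0 < piece_const C * th n%:~R ^+ 2.
  by apply: mulr_gt0; [exact: piece_const_gt0|rewrite exprn_gt0 ?th_gt0].
move: h1 h2; rewrite !intrB => h1 h2.
have e2 : (2 ^ m)%N%:Z%:~R = 2 ^+ m :> R by rewrite -pmulrn natrX.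
rewrite e2 in h1 h2.
split.
- move=> y z; rewrite -mulrBr normrM gtr0_norm ?invr_gt0// ler_pdivrMl//.
  apply: (le_trans (piece_lip mol _ _ _)); apply: ler_wpM2l; first exact: ltW.
  rewrite (_ : _ - _ = sc I.1 * (z - y)); last by ring.
  by rewrite normrM gtr0_norm// distrC.
- move=> y nst; rewrite piece_out ?mulr0//; apply: contra nst => /andP[h3 h4].
  by apply/andP; split; lra.
- have ip := integ_affine (sc I.1 * x + 2 ^+ m) (scN_neq0 I.1) (piece_integ mol n).
  rewrite (@eq_Int _ _ (fun y => (piece_const C * th n%:~R ^+ 2)^-1 *
     piece Phi n (- sc I.1 * y + (sc I.1 * x + 2 ^+ m)))); last by move=> y; rewrite affE.
  by rewrite IntZ// (Int_affine _ (scN_neq0 I.1) (piece_integ mol n)) (Int_piece mol) !mulr0.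
Qed.

Lemma cauchy_schwarz (T : Type) (s : seq T) (a b : T -> R) :
  (\sum_(i <- s) a i * b i) ^+ 2 <= (\sum_(i <- s) a i ^+ 2) * \sum_(i <- s) b i ^+ 2.
Proof.
elim: s => [|i s ih]; first by rewrite !big_nil expr0n mul0r.
rewrite !big_cons; move: ih.
have X0 : 0 <= \sum_(j <- s) a j ^+ 2 by apply: sumr_ge0 => j _; exact: sqr_ge0.
have Z0 : 0 <= \sum_(j <- s) b j ^+ 2 by apply: sumr_ge0 => j _; exact: sqr_ge0.
move: (\sum_(j <- s) a j * b j) (\sum_(j <- s) a j ^+ 2) X0 (\sum_(j <- s) b j ^+ 2) Z0 (a i) (b i).
move=> Y X X0 Z Z0 u v ih.
have W0 : 0 <= u ^+ 2 * Z + v ^+ 2 * X by rewrite addr_ge0// mulr_ge0// sqr_ge0.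
have key : 2 * (u * v * Y) <= u ^+ 2 * Z + v ^+ 2 * X.
  apply: (le_trans (ler_norm _)); rewrite -ler_sqr ?nnegrE// real_normK ?num_real//.
  have h : 0 <= u ^+ 2 * v ^+ 2 by rewrite mulr_ge0 ?sqr_ge0.
  have h1 := ler_wpM2l h ih.
  have h2 := sqr_ge0 (u ^+ 2 * Z - v ^+ 2 * X).
  rewrite (_ : (2 * (u * v * Y)) ^+ 2 = 4 * (u ^+ 2 * v ^+ 2 * Y ^+ 2)); last by ring.
  move: h2; rewrite (_ : (u ^+ 2 * Z - v ^+ 2 * X) ^+ 2 =
    (u ^+ 2 * Z + v ^+ 2 * X) ^+ 2 - 4 * (u ^+ 2 * v ^+ 2 * (X * Z))); last by ring.
  by lra.
rewrite (_ : (u * v + Y) ^+ 2 = u ^+ 2 * v ^+ 2 + 2 * (u * v * Y) + Y ^+ 2); last by ring.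
rewrite (_ : (u ^+ 2 + X) * (v ^+ 2 + Z) = u ^+ 2 * v ^+ 2 + (u ^+ 2 * Z + v ^+ 2 * X) + X * Z); last by ring.
by apply: lerD => //; rewrite lerD2l.
Qed.

Lemma sqr_sum_le (T : Type) (s : seq T) (c a : T -> R) : (forall i, 0 <= c i) ->
  (\sum_(i <- s) c i * a i) ^+ 2 <= (\sum_(i <- s) c i) * \sum_(i <- s) c i * a i ^+ 2.
Proof.
move=> c0; have := cauchy_schwarz s (fun i => Num.sqrt (c i)) (fun i => Num.sqrt (c i) * a i).
under eq_bigr do rewrite mulrA -expr2 sqr_sqrtr//.
under [X in _ <= X * _]eq_bigr do rewrite sqr_sqrtr//.
by under [X in _ <= _ * X]eq_bigr do rewrite exprMn sqr_sqrtr//.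
Qed.

Lemma sum_th (N : nat) : \sum_(i < (N + N)%N) th (i%:Z - N%:Z + 1)%:~R <= 3 * Int (@th R).
Proof.
pose E (i : 'I_(N + N)) x : R := th (i%:Z - N%:Z + 1)%:~R * ib ((i%:Z - N%:Z + 1)%:~R <= x < (i%:Z - N%:Z + 1)%:~R + 1).
have iE i : integ (E i) by exact/integZ/integ_itv.
have -> : \sum_(i < (N + N)%N) th (i%:Z - N%:Z + 1)%:~R = Int (fun x => \sum_(i < (N + N)%N) E i x).
  rewrite Int_sum//; apply: eq_bigr => i _.
  by rewrite IntZ ?Int_itv ?lerDl//; [ring|exact: integ_itv].
rewrite -IntZ; last exact: integ_th.
apply: Int_le; [exact: integ_sum|exact/integZ/integ_th|move=> x].
apply: le_trans (_ : (3 * th x) * \sum_(i < (N + N)%N)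
   ib ((i%:Z - N%:Z + 1)%:~R <= x < (i%:Z - N%:Z + 1)%:~R + 1) <= _).
  rewrite mulr_sumr; apply: ler_sum => i _; rewrite /E.
  case: andP => [[h1 h2]|_]; last by rewrite !mulr0.
  by rewrite !mulr1; apply: th_near; rewrite ler_norml; apply/andP; split; lra.
rewrite ler_piMr ?mulr_ge0 ?th_ge0//; apply: sum_excl.
  exact: index_enum_uniq.
move=> i j _ _ h h'; apply: val_inj => /=.
have := int_unit_uniq h h'; lia.
Qed.

Section Estimate.
Variables (p q C : R) (Phi f w : R -> R) (m : nat) (ks ns : seq int) (pt : int * int -> R).
Hypotheses (p2 : 2 < p) (q1 : 1 < q) (pq : (p / 2)^-1 + q^-1 = 1).
Hypotheses (mol : molecule C Phi) (C0 : 0 < C) (m1 : (0 < m)%N).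
Hypotheses (mf : measurable_fun setT f) (ifp : integ (fun x => `|f x| `^ p)).
Hypotheses (w0 : forall x, 0 <= w x) (iw : integ w) (iwq : integ (fun x => w x `^ q)).
Hypotheses (uk : uniq ks) (un : uniq ns) (ptP : forall I, dyb I (pt I)).

Let F := Int (fun x => `|f x| `^ p) `^ (p / 2)^-1.
Let wn := Int (fun x => w x `^ q) `^ q^-1.
Let C1 := piece_const C.
Definition weight_const : R := 2 * 2700 * (2 * 7 * (1 - (2 `^ (q - 1))^-1)^-1).

Let coef (n : int) : R := C1 * th n%:~R ^+ 2.
Let atom (n : int) I := Int (fun y => f y *
  ((coef n)^-1 * piece Phi n (sc I.1 * (pt I - y) + 2 ^+ m))).

(** [weighted_square] is applied to the indices v + N: there the weight is averaged over the
    interval of index v, from which the convolution is seen, while the atom lives around the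
    translate. *)
Lemma atom_weighted n (D : nat) : `|(2 ^ m)%N%:Z - n| < 2 ^+ D ->
  \sum_(I <- box ks ns) (sc I.1 * atom n I) ^+ 2 * Int (fun x => w x * ib (dyb I x)) <=
  weight_const * D.+1%:R * (F * wn).
Proof.
move=> hD; set N := _ - n in hD.
pose psi I y := (coef n)^-1 * piece Phi n (sc I.1 * (pt (I.1, I.2 - N) - y) + 2 ^+ m).
have K I : kern I (psi I) by apply: kern_piece => //; exact: ptP.
have un' : uniq [seq v + N | v <- ns] by rewrite map_inj_uniq//; exact: addIr.
have rearrange (a b c G : R) : 2 * 2700 * (a * (2 * (7 * c) * (b * G))) = 2 * 2700 * (2 * 7 * G) * c * (a * b).
  by ring.
have := weighted_square uk un' K p2 q1 pq mf ifp w0 iw iwq hD.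
rewrite rearrange.
apply: le_trans; rewrite !big_allpairs /=.
apply: ler_sum => k _; rewrite big_map le_eqVlt; apply/orP; left; apply/eqP.
by apply: eq_bigr => v _; rewrite /psi /atom /= addrK; ring.
Qed.

Let nn (N i : nat) : int := i%:Z - N%:Z + 1.
Let part (N : nat) I := \sum_(i < (N + N)%N) coef (nn N i) * (sc I.1 * atom (nn N i) I).

Let C10 : 0 < C1. Proof. exact: piece_const_gt0. Qed.
Let coef_gt0 n : 0 < coef n.
Proof. by apply: mulr_gt0 => //; rewrite exprn_gt0 ?th_gt0. Qed.
Let coef_ge0 n : 0 <= coef n. Proof. exact: ltW. Qed.
Let Fwn0 : 0 <= F * wn. Proof. by apply: mulr_ge0; exact: powR_ge0. Qed.

Lemma weight_const_ge0 : 0 <= weight_const.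
Proof.
apply: mulr_ge0; first exact: mulr_ge0 (ler0n _ _) (ler0n _ _).
apply: mulr_ge0; first exact: mulr_ge0 (ler0n _ _) (ler0n _ _).
have h : 1 < 2 `^ (q - 1).
  suff : 1 `^ (q - 1) < 2 `^ (q - 1) :> R by rewrite powR1.
  by apply: gt0_ltr_powR; rewrite ?subr_gt0 ?nnegrE ?ltr1n.
by rewrite invr_ge0 subr_ge0 invf_le1 ?(lt_trans ltr01 h)// (ltW h).
Qed.

Let shift_bound n : `|(2 ^ m)%N%:Z - n| < 2 ^+ (m + `|n|%N + 1)%N.
Proof.
apply: le_lt_trans (ler_normB _ _) _.
have h : (`|n| < 2 ^ `|n|)%N by rewrite ltn_expl.
have h2 : (2 ^ m + `|n| < 2 ^ (m + `|n| + 1))%N.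
  have gen a b d : (0 < a -> d < b -> a + d < a * b * 2)%N by clear; nia.
  by rewrite !expnD expn1; apply: gen; rewrite ?expn_gt0.
have -> : 2 ^+ (m + `|n| + 1)%N = (2 ^ (m + `|n| + 1))%N%:Z  :> int by rewrite -[RHS]natz natrX.
by rewrite (@ger0_norm int (2 ^ m)%N%:Z)// -abszE -PoszD ltz_nat.
Qed.

(* Here the factor m appears: a shift by 2^m - n costs m + |n| + 2, and the decay
   of the coefficients absorbs |n|. *)
Let coef_shift n : coef n * (m + `|n|%N + 1).+1%:R <= C1 * (4 * m%:R) * th n%:~R.
Proof.
have t0 := th_ge0 (n%:~R : R).
have h : th n%:~R * (m + `|n|%N + 1).+1%:R <= 4 * m%:R :> R.
  rewrite -ler_pdivlMl ?th_gt0// /th invrK.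
  have mR : 1 <= m%:R :> R by rewrite ler1n.
  have nR : `|n|%N%:R <= n%:~R ^+ 2 :> R.
    have -> : n%:~R ^+ 2 = (`|n| ^ 2)%N%:R :> R.
      by rewrite natrX natr_absz intr_norm real_normK ?num_real.
    by rewrite ler_nat; case: `|n|%N => // k; rewrite leq_pmull.
  have sq := sqr_ge0 (n%:~R : R).
  rewrite -natr1 !natrD; nra.
have gen (a t d e : R) : 0 <= a -> 0 <= t -> t * d <= e -> a * (t * t) * d <= a * e * t.
  move=> a0 u0 hd; rewrite (_ : a * (t * t) * d = a * t * (t * d)); last by ring.
  rewrite (_ : a * e * t = a * t * e); last by ring.
  by apply: ler_wpM2l => //; apply: mulr_ge0.
rewrite /coef expr2; apply: gen => //; exact: ltW.
Qed.

(** Cauchy-Schwarz in n with the summable weights [coef n] reduces the sum to one piece at a time.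
    In the constant, one factor [3 * Int th] bounds the sum of the weights, the other the sum of the
    weights times the translation costs. *)
Lemma part_weighted N : \sum_(I <- box ks ns) part N I ^+ 2 * Int (fun x => w x * ib (dyb I x)) <=
  C1 * (3 * Int (@th R)) * (C1 * (4 * m%:R) * (3 * Int (@th R))) * weight_const * (F * wn).
Proof.
have I0 := ltW (Int_th_gt0 R); have W0 := weight_const_ge0.
have c40 : 0 <= C1 * (4 * m%:R) := mulr_ge0 (ltW C10) (mulr_ge0 (ler0n _ _) (ler0n _ _)).
have re (a b c d : R) : a * (b * c * d) = a * c * (b * d) by ring.
have Wi I : 0 <= Int (fun x => w x * ib (dyb I x)) by apply: Int_ge0 => x; rewrite mulr_ge0.
pose Sc := \sum_(i < (N + N)%N) coef (nn N i).
have Sc0 : 0 <= Sc by apply: sumr_ge0.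
have ScL : Sc <= C1 * (3 * Int (@th R)).
  apply: le_trans (_ : C1 * \sum_(i < (N + N)%N) th (nn N i)%:~R <= _); last first.
    by apply: ler_wpM2l; [exact: ltW|exact: sum_th].
  rewrite mulr_sumr; apply: ler_sum => i _; apply: ler_wpM2l; first exact: ltW.
  by rewrite expr2 ler_piMr ?th_ge0 ?th_le1.
apply: le_trans (_ : \sum_(I <- box ks ns) \sum_(i < (N + N)%N) Sc * (coef (nn N i) *
   ((sc I.1 * atom (nn N i) I) ^+ 2 * Int (fun x => w x * ib (dyb I x)))) <= _).
  apply: ler_sum => I _.
  apply: le_trans (ler_wpM2r (Wi I) (sqr_sum_le _ _ _)) _; first by move=> i; exact: coef_ge0.
  rewrite -mulrA [X in _ * X]mulr_suml mulr_sumr le_eqVlt; apply/orP; left; apply/eqP.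
  by apply: eq_bigr => i _; congr (_ * _); rewrite mulrA.
rewrite exchange_big /=.
apply: le_trans (_ : \sum_(i < (N + N)%N) Sc * ((C1 * (4 * m%:R) * th (nn N i)%:~R) * (weight_const * (F * wn))) <= _).
  apply: ler_sum => i _; rewrite -!mulr_sumr; apply: ler_wpM2l => //.
  apply: le_trans (ler_wpM2l (coef_ge0 _) (atom_weighted (shift_bound _))) _.
  rewrite re; apply: ler_wpM2r; first exact: mulr_ge0.
  exact: coef_shift.
rewrite -mulr_sumr -mulr_suml -mulr_sumr -[leRHS]mulrA -[leRHS]mulrA.
apply: ler_pM => //; last first.
  apply: ler_wpM2r; first exact: mulr_ge0.
  by apply: (ler_wpM2l c40); exact: sum_th.
apply: mulr_ge0; last exact: mulr_ge0.
by apply: mulr_ge0 => //; apply: sumr_ge0 => i _; exact: th_ge0.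
Qed.

Let Cth : forall z, `|Phi z| <= C * th z.
Proof.
case: mol => _ h _ _ z; apply: (le_trans (h z)); apply: ler_wpM2l; first exact: ltW.
by rewrite exprS ler_piMr ?th_ge0// exprn_ile1 ?th_ge0 ?th_le1.
Qed.

(** [E] depends on [I]; this is harmless because the limit in N is taken inside a finite sum over
    intervals. *)
Lemma part_error I : exists2 E, 0 <= E & forall N, `|cv f Phi m I.1 (pt I) - part N I| <= E * th N%:R.
Proof.
set x := pt I; set k := I.1.
pose z y := sc k * (x - y) + 2 ^+ m.
have mPhi : measurable_fun setT Phi by case: mol.
have iPhi : integ (fun y => f y * Phi (z y)) := integ_conv p2 mf ifp k x (2 ^+ m) mPhi Cth.
have mpiece n : measurable_fun setT (piece Phi n) := integ_mf (piece_integ mol n).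
pose sumN N y := \sum_(i < (N + N)%N) piece Phi (nn N i) y.
have msum N : measurable_fun setT (sumN N) by apply: measurable_sum => i; exact: mpiece.
pose A := C * (6 + 108 * Int (@th R)).
have A0 : 0 <= A.
  apply: mulr_ge0; first exact: ltW.
  by apply: addr_ge0; [exact: ler0n|exact: mulr_ge0 (ler0n _ _) (ltW (Int_th_gt0 R))].
have err N y : `|Phi y - sumN N y| <= A * th N%:R * th y.
  by rewrite -mulrA; exact: sum_piece_error.
have ierr N : integ (fun y => f y * (Phi (z y) - sumN N (z y))).
  apply: (integ_conv p2 mf ifp k x (2 ^+ m) (h := fun y => Phi y - sumN N y) _ (err N)).
  exact: measurable_funB.
have ith : integ (fun y => f y * th (z y)).
  apply: (integ_conv p2 mf ifp k x (2 ^+ m) (@measurable_th R) (B := 1)).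
  by move=> y; rewrite mul1r ger0_norm ?th_ge0.
have inorm := integ_norm ith.
exists (sc k * (A * Int (fun y => `|f y * th (z y)|))).
  by apply: mulr_ge0 => //; apply: mulr_ge0 => //; apply: Int_ge0 => y.
move=> N.
have ipc n : integ (fun y => f y * piece Phi n (z y)).
  have [B hB] : exists B, forall y, `|piece Phi n y| <= B * th y.
    exists (C + (kap R)^-1 * `|tailmass Phi n| * 3 * (th n%:~R)^-1 +
      (kap R)^-1 * `|tailmass Phi (n - 1)| * 3 * (th (n - 1)%:~R)^-1).
    have k0 : 0 <= (kap R)^-1 by rewrite invr_ge0 ltW ?kap_gt0.
    move=> y; rewrite /piece !mulrDl.
    have tl l : `|(kap R)^-1 * tailmass Phi l * tau l y| <= (kap R)^-1 * `|tailmass Phi l| * 3 * (th l%:~R)^-1 * th y.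
      rewrite !normrM (ger0_norm k0) -[leRHS]mulrA -[leRHS]mulrA; apply: ler_wpM2l; first exact: mulr_ge0.
      have [h|h] := leP 1 `|y - l%:~R|.
        rewrite /tau tent_out// normr0; apply: mulr_ge0; first exact: ler0n.
        by apply: mulr_ge0; [rewrite invr_ge0|]; exact: th_ge0.
      apply: (le_trans (tent_norm _)).
      rewrite mulrCA ler_pdivlMl ?th_gt0// mulr1 th_near// distrC; exact: ltW.
    rewrite (le_trans (ler_normD _ _))//; apply: lerD; last exact: tl.
    rewrite (le_trans (ler_normB _ _))//; apply: lerD; last exact: tl.
    rewrite normrM; apply: le_trans (Cth y); rewrite ler_piMr//; exact: tent_norm.
  exact: (integ_conv p2 mf ifp k x (2 ^+ m) (mpiece n) hB).
have -> : part N I = sc k * Int (fun y => f y * sumN N (z y)).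
  rewrite /part /sumN; under [in RHS]eq_Int do rewrite mulr_sumr.
  rewrite Int_sum// mulr_sumr; apply: eq_bigr => i _; rewrite mulrCA; congr (_ * _).
  rewrite /atom (@eq_Int _ _ (fun y => (coef (nn N i))^-1 * (f y * piece Phi (nn N i) (z y)))).
    by rewrite IntZ// mulrA divff ?mul1r// gt_eqF.
  by move=> y; rewrite mulrCA.
rewrite (cvE p2 mf ifp m k x mPhi Cth) -mulrBr normrM gtr0_norm// -mulrA.
apply: ler_wpM2l => //.
have iS : integ (fun y => f y * sumN N (z y)).
  by under [X in integ X]funext do rewrite mulr_sumr; exact: integ_sum.
have e : Int (fun y => f y * Phi (z y)) - Int (fun y => f y * sumN N (z y)) =
    Int (fun y => f y * (Phi (z y) - sumN N (z y))).
  by rewrite -IntB//; apply: eq_Int => y; rewrite mulrBr.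
rewrite (_ : Int _ - Int _ = Int (fun y => f y * (Phi (z y) - sumN N (z y)))); last exact: e.
rewrite mulrAC -IntZ//.
apply: Int_abs_le => //; first exact: integZ.
move=> y; rewrite !normrM (ger0_norm (th_ge0 (z y))) mulrCA ler_wpM2l//.
Qed.

Lemma part_cvg I : part N I @[N --> \oo] --> cv f Phi m I.1 (pt I).
Proof.
have [E E0 h] := part_error I.
apply/cvgrPdist_le => e e0.
have c0 : E * harmonic n @[n --> \oo] --> (0 : R).
  by rewrite -[X in _ --> X](mulr0 E); apply: cvgM; [exact: cvg_cst|exact: cvg_harmonic].
move/cvgrPdist_le/(_ e e0): c0; apply: filterS => N; rewrite sub0r normrN => hN.
apply: (le_trans (h N)); apply: le_trans hN.
apply: le_trans (ler_norm _); apply: ler_wpM2l => //.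
rewrite /th /= lef_pV2 ?posrE ?den_gt0// -natrX -[1]/(1%:R) -natrD ler_nat add1n ltnS.
by case: N => // N; rewrite leq_pmull.
Qed.

Lemma square_weighted :
  \sum_(I <- box ks ns) cv f Phi m I.1 (pt I) ^+ 2 * Int (fun x => w x * ib (dyb I x)) <=
  C1 * (3 * Int (@th R)) * (C1 * (4 * m%:R) * (3 * Int (@th R))) * weight_const * (F * wn).
Proof.
have : (\sum_(I <- box ks ns) part N I ^+ 2 * Int (fun x => w x * ib (dyb I x))) @[N --> \oo] -->
   \sum_(I <- box ks ns) cv f Phi m I.1 (pt I) ^+ 2 * Int (fun x => w x * ib (dyb I x)).
  elim: (box ks ns) => [|I s ih].
    by rewrite big_nil; under eq_fun do rewrite big_nil; exact: cvg_cst.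
  rewrite big_cons; under eq_fun do rewrite big_cons.
  apply: cvgD => //; apply: cvgM; last exact: cvg_cst.
  by under eq_fun do rewrite expr2; rewrite expr2; apply: cvgM; exact: part_cvg.
move=> h; rewrite -(cvg_lim _ h)//; apply: limr_le; first by apply/cvg_ex; eexists; exact: h.
by apply: nearW => N; exact: part_weighted.
Qed.

End Estimate.
End SquareFunction.

(** * Uniqueness of the Fourier transform by Poisson kernels *)

Section FourierUniqueness.
Variable R : realType.
Local Notation mu := (@lebesgue_measure R).

Lemma dominated_Int (F : nat -> R -> R) (f g : R -> R) :
  (forall n, measurable_fun setT (F n)) -> measurable_fun setT f -> integ g ->
  (forall n x, `|F n x| <= g x) -> (forall x, F n x @[n --> \oo] --> f x) ->
  Int (F n) @[n --> \oo] --> Int f.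
Proof.
move=> mF mf ig Fg Ff.
have iF n : integ (F n) by exact: integ_le (mF n) (Fg n) ig.
have Ff' x : (F n x)%:E @[n --> \oo] --> (f x)%:E.
  by apply/fine_cvgP; split; [exact: nearW|exact: Ff].
have [||||h1 _ h2] := @dominated_convergence _ _ R mu setT measurableT
  (fun n x => (F n x)%:E) (EFin \o f) (EFin \o g) _ _ _ ig _.
- by move=> n; apply/measurable_EFinP; exact: mF.
- by apply/measurable_EFinP.
- by apply: aeW => x _; exact: Ff'.
- by apply: aeW => x n _ /=; rewrite lee_fin.
have if_ : integ f by exact: h1.
move: h2; rewrite EFin_Int//.
under eq_fun do rewrite EFin_Int//.
by move=> /fine_cvgP[].
Qed.

(** The denominator |1 - r e^(is)|^2 of the Poisson kernel of the unit disc. *)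
Definition pden (r s : R) : R := 1 - 2 * r * cos s + r ^+ 2.

Lemma pden_ge (r s : R) : 0 <= r -> (1 - r) ^+ 2 <= pden r s.
Proof.
move=> r0; rewrite /pden; have := cos_le1 s; have := ler_wpM2l r0 (cos_le1 s); nra.
Qed.

Lemma cos_rec (n : nat) (s : R) :
  cos (n.+2%:R * s) = 2 * cos s * cos (n.+1%:R * s) - cos (n%:R * s).
Proof.
have -> : n.+2%:R * s = n.+1%:R * s + s by rewrite -[n.+2%:R]natr1 mulrDl mul1r.
have -> : n%:R * s = n.+1%:R * s - s by rewrite -[n.+1%:R]natr1 mulrDl mul1r addrK.
by rewrite cosD cosB; ring.
Qed.

(** Real part of the geometric sum of powers of r e^(is), obtained from the three-term recurrence of
    the cosines so as to stay with real functions. *)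
Lemma poisson_partial (r s : R) (M : nat) :
  (\sum_(j < M.+1) r ^+ j * cos (j%:R * s)) * pden r s =
  1 - r * cos s - r ^+ M.+1 * cos (M.+1%:R * s) + r ^+ M.+2 * cos (M%:R * s).
Proof.
elim: M => [|M ih].
  by rewrite big_ord1 expr0 !mul0r cos0 !mul1r /pden; ring.
by rewrite big_ord_recr /= mulrDl ih cos_rec /pden !exprS; ring.
Qed.

Section Integral.
Variables (u : R -> R).
Hypotheses (iu : integ u) (u0 : forall t, Int (fun y => u y * cos (t * y)) = 0).

Lemma measurable_cos_scale (t : R) : measurable_fun setT (fun y => cos (t * y)).
Proof.
apply: continuous_measurable_fun => x; apply: continuous_comp; last exact: continuous_cos.
by apply: cvgM; [exact: cvg_cst|exact: cvg_id].
Qed.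

Lemma measurable_pdenV (r d : R) : 0 <= r < 1 -> measurable_fun setT (fun y => (pden r (d * y))^-1).
Proof.
move=> /andP[r0 r1]; apply: continuous_measurable_fun => x; apply: cvgV.
  by rewrite gt_eqF// (lt_le_trans _ (pden_ge _ r0))// exprn_gt0// subr_gt0.
have c : {for x, continuous (fun y => cos (d * y))}.
  apply: continuous_comp; last exact: continuous_cos.
  by apply: cvgM; [exact: cvg_cst|exact: cvg_id].
by apply: cvgD; [apply: cvgB; [exact: cvg_cst|apply: cvgM; [exact: cvg_cst|exact: c]]|exact: cvg_cst].
Qed.

Lemma integM_bounded (g : R -> R) (B : R) : measurable_fun setT g ->
  (forall y, `|g y| <= B) -> integ (fun y => u y * g y).
Proof.
move=> mg gB; apply: integ_le (integZ B (integ_norm iu)).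
  by apply: measurable_funM => //; exact: integ_mf.
by move=> y; rewrite normrM mulrC ler_wpM2r.
Qed.

Lemma integ_ucos (t : R) : integ (fun y => u y * cos (t * y)).
Proof.
apply: (@integM_bounded _ 1); first exact: measurable_cos_scale.
by move=> y; rewrite ler_norml cos_geN1 cos_le1.
Qed.

(** The quotient is the sum of the series of r^j cos(j d y). Every partial sum is annihilated by
    [u], and the remainder is O(r^M) uniformly in y. *)
Lemma poisson_half (r d : R) : 0 <= r < 1 ->
  Int (fun y => u y * ((1 - r * cos (d * y)) / pden r (d * y))) = 0.
Proof.
move=> /[dup] r01 /andP[r0 r1].
have q0 : 0 < (1 - r) ^+ 2 by rewrite exprn_gt0// subr_gt0.
have D0 s : 0 < pden r s by exact: lt_le_trans (pden_ge s r0).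
have mc := measurable_cos_scale d.
have c1 t : `|cos t| <= 1 :> R by rewrite ler_norml cos_geN1 cos_le1.
pose T M y := \sum_(j < M.+1) r ^+ j * cos (j%:R * (d * y)).
have iT M : integ (fun y => u y * T M y).
  under [X in integ X]funext do rewrite mulr_sumr.
  apply: integ_sum => j; apply: eq_integ (integZ (r ^+ j) (integ_ucos (j%:R * d))) => y.
  by rewrite mulrCA -[j%:R * d * y]mulrA.
have T0 M : Int (fun y => u y * T M y) = 0.
  under eq_Int do rewrite mulr_sumr.
  rewrite Int_sum => [|j].
    rewrite big1// => j _.
    rewrite (@eq_Int _ _ (fun y => r ^+ j * (u y * cos (j%:R * d * y)))); last
      by move=> y; rewrite [RHS]mulrCA -[j%:R * d * y]mulrA.
    by rewrite IntZ ?u0 ?mulr0//; exact: integ_ucos.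
  apply: eq_integ (integZ (r ^+ j) (integ_ucos (j%:R * d))) => y.
  by rewrite mulrCA -[j%:R * d * y]mulrA.
set J := Int _.
have iJ : integ (fun y => u y * ((1 - r * cos (d * y)) / pden r (d * y))).
  apply: (@integM_bounded _ (2 * ((1 - r) ^+ 2)^-1)).
    apply: measurable_funM; last exact: measurable_pdenV.
    by apply: measurable_funB => //; exact: measurable_funM.
  move=> y; rewrite normrM; apply: ler_pM => //.
    rewrite (le_trans (ler_normB _ _))// normr1 normrM (ger0_norm r0).
    by have := c1 (d * y); have := normr_ge0 (cos (d * y)); nra.
  by rewrite normfV gtr0_norm// lef_pV2 ?posrE// pden_ge.
have JM M : `|J| <= r ^+ M * (2 * ((1 - r) ^+ 2)^-1 * Int (fun y => `|u y|)).
  have -> : J = Int (fun y => u y * ((1 - r * cos (d * y)) / pden r (d * y)) - u y * T M y).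
    by rewrite IntB// T0 subr0.
  rewrite mulrA -IntZ; last exact: integ_norm.
  apply: Int_abs_le; [exact: integB|exact/integZ/integ_norm|move=> y].
  rewrite -mulrBr normrM mulrC ler_wpM2r//.
  have -> : (1 - r * cos (d * y)) / pden r (d * y) - T M y =
      (r ^+ M.+1 * cos (M.+1%:R * (d * y)) - r ^+ M.+2 * cos (M%:R * (d * y))) / pden r (d * y).
    have := poisson_partial r (d * y) M; rewrite -/(T M y) => e.
    apply: (mulIf (lt0r_neq0 (D0 (d * y)))).
    by rewrite mulrBl !divfK ?gt_eqF// e; ring.
  have rM : 0 <= r ^+ M by exact: exprn_ge0.
  rewrite normrM [leRHS]mulrA; apply: ler_pM => //; last first.
    by rewrite normfV gtr0_norm// lef_pV2 ?posrE// pden_ge.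
  rewrite (le_trans (ler_normB _ _))// (normrM (r ^+ M.+1)) (normrM (r ^+ M.+2)).
  rewrite (ger0_norm (exprn_ge0 M.+1 r0)) (ger0_norm (exprn_ge0 M.+2 r0)).
  have le1 k t : (M <= k)%N -> r ^+ k * `|cos t| <= r ^+ M.
    move=> Mk; apply: (@le_trans _ _ (r ^+ k)); first by rewrite ler_piMr// exprn_ge0.
    by apply: ler_wiXn2l => //; exact: ltW.
  rewrite mulr_natr mulr2n; apply: lerD; apply: le1; lia.
apply/eqP; rewrite -normr_le0.
pose B := 2 * ((1 - r) ^+ 2)^-1 * Int (fun y => `|u y|).
have c0 : r ^+ M * B @[M --> \oo] --> (0 : R).
  rewrite -[X in _ --> X](mul0r B); apply: cvgM; last exact: cvg_cst.
  by apply: cvg_expr; rewrite ger0_norm.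
rewrite -(cvg_lim _ c0)//; apply: limr_ge; first by apply/cvg_ex; eexists; exact: c0.
by apply: nearW => M; exact: JM.
Qed.

Lemma poisson_zero (r d : R) : 0 <= r < 1 -> Int (fun y => u y * (pden r (d * y))^-1) = 0.
Proof.
move=> /[dup] r01 /andP[r0 r1].
have q0 : 0 < (1 - r) ^+ 2 by rewrite exprn_gt0// subr_gt0.
have D0 s : 0 < pden r s by exact: lt_le_trans (pden_ge s r0).
have i1 : integ (fun y => u y * (pden r (d * y))^-1).
  apply: (@integM_bounded _ ((1 - r) ^+ 2)^-1); first exact: measurable_pdenV.
  by move=> y; rewrite normfV gtr0_norm// lef_pV2 ?posrE// pden_ge.
have Iu : Int u = 0.
  by rewrite -[RHS](u0 0); apply: eq_Int => y; rewrite mul0r cos0 mulr1.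
have r2 : 1 - r ^+ 2 != 0 by rewrite gt_eqF// subr_gt0 exprn_ilt1.
apply: (mulfI r2); rewrite mulr0 -IntZ//.
have := poisson_half d r01.
(* With z = r e^(is), the real part of 1 / (1 - z) is half of 1 plus the Poisson kernel. *)
rewrite (@eq_Int _ _ (fun y => 2^-1 * (u y + (1 - r ^+ 2) * (u y * (pden r (d * y))^-1)))); last first.
  by move=> y; move: (D0 (d * y)); rewrite /pden => /lt0r_neq0 h; field.
have iB : integ (fun y => (1 - r ^+ 2) * (u y * (pden r (d * y))^-1)) by exact: integZ.
rewrite (@IntZ _ 2^-1); last exact: integD.
rewrite IntD// Iu add0r.
by move/eqP; rewrite mulf_eq0 invr_eq0 pnatr_eq0 /= => /eqP.
Qed.

Lemma sin_quotient (e : nat -> R) (y : R) : (forall n, e n != 0) -> e n @[n --> \oo] --> (0 : R) ->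
  2 * sin (e n * (y / 2)) / e n @[n --> \oo] --> y.
Proof.
move=> e0 ce; pose g (t : R) := 2 * sin (t * (y / 2)).
have dg : is_derive (0 : R) (1 : R) g y.
  have e1 : y = 2 * ((y / 2) * cos (0 * (y / 2))) by rewrite mul0r cos0; field.
  rewrite [X in is_derive _ _ _ X]e1 /g; apply: is_derive_eq.
  by rewrite /GRing.scale /=; ring.
have [/cvg_ex[l hl] d2] := dg.
have lE : l = y by rewrite -d2 /derive; apply/esym/cvg_lim.
move: hl; rewrite lE => /cvgr_dnbhsP/(_ e (conj e0 ce)); apply: cvg_trans.
rewrite (_ : (fun n => 2 * sin (e n * (y / 2)) / e n) =
  (fun n => (e n)^-1 *: ((g \o shift 0) (e n *: 1) - g 0)))//.
apply/funext => n; rewrite /g /= /shift /GRing.scale /= mulr1 addr0 mul0r sin0 mulr0 subr0.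
by rewrite mulrC.
Qed.

(* The Poisson kernels [1 / pden r (d * y)] annihilate u, and d^2 / pden (1 - d) (d y)
   tends to 1 / (1 + y^2) as d -> 0. *)
Lemma weighted_zero : Int (fun y => u y * th y) = 0.
Proof.
pose d (n : nat) : R := n.+2%:R^-1.
pose v n y : R := d n ^+ 2 / pden (1 - d n) (d n * y).
have d0 n : 0 < d n by rewrite invr_gt0.
have d1 n : d n < 1 by rewrite invf_lt1// ltr1n.
have r01 n : 0 <= 1 - d n < 1 by have := d0 n; have := d1 n; lra.
have v01 n y : `|v n y| <= 1.
  have h := pden_ge (d n * y) (proj1 (andP (r01 n))).
  have e : (1 - (1 - d n)) ^+ 2 = d n ^+ 2 by congr (_ ^+ 2); ring.
  rewrite e in h; have p : 0 < d n ^+ 2 by rewrite exprn_gt0.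
  have D0 := lt_le_trans p h.
  by rewrite /v ger0_norm; [rewrite ler_pdivrMr// mul1r|rewrite divr_ge0// ltW].
have mv n : measurable_fun setT (v n) by apply: measurable_funM => //; exact: measurable_pdenV.
have vz n : Int (fun y => u y * v n y) = 0.
  rewrite (@eq_Int _ _ (fun y => d n ^+ 2 * (u y * (pden (1 - d n) (d n * y))^-1))); last
    by move=> y; rewrite /v mulrCA.
  rewrite IntZ ?poisson_zero ?mulr0//.
  apply: (@integM_bounded _ (d n ^+ 2)^-1); first exact: measurable_pdenV.
  move=> z; have h := pden_ge (d n * z) (proj1 (andP (r01 n))).
  have e : (1 - (1 - d n)) ^+ 2 = d n ^+ 2 by congr (_ ^+ 2); ring.
  rewrite e in h; have p : 0 < d n ^+ 2 by rewrite exprn_gt0.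
  have D0 := lt_le_trans p h.
  by rewrite normfV gtr0_norm// lef_pV2 ?posrE.
have cd : d n @[n --> \oo] --> (0 : R).
  have := @cvg_harmonic R; rewrite -(cvg_shiftS (@harmonic R : nat -> R)).
  by apply: cvg_trans.
(* Half-angle form of the denominator: (1 - r)^2 + 4 r sin(s/2)^2 with r = 1 - d. It exposes the
   limit as d -> 0. *)
have vE n y : v n y = (1 + (1 - d n) * (2 * sin (d n * (y / 2)) / d n) ^+ 2)^-1.
  have c2 : cos (d n * y) = 1 - 2 * sin (d n * (y / 2)) ^+ 2.
    have -> : d n * y = d n * (y / 2) + d n * (y / 2) by field.
    by rewrite cosD -!expr2; have := cos2Dsin2 (d n * (y / 2)); lra.
  rewrite /v /pden c2 -[LHS]invrK invfM invrK mulrC.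
  by congr (_^-1); field; rewrite gt_eqF.
have cv y : v n y @[n --> \oo] --> th y.
  under eq_fun do rewrite vE.
  rewrite /th; apply: cvgV; first by rewrite gt_eqF ?den_gt0.
  apply: cvgD; first exact: cvg_cst.
  rewrite (_ : y ^+ 2 = (1 - 0) * y ^+ 2); last by rewrite subr0 mul1r.
  apply: cvgM.
    by apply: cvgB => //; exact: cvg_cst.
  under eq_fun do rewrite expr2; rewrite expr2.
  by apply: cvgM; apply: sin_quotient => // n; rewrite gt_eqF.
have h : Int (fun y => u y * v n y) @[n --> \oo] --> Int (fun y => u y * th y).
  apply: (@dominated_Int _ _ (fun y => `|u y|)).
  - by move=> n; apply: measurable_funM => //; exact: integ_mf.
  - by apply: measurable_funM; [exact: integ_mf|exact: measurable_th].
  - exact: integ_norm.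
  - by move=> n x; rewrite normrM ler_piMr.
  - by move=> x; apply: cvgM => //; exact: cvg_cst.
rewrite -(cvg_lim _ h)//; under eq_fun do rewrite vz.
exact: lim_cst.
Qed.

End Integral.

(* Apply [weighted_zero] to y |-> h (e y + a) and let e -> 0. *)
Lemma fourier_injective (h : R -> R) (B : R) : continuous h -> (forall x, `|h x| <= B) -> integ h ->
  (forall t, Int (fun x => h x * cos (t * x)) = 0) ->
  (forall t, Int (fun x => h x * sin (t * x)) = 0) -> forall a, h a = 0.
Proof.
move=> ch hB ih hc hs a.
have mh : measurable_fun setT h by exact: integ_mf.
pose e n : R := harmonic n.
have e0 n : 0 < e n by exact: harmonic_gt0.
have en0 n : e n != 0 by rewrite gt_eqF.
have iu n : integ (fun y => h (e n * y + a)) by exact: integ_affine.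
have msin t : measurable_fun setT (fun x : R => sin (t * x)).
  apply: continuous_measurable_fun => x; apply: continuous_comp; last exact: continuous_sin.
  by apply: cvgM; [exact: cvg_cst|exact: cvg_id].
have ihc t : integ (fun x => h x * cos (t * x)) by exact: integ_ucos.
have ihs t : integ (fun x => h x * sin (t * x)).
  apply: (@integM_bounded _ ih _ 1) => // y; by rewrite ler_norml sin_geN1 sin_le1.
(* By the addition formula, the cosine transform of the rescaled translate combines the cosine and
   the sine transform of [h]; hence both must vanish. *)
have u0 n t : Int (fun y => h (e n * y + a) * cos (t * y)) = 0.
  pose F x := cos (t / e n * a) * (h x * cos (t / e n * x)) + sin (t / e n * a) * (h x * sin (t / e n * x)).
  have FE y : h (e n * y + a) * cos (t * y) = F (e n * y + a).
    have -> : t * y = t / e n * (e n * y + a) - t / e n * a by field.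
    by rewrite cosB /F; ring.
  have iF : integ F by apply: integD; exact: integZ.
  rewrite (eq_Int FE) (Int_affine a (en0 n) iF) /F IntD; [|exact: integZ..].
  by rewrite !IntZ// hc hs !mulr0 addr0 mulr0.
have z n := weighted_zero (iu n) (u0 n).
have c : Int (fun y => h (e n * y + a) * th y) @[n --> \oo] --> Int (fun y => h a * th y).
  apply: (@dominated_Int _ _ (fun y => B * th y)).
  - by move=> n; apply: measurable_funM; [exact: measurable_affine|exact: measurable_th].
  - by apply: measurable_funM => //; exact: measurable_th.
  - exact/integZ/integ_th.
  - by move=> n y; rewrite normrM (ger0_norm (th_ge0 y)) ler_wpM2r ?th_ge0.
  - move=> y; apply: cvgM; last exact: cvg_cst.
    have c1 : e n * y + a @[n --> \oo] --> a.
      rewrite [X in _ --> X](_ : a = 0 * y + a); last by rewrite mul0r add0r.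
      by apply: cvgD; [apply: cvgM; [exact: cvg_harmonic|exact: cvg_cst]|exact: cvg_cst].
    exact: (cvg_comp _ _ c1 (ch a)).
have : Int (fun y => h a * th y) = 0.
  by rewrite -(cvg_lim _ c)//; under eq_fun do rewrite z; exact: lim_cst.
rewrite IntZ; last exact: integ_th.
by move/eqP; rewrite mulf_eq0 (gt_eqF (Int_th_gt0 R)) orbF => /eqP.
Qed.

End FourierUniqueness.

(** * From Schwartz functions and their Fourier transforms to molecules and explicit dilates *)

Section Schwartz.
Variable R : realType.
Local Notation sc := (pow2 R).
Local Open Scope complex_scope.
#[local] Hint Extern 0 (is_true (0 < sc _)) => exact: sc_gt0 : core.
#[local] Hint Extern 0 (is_true (sc _ != 0)) => exact: sc_neq0 : core.

Lemma Re_mul (x y : R[i]) : complex.Re (x * y) = complex.Re x * complex.Re y - complex.Im x * complex.Im y.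
Proof. by case: x y => [a b] [c d]. Qed.

Lemma Im_mul (x y : R[i]) : complex.Im (x * y) = complex.Re x * complex.Im y + complex.Im x * complex.Re y.
Proof. by case: x y => [a b] [c d]. Qed.

Lemma cabs_sqr (z : R[i]) : cabs z ^+ 2 = complex.Re z ^+ 2 + complex.Im z ^+ 2.
Proof. by case: z => [a b]; rewrite /cabs /= sqr_sqrtr// addr_ge0 ?sqr_ge0. Qed.

Lemma cabs_ge0 (z : R[i]) : 0 <= cabs z.
Proof. by case: z => [a b]; exact: sqrtr_ge0. Qed.

Lemma Re_le_cabs (z : R[i]) : `|complex.Re z| <= cabs z.
Proof.
rewrite -ler_sqr ?nnegrE ?cabs_ge0// cabs_sqr real_normK ?num_real//.
by rewrite lerDl sqr_ge0.
Qed.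

Lemma Im_le_cabs (z : R[i]) : `|complex.Im z| <= cabs z.
Proof.
rewrite -ler_sqr ?nnegrE ?cabs_ge0// cabs_sqr real_normK ?num_real//.
by rewrite lerDr sqr_ge0.
Qed.

Lemma cabs_le (z : R[i]) : cabs z <= `|complex.Re z| + `|complex.Im z|.
Proof.
rewrite -ler_sqr ?nnegrE ?cabs_ge0 ?addr_ge0// cabs_sqr sqrrD !real_normK ?num_real//.
by rewrite -addrA lerD2l lerDr mulrn_wge0 ?mulr_ge0.
Qed.

Lemma rapid_th (g : R -> R) : (forall a : nat, exists C, forall x, `|x| ^+ a * `|g x| <= C) ->
  exists2 C, 0 < C & forall x, `|g x| <= C * th x ^+ 3.
Proof.
(* The moments 0 and 6 suffice, because (1 + x^2)^3 <= 4 (1 + x^6). *)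
move=> h; have [C0 h0] := h 0%N; have [C6 h6] := h 6%N.
have C00 : 0 <= C0 by apply: le_trans (h0 0); rewrite expr0 mul1r.
have C60 : 0 <= C6 by apply: le_trans (h6 0); rewrite mulr_ge0.
exists (4 * (C0 + C6) + 1) => [|x]; first by lra.
have hx0 := h0 x; have hx6 := h6 x; rewrite expr0 mul1r in hx0.
have d0 := den_gt0 x.
rewrite /th exprVn ler_pdivlMr ?exprn_gt0//.
have x6 : `|x| ^+ 6 = (x ^+ 2) ^+ 3 by rewrite -(real_normK (num_real x)) -exprM.
rewrite x6 in hx6.
have t0 : 0 <= x ^+ 2 by exact: sqr_ge0.
have cv : (1 + x ^+ 2) ^+ 3 <= 4 * (1 + (x ^+ 2) ^+ 3).
  move: (x ^+ 2) t0 => t t0.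
  have : 0 <= 3 * (t - 1) ^+ 2 * (t + 1) by apply: mulr_ge0; [apply: mulr_ge0 => //; exact: sqr_ge0|lra].
  by rewrite !exprS expr0; lra.
have g0 : 0 <= `|g x| by [].
by have := ler_wpM2l g0 cv; lra.
Qed.

Lemma schwartz_rapid (f : R -> R[i]) : schwartz f -> forall g : R -> R,
  (g = fun x => complex.Re (f x)) \/ (g = fun x => complex.Im (f x)) ->
  [/\ (forall x, derivable g x 1),
      exists2 C, 0 < C & forall x, `|g x| <= C * th x ^+ 3 &
      exists2 C, 0 < C & forall x, `|derive1 g x| <= C * th x ^+ 3].
Proof.
move=> [s1 s2 hb] g hg.
have hder n : forall a : nat, exists C, forall x, `|x| ^+ a * `|derive1n n g x| <= C.
  move=> a; have [C hC] := hb a n; exists C => x; apply: le_trans (hC x).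
  rewrite ler_wpM2l ?exprn_ge0//.
  case: hg => ->; [exact: (Re_le_cabs (cderiven n f x))|exact: (Im_le_cabs (cderiven n f x))].
split.
- by move=> x; case: hg => ->; [exact: (s1 0%N x)|exact: (s2 0%N x)].
- exact: rapid_th (hder 0%N).
- exact: rapid_th (hder 1%N).
Qed.

Lemma local_lipschitz (g : R -> R) (C : R) (n : int) x y : 0 < C -> (forall x, derivable g x 1) ->
  (forall x, `|derive1 g x| <= C * th x ^+ 3) ->
  `|x - n%:~R| <= 1 -> `|y - n%:~R| <= 1 ->
  `|g x - g y| <= 27 * C * th n%:~R ^+ 2 * `|x - y|.
Proof.
move=> C0 dg hg; wlog xy : x y / y <= x.
  move=> h hx hy; have [xy|/ltW yx] := leP y x; first exact: h.
  by rewrite distrC (distrC x); exact: h.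
move=> hx hy.
have [c cyx ->] := @MVT_segment R g (derive1 g) y x xy
   (fun z _ => DeriveDef (dg z) (esym (derive1E g z)))
   (derivable_within_continuous (fun z _ => dg z)).
move: cyx; rewrite in_itv /= => /andP[yc cx].
rewrite normrM; apply: ler_wpM2r => //; apply: (le_trans (hg c)).
have cn : `|c - n%:~R| <= 1.
  by move: hx hy; rewrite !ler_norml => /andP[_ h1] /andP[h2 _]; apply/andP; split; lra.
have t3 : th c ^+ 3 <= (3 * th n%:~R) ^+ 3.
  by rewrite lerXn2r ?nnegrE ?mulr_ge0 ?th_ge0// th_near.
have t2 : th n%:~R ^+ 3 <= th (n%:~R : R) ^+ 2.
  by rewrite exprSr ler_piMr ?th_le1 ?exprn_ge0 ?th_ge0.
have := ler_wpM2l (ltW C0) t3; have := ler_wpM2l (ltW C0) t2; rewrite exprMn.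
lra.
Qed.

Lemma derivable_continuous (g : R -> R) : (forall x, derivable g x 1) -> continuous g.
Proof. by move=> dg x; apply/differentiable_continuous/derivable1_diffP. Qed.

Lemma rapid_integ (g : R -> R) C : continuous g -> (forall x, `|g x| <= C * th x ^+ 3) -> integ g.
Proof.
move=> cg hg; apply: integ_le (integZ C (integ_th R)); first exact: continuous_measurable_fun.
move=> x; apply: (le_trans (hg x)).
have C0 : 0 <= C.
  by have := hg 0; rewrite /th expr0n addr0 invr1 expr1n mulr1; exact: le_trans.
by apply: ler_wpM2l => //; rewrite exprS ler_piMr ?th_ge0// exprn_ile1 ?th_ge0 ?th_le1.
Qed.

Definition fcos (g : R -> R) (xi : R) : R := Int (fun x => g x * cos (2 * pi * x * xi)).
Definition fsin (g : R -> R) (xi : R) : R := Int (fun x => g x * sin (2 * pi * x * xi)).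

Lemma integ_fcos (g : R -> R) (xi : R) : integ g -> integ (fun x => g x * cos (2 * pi * x * xi)).
Proof.
move=> ig; apply: eq_integ (integ_ucos ig (2 * pi * xi)) => x.
by congr (_ * cos _); ring.
Qed.

Lemma integ_fsin (g : R -> R) (xi : R) : integ g -> integ (fun x => g x * sin (2 * pi * x * xi)).
Proof.
move=> ig; apply: (@integM_bounded _ _ ig _ 1); last by move=> y; rewrite ler_norml sin_geN1 sin_le1.
apply: continuous_measurable_fun => x; apply: continuous_comp; last exact: continuous_sin.
apply: cvgM; last exact: cvg_cst.
by apply: cvgM; [exact: cvg_cst|exact: cvg_id].
Qed.

Lemma fourierE (f : R -> R[i]) (P Q : R -> R) xi :
  (forall x, complex.Re (f x) = P x) -> (forall x, complex.Im (f x) = Q x) -> integ P -> integ Q ->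
  fourier f xi = (fcos P xi + fsin Q xi) +i* (fcos Q xi - fsin P xi).
Proof.
move=> fP fQ iP iQ; rewrite /fourier /cintegral; congr (_ +i* _).
  rewrite /fcos /fsin -IntD; [|exact: integ_fcos|exact: integ_fsin].
  apply: eq_Int => x; rewrite Re_mul fP fQ /expi /= sinN cosN.
  by rewrite mulrN opprK.
rewrite /fcos /fsin -IntB; [|exact: integ_fcos|exact: integ_fsin].
apply: eq_Int => x; rewrite Im_mul fP fQ /expi /= sinN cosN.
by rewrite mulrN addrC.
Qed.

(** The origin lies outside [1/2, 2], so the Fourier transform vanishes there; its real and
    imaginary parts at 0 are the integrals of those of [Phi]. Decay and the local Lipschitz bound
    come from the Schwartz seminorms. *)
Lemma mother_molecule (Phi : R -> R[i]) : is_mother Phi ->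
  exists2 C, 0 < C & molecule C (fun x => complex.Re (Phi x)) /\ molecule C (fun x => complex.Im (Phi x)).
Proof.
move=> [sPhi [g [_ g0] hg]].
have [d1 [C1 C10 h1] [D1 D10 k1]] := schwartz_rapid sPhi (or_introl erefl).
have [d2 [C2 C20 h2] [D2 D20 k2]] := schwartz_rapid sPhi (or_intror erefl).
have c1 := derivable_continuous d1; have c2 := derivable_continuous d2.
have i1 := rapid_integ c1 h1; have i2 := rapid_integ c2 h2.
have := hg 0; rewrite (fourierE 0 (fun=> erefl) (fun=> erefl) i1 i2) g0; last first.
  by rewrite in_itv /= negb_and -ltNge invr_gt0 ltr0n.
rewrite /fcos /fsin.
under eq_Int do rewrite mulr0 cos0 mulr1.
under [X in _ + X]eq_Int do rewrite mulr0 sin0 mulr0.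
under [X in _ +i* (X - _)]eq_Int do rewrite mulr0 cos0 mulr1.
under [X in _ +i* (_ - X)]eq_Int do rewrite mulr0 sin0 mulr0.
rewrite Int0 addr0 subr0 => -[z1 z2].
pose C := C1 + C2 + 27 * D1 + 27 * D2.
have le1 (A x : R) k : A <= C -> A * th x ^+ k <= C * th x ^+ k.
  by move=> h; rewrite ler_wpM2r// exprn_ge0// th_ge0.
exists C; first by rewrite /C; lra.
split; split.
- exact: continuous_measurable_fun.
- by move=> x; apply: (le_trans (h1 x)); apply: le1; rewrite /C; lra.
- move=> n x y hx hy; apply: (le_trans (local_lipschitz D10 d1 k1 hx hy)).
  by apply: ler_wpM2r => //; apply: le1; rewrite /C; lra.
- exact: z1.
- exact: continuous_measurable_fun.
- by move=> x; apply: (le_trans (h2 x)); apply: le1; rewrite /C; lra.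
- move=> n x y hx hy; apply: (le_trans (local_lipschitz D20 d2 k2 hx hy)).
  by apply: ler_wpM2r => //; apply: le1; rewrite /C; lra.
- exact: z2.
Qed.

Section Dilate.
Variables (s b : R).
Hypothesis s0 : 0 < s.
Let sn0 : s != 0. Proof. exact: lt0r_neq0. Qed.

Lemma integ_dilate (g : R -> R) : integ g -> integ (fun x => s * g (s * x + b)).
Proof. by move=> ig; apply: integZ; exact: integ_affine. Qed.

Lemma fcos_dilate (g : R -> R) (xi : R) : integ g -> fcos (fun x => s * g (s * x + b)) xi =
  cos (2 * pi * b * (xi / s)) * fcos g (xi / s) + sin (2 * pi * b * (xi / s)) * fsin g (xi / s).
Proof.
move=> ig; rewrite /fcos /fsin; set be := 2 * pi * b * (xi / s).
pose F z := cos be * (g z * cos (2 * pi * z * (xi / s))) + sin be * (g z * sin (2 * pi * z * (xi / s))).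
have iF : integ F by apply: integD; apply: integZ; [exact: integ_fcos|exact: integ_fsin].
have FE x : s * g (s * x + b) * cos (2 * pi * x * xi) = s * F (s * x + b).
  have -> : 2 * pi * x * xi = 2 * pi * (s * x + b) * (xi / s) - be by rewrite /be; field.
  by rewrite cosB /F; ring.
rewrite (eq_Int FE) IntZ; last exact: integ_affine.
rewrite (Int_affine b sn0 iF) gtr0_norm// mulrA divff// mul1r /F IntD; last 2 first.
- by apply: integZ; exact: integ_fcos.
- by apply: integZ; exact: integ_fsin.
by rewrite !IntZ//; [exact: integ_fsin|exact: integ_fcos].
Qed.

Lemma fsin_dilate (g : R -> R) (xi : R) : integ g -> fsin (fun x => s * g (s * x + b)) xi =
  cos (2 * pi * b * (xi / s)) * fsin g (xi / s) - sin (2 * pi * b * (xi / s)) * fcos g (xi / s).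
Proof.
move=> ig; rewrite /fcos /fsin; set be := 2 * pi * b * (xi / s).
pose F z := cos be * (g z * sin (2 * pi * z * (xi / s))) - sin be * (g z * cos (2 * pi * z * (xi / s))).
have iF : integ F by apply: integB; apply: integZ; [exact: integ_fsin|exact: integ_fcos].
have FE x : s * g (s * x + b) * sin (2 * pi * x * xi) = s * F (s * x + b).
  have -> : 2 * pi * x * xi = 2 * pi * (s * x + b) * (xi / s) - be by rewrite /be; field.
  by rewrite sinB /F; ring.
rewrite (eq_Int FE) IntZ; last exact: integ_affine.
rewrite (Int_affine b sn0 iF) gtr0_norm// mulrA divff// mul1r /F IntB; last 2 first.
- by apply: integZ; exact: integ_fsin.
- by apply: integZ; exact: integ_fcos.
by rewrite !IntZ//; [exact: integ_fcos|exact: integ_fsin].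
Qed.

End Dilate.

(** Both functions have the same Fourier transform; their difference is continuous, bounded and
    integrable, so it vanishes at every point and not only almost everywhere. *)
Lemma dilate_unique (Phi Phi' : R -> R[i]) (L : nat) (M : int) (m : nat) (j : int) :
  schwartz Phi -> is_shifted_dilate Phi L M m j Phi' ->
  let s := sc (L%:Z * j + M) in
  (forall x, complex.Re (Phi' x) = s * complex.Re (Phi (s * x + 2 ^+ m))) /\
  (forall x, complex.Im (Phi' x) = s * complex.Im (Phi (s * x + 2 ^+ m))).
Proof.
move=> sPhi [sPhi' hF] s.
have s0 : 0 < s by exact: sc_gt0.
have [d1 [C1 C10 h1] _] := schwartz_rapid sPhi (or_introl erefl).
have [d2 [C2 C20 h2] _] := schwartz_rapid sPhi (or_intror erefl).
have [e1 [D1 D10 k1] _] := schwartz_rapid sPhi' (or_introl erefl).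
have [e2 [D2 D20 k2] _] := schwartz_rapid sPhi' (or_intror erefl).
pose P0 x := complex.Re (Phi x); pose Q0 x := complex.Im (Phi x).
pose P' x := complex.Re (Phi' x); pose Q' x := complex.Im (Phi' x).
have iP0 : integ P0 := rapid_integ (derivable_continuous d1) h1.
have iQ0 : integ Q0 := rapid_integ (derivable_continuous d2) h2.
have iP' : integ P' := rapid_integ (derivable_continuous e1) k1.
have iQ' : integ Q' := rapid_integ (derivable_continuous e2) k2.
pose P x := s * P0 (s * x + 2 ^+ m); pose Q x := s * Q0 (s * x + 2 ^+ m).
have iP : integ P by exact: integ_dilate.
have iQ : integ Q by exact: integ_dilate.
pose h x := P' x - P x; pose k x := Q' x - Q x.
have ih : integ h by exact: integB.
have ik : integ k by exact: integB.
have fcB f g xi : integ f -> integ g -> fcos (fun x => f x - g x) xi = fcos f xi - fcos g xi.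
  move=> if_ ig; rewrite /fcos -IntB; [|exact: integ_fcos..].
  by apply: eq_Int => x; rewrite mulrBl.
have fsB f g xi : integ f -> integ g -> fsin (fun x => f x - g x) xi = fsin f xi - fsin g xi.
  move=> if_ ig; rewrite /fsin -IntB; [|exact: integ_fsin..].
  by apply: eq_Int => x; rewrite mulrBl.
have fcN f xi : fcos f (- xi) = fcos f xi.
  by apply: eq_Int => x; rewrite mulrN cosN.
have fsN f xi : integ f -> fsin f (- xi) = - fsin f xi.
  move=> if_; rewrite /fsin -[RHS]mulN1r -IntZ; last exact: integ_fsin.
  by apply: eq_Int => x; rewrite mulrN sinN mulrN mulN1r.
have key xi : fcos h xi + fsin k xi = 0 /\ fcos k xi - fsin h xi = 0.
  have := hF xi; rewrite /= -/s.
  rewrite (fourierE xi (P := P') (Q := Q'))// (fourierE (xi / s) (P := P0) (Q := Q0))//.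
  rewrite /expi => -[]; rewrite /h /k !fcB// !fsB// /P /Q.
  rewrite !fcos_dilate// !fsin_dilate// -[2 ^ (L%:Z * j + M)]/s => E1 E2.
  by split; [move: E1|move: E2]; lra.
(* Passing to -xi flips the sign of the sine transforms only, which separates the four transforms
   coupled in [key]. *)
have z xi : [/\ fcos h xi = 0, fsin h xi = 0, fcos k xi = 0 & fsin k xi = 0].
  have [a1 a2] := key xi; have [a3 a4] := key (- xi).
  rewrite !fcN !fsN// in a3 a4.
  by split; lra.
have tc t x : 2 * pi * x * (t / (2 * pi)) = t * x :> R.
  have : 2 * pi != 0 :> R by apply: lt0r_neq0; rewrite mulr_gt0 ?pi_gt0.
  by move: (2 * pi) => q q0; field.
have bnd C (g : R -> R) : 0 < C -> (forall x, `|g x| <= C * th x ^+ 3) -> forall x, `|g x| <= C.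
  move=> C0 hg x; apply: (le_trans (hg x)); rewrite ler_piMr ?(ltW C0)//.
  by rewrite exprn_ile1 ?th_ge0 ?th_le1.
have cdil (g : R -> R) : continuous g -> continuous (fun x => s * g (s * x + 2 ^+ m)).
  move=> cg x; apply: cvgM; first exact: cvg_cst.
  apply: (@continuous_comp _ _ _ (fun x => s * x + 2 ^+ m) g); last exact: cg.
  by apply: cvgD; [apply: cvgM; [exact: cvg_cst|exact: cvg_id]|exact: cvg_cst].
have fin (g : R -> R) B : continuous g -> (forall x, `|g x| <= B) -> integ g ->
   (forall xi, fcos g xi = 0) -> (forall xi, fsin g xi = 0) -> forall x, g x = 0.
  move=> cg gB ig gc gs; apply: (fourier_injective cg gB ig) => t.
    by rewrite -[RHS](gc (t / (2 * pi))); apply: eq_Int => x; rewrite tc.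
  by rewrite -[RHS](gs (t / (2 * pi))); apply: eq_Int => x; rewrite tc.
split=> x; apply/eqP; rewrite -subr_eq0; apply/eqP.
  apply: (fin h (D1 + s * C1)).
  - move=> y; apply: cvgB; first exact: (derivable_continuous e1).
    exact: (cdil P0 (derivable_continuous d1)).
  - move=> y; rewrite (le_trans (ler_normB _ _))//; apply: lerD; first exact: bnd k1 y.
    by rewrite normrM gtr0_norm// ler_wpM2l ?(ltW s0)//; exact: bnd h1 _.
  - exact: ih.
  - by move=> xi; case: (z xi).
  - by move=> xi; case: (z xi).
apply: (fin k (D2 + s * C2)).
- move=> y; apply: cvgB; first exact: (derivable_continuous e2).
  exact: (cdil Q0 (derivable_continuous d2)).
- move=> y; rewrite (le_trans (ler_normB _ _))//; apply: lerD; first exact: bnd k2 y.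
  by rewrite normrM gtr0_norm// ler_wpM2l ?(ltW s0)//; exact: bnd h2 _.
- exact: ik.
- by move=> xi; case: (z xi).
- by move=> xi; case: (z xi).
Qed.

End Schwartz.

(** * Step functions above the square function, and reduction to real functions *)

Section Majorant.
Variable R : realType.
Local Notation sc := (pow2 R).
Local Open Scope complex_scope.
#[local] Hint Extern 0 (is_true (0 < sc _)) => exact: sc_gt0 : core.
#[local] Hint Extern 0 (is_true (sc _ != 0)) => exact: sc_neq0 : core.

(** The supremum need not be attained, so a point with more than a quarter of it is taken; when the
    supremum is 0, [x0] serves. *)
Lemma near_sup (D : R -> bool) (N : R -> R) x0 B : D x0 -> (forall x, 0 <= N x) ->
  (forall x, N x <= B) -> exists2 x, D x & forall y, D y -> N y <= 4 * N x.
Proof.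
move=> D0 N0 NB; pose E := [set N x | x in [set x | D x]].
have hE : has_sup E.
  by split; [exists (N x0); exists x0|exists B => _ [x _ <-]].
have ub y : D y -> N y <= sup E by move=> Dy; apply: ub_le_sup; [exact: hE.2|exists y].
have [s0|s0] := leP (sup E) 0.
  exists x0 => // y Dy; apply: (le_trans (ub y Dy)); apply: (le_trans s0).
  by rewrite mulr_ge0.
have e0 : 0 < 3 / 4 * sup E by rewrite mulr_gt0// divr_gt0.
have [_ [x Dx <-] hx] := sup_adherent e0 hE.
by exists x => // y Dy; apply: (le_trans (ub y Dy)); lra.
Qed.

Definition square_const (C q : R) : R :=
  piece_const C * (3 * Int (@th R)) * (piece_const C * 4 * (3 * Int (@th R))) * weight_const q.

Lemma square_const_ge0 (C q : R) : 0 < C -> 1 < q -> 0 <= square_const C q.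
Proof.
move=> C0 q1; have c0 := ltW (piece_const_gt0 C0); have I0 := ltW (Int_th_gt0 R).
apply: mulr_ge0; last exact: weight_const_ge0.
have i3 : 0 <= 3 * Int (@th R) by apply: mulr_ge0; first exact: ler0n.
apply: mulr_ge0; first exact: mulr_ge0.
by apply: mulr_ge0 => //; apply: mulr_ge0; last exact: ler0n.
Qed.

Section Fixed.
Variables (p q C : R) (P Q f1 f2 : R -> R) (m : nat) (F : R).
Hypotheses (p2 : 2 < p) (q1 : 1 < q) (pq : (p / 2)^-1 + q^-1 = 1) (C0 : 0 < C) (m1 : (0 < m)%N).
Hypotheses (molP : molecule C P) (molQ : molecule C Q).
Hypotheses (mf1 : measurable_fun setT f1) (mf2 : measurable_fun setT f2).
Hypotheses (if1 : integ (fun x => `|f1 x| `^ p)) (if2 : integ (fun x => `|f2 x| `^ p)).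
Hypothesis F1 : Int (fun x => `|f1 x| `^ p) `^ (p / 2)^-1 <= F.
Hypothesis F2 : Int (fun x => `|f2 x| `^ p) `^ (p / 2)^-1 <= F.

(** Squared modulus of the complex convolution for f = f1 + i f2 and Phi = P + i Q, written in the
    real convolutions to which the estimates above apply. *)
Definition conv_sqr k x : R :=
  (cv f1 P m k x - cv f2 Q m k x) ^+ 2 + (cv f1 Q m k x + cv f2 P m k x) ^+ 2.

Lemma molecule_th (Psi : R -> R) : molecule C Psi ->
  measurable_fun setT Psi /\ forall z, `|Psi z| <= C * th z.
Proof.
case=> mPsi h _ _; split => // z; apply: (le_trans (h z)); apply: ler_wpM2l; first exact: ltW.
by rewrite exprS ler_piMr ?th_ge0// exprn_ile1 ?th_ge0 ?th_le1.
Qed.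

Lemma conv_sqr_ge0 k x : 0 <= conv_sqr k x.
Proof. by rewrite addr_ge0 ?sqr_ge0. Qed.

Lemma conv_sqr_le k x : conv_sqr k x <= 2 * (cv f1 P m k x ^+ 2 + cv f2 Q m k x ^+ 2 +
   (cv f1 Q m k x ^+ 2 + cv f2 P m k x ^+ 2)).
Proof.
rewrite /conv_sqr mulrDr; apply: lerD.
  by have := sqr_ge0 (cv f1 P m k x + cv f2 Q m k x); rewrite sqrrB sqrrD; lra.
by have := sqr_ge0 (cv f1 Q m k x - cv f2 P m k x); rewrite sqrrB sqrrD; lra.
Qed.

Lemma conv_sqr_bounded k : exists B, forall x, conv_sqr k x <= B.
Proof.
have [mP hP] := molecule_th molP; have [mQ hQ] := molecule_th molQ.
have [B1 b1] := cv_bounded p2 mf1 if1 m k mP hP.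
have [B2 b2] := cv_bounded p2 mf2 if2 m k mQ hQ.
have [B3 b3] := cv_bounded p2 mf1 if1 m k mQ hQ.
have [B4 b4] := cv_bounded p2 mf2 if2 m k mP hP.
exists (2 * (B1 ^+ 2 + B2 ^+ 2 + (B3 ^+ 2 + B4 ^+ 2))) => x; apply: (le_trans (conv_sqr_le k x)).
have sq (a B : R) : `|a| <= B -> a ^+ 2 <= B ^+ 2.
  move=> h; rewrite -[leLHS]real_normK ?num_real// lerXn2r ?nnegrE//.
  exact: le_trans h.
by apply: ler_wpM2l => //; apply: lerD; apply: lerD; exact: sq.
Qed.

(* On each dyadic interval, four times the value at a nearly maximal point dominates
   the square of the convolution; this replaces the square function by a step
   function. *)
Lemma majorant_exists : exists b : int * int -> R,
  [/\ forall I, 0 <= b I, forall I x, dyb I x -> conv_sqr I.1 x <= b I &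
    forall ks ns, uniq ks -> uniq ns ->
      integ (fun x => (\sum_(I <- box ks ns) b I * ib (dyb I x)) `^ (p / 2)) /\
      Int (fun x => (\sum_(I <- box ks ns) b I * ib (dyb I x)) `^ (p / 2)) <=
        (32 * square_const C q * m%:R * F) `^ (p / 2)].
Proof.
have F0 : 0 <= F by apply: le_trans F1; exact: powR_ge0.
have [pt ptP] : {pt : int * int -> R & forall I, dyb I (pt I) /\
    forall y, dyb I y -> conv_sqr I.1 y <= 4 * conv_sqr I.1 (pt I)}.
  apply: (@choice _ _ (fun I x => dyb I x /\ forall y, dyb I y -> conv_sqr I.1 y <= 4 * conv_sqr I.1 x)) => I.
  have [B hB] := conv_sqr_bounded I.1.
  have [x h1 h2] := near_sup (dy_inhab R I) (conv_sqr_ge0 I.1) hB.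
  by exists x.
have ptd I : dyb I (pt I) by case: (ptP I).
exists (fun I => 4 * conv_sqr I.1 (pt I)); split.
- by move=> I; rewrite mulr_ge0// conv_sqr_ge0.
- by move=> I x Ix; case: (ptP I) => _; exact.
move=> ks ns uk un.
have q0 : 0 < q by exact: lt_trans q1.
have sc0 := square_const_ge0 C0 q1.
have m0 : 0 <= m%:R :> R by exact: ler0n.
apply: (duality (q := q)) => //.
- by rewrite ltr_pdivlMr// mul1r.
- by move=> I; rewrite mulr_ge0// conv_sqr_ge0.
- apply: mulr_ge0 => //; apply: mulr_ge0 => //; apply: mulr_ge0 => //; exact: ler0n.
move=> w w0 iw iwq; set wn := _ `^ q^-1.
have wn0 : 0 <= wn by exact: powR_ge0.
have W0 I : 0 <= Int (fun x => w x * ib (dyb I x)) by apply: Int_ge0 => x; rewrite mulr_ge0.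
have one (f Psi : R -> R) : measurable_fun setT f -> integ (fun x => `|f x| `^ p) ->
    Int (fun x => `|f x| `^ p) `^ (p / 2)^-1 <= F -> molecule C Psi ->
    \sum_(I <- box ks ns) cv f Psi m I.1 (pt I) ^+ 2 * Int (fun x => w x * ib (dyb I x)) <=
    square_const C q * m%:R * (F * wn).
  move=> mf if_ hF mol.
  have := square_weighted p2 q1 pq mol C0 m1 mf if_ w0 iw iwq uk un ptd.
  rewrite -/wn => h; apply: (le_trans h).
  have re (a t n c x y : R) : a * t * (a * (4 * n) * t) * c * (x * y) = (a * t * (a * 4 * t) * c) * n * (x * y).
    by ring.
  rewrite re -/(square_const C q).
  by apply: ler_wpM2l; [exact: mulr_ge0|exact: ler_wpM2r].
have h11 := one f1 P mf1 if1 F1 molP; have h12 := one f1 Q mf1 if1 F1 molQ.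
have h21 := one f2 P mf2 if2 F2 molP; have h22 := one f2 Q mf2 if2 F2 molQ.
(* 8 = 4 * 2: the factor 4 of the nearly maximal point and the factor 2 of [conv_sqr_le]. The four
   real convolutions then make it 32. *)
apply: le_trans (_ : \sum_(I <- box ks ns) 8 * ((cv f1 P m I.1 (pt I) ^+ 2 * Int (fun x => w x * ib (dyb I x)) +
   cv f2 Q m I.1 (pt I) ^+ 2 * Int (fun x => w x * ib (dyb I x))) +
   (cv f1 Q m I.1 (pt I) ^+ 2 * Int (fun x => w x * ib (dyb I x)) +
   cv f2 P m I.1 (pt I) ^+ 2 * Int (fun x => w x * ib (dyb I x)))) <= _).
  apply: ler_sum => I _; rewrite -!mulrDl mulrA; apply: ler_wpM2r => //.
  by have := conv_sqr_le I.1 (pt I); lra.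
rewrite -mulr_sumr !big_split /=.
have -> : 32 * square_const C q * m%:R * F * wn = 8 * (4 * (square_const C q * m%:R * (F * wn))).
  by move: (square_const C q) (m%:R : R) => a b; ring.
apply: ler_wpM2l => //.
move: h11 h12 h21 h22.
move: (square_const C q * m%:R * (F * wn)) => X; lra.
Qed.

End Fixed.

Definition win (n : nat) : seq int := [seq i%:Z - n%:Z | i <- iota 0 n.*2.+1].

Lemma uniq_win n : uniq (win n).
Proof. by rewrite map_inj_uniq ?iota_uniq// => i j /addIr[]. Qed.

Lemma mem_win n (j : int) : (j \in win n) = (`|j| <= n)%N.
Proof.
apply/mapP/idP => [[i hi ->]|h]; first by move: hi; rewrite mem_iota; lia.
by exists (absz (j + n%:Z)); [rewrite mem_iota; lia|lia].
Qed.

Lemma sub_sum (T : eqType) (s t : seq T) (b : T -> R) : uniq s -> uniq t ->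
  {subset s <= t} -> (forall i, 0 <= b i) -> \sum_(i <- s) b i <= \sum_(i <- t) b i.
Proof.
move=> us ut st b0.
have pm : perm_eq s [seq i <- t | i \in s].
  apply: uniq_perm => //; first exact: filter_uniq.
  by move=> i; rewrite mem_filter andb_idr// => /st.
rewrite (perm_big _ pm) /= big_filter big_mkcond /=; apply: ler_sum => i _.
by case: ifP.
Qed.

Lemma box_subset ks ns ks' ns' : {subset ks <= ks'} -> {subset ns <= ns'} ->
  {subset box ks ns <= box ks' ns'}.
Proof.
move=> h1 h2 I /allpairsP[[k n] [/= /h1 hk /h2 hn ->]].
by apply/allpairsP; exists (k, n).
Qed.

Lemma uniq_box ks ns : uniq ks -> uniq ns -> uniq (box ks ns).
Proof. by move=> uk un; apply: allpairs_uniq => // -[a b] [c d] _ _ /= [-> ->]. Qed.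

Lemma win_subset n n' : (n <= n')%N -> {subset win n <= win n'}.
Proof. by move=> h j; rewrite !mem_win => /leq_trans; apply. Qed.

Definition stepsum (b : int * int -> R) (n : nat) (x : R) : R :=
  \sum_(I <- box (win n) (win n)) b I * ib (dyb I x).

Lemma stepsum_ge0 b n x : (forall I, 0 <= b I) -> 0 <= stepsum b n x.
Proof. by move=> b0; apply: sumr_ge0 => I _; rewrite mulr_ge0. Qed.

Lemma stepsum_le b n n' x : (forall I, 0 <= b I) -> (n <= n')%N -> stepsum b n x <= stepsum b n' x.
Proof.
move=> b0 nn; apply: sub_sum; [exact/uniq_box/uniq_win/uniq_win..| |].
  by apply: box_subset; exact: win_subset.
by move=> I; rewrite mulr_ge0.
Qed.

Lemma measurable_stepsum b n : measurable_fun setT (stepsum b n).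
Proof.
apply: measurable_sum => I; apply: measurable_funM => //.
by apply: measurable_bR; exact: measurable_dyb.
Qed.

(** At scale k only the interval of index floor(2^k x) contains x. Finitely many scales involve
    finitely many such intervals, and a large box contains them all; its size depends on x. *)
Lemma scales_le (b : int * int -> R) (N : int -> R -> R) x (ks : seq int) : uniq ks ->
  (forall I, 0 <= b I) -> (forall I, dyb I x -> N I.1 x <= b I) ->
  exists n0, forall n, (n0 <= n)%N -> \sum_(k <- ks) N k x <= stepsum b n x.
Proof.
move=> uk b0 hN; pose fl k := Num.floor (sc k * x).
have fld k : dyb (k, fl k) x.
  by apply/andP; split => /=; [exact: floor_le|have := floorD1_gt (sc k * x); rewrite intrD].
have [n0 hn0] : exists n0 : nat, forall k, k \in ks -> (`|k| <= n0)%N /\ (`|fl k| <= n0)%N.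
  elim: (ks) => [|k s [n ih]]; first by exists 0%N.
  exists (maxn n (maxn `|k| `|fl k|)) => j; rewrite inE => /predU1P[->|/ih[h1 h2]]; lia.
exists n0 => n nn.
apply: le_trans (_ : \sum_(I <- [seq (k, fl k) | k <- ks]) b I * ib (dyb I x) <= _).
  rewrite big_map; apply: ler_sum => k _; rewrite fld mulr1; exact: hN (fld k).
apply: sub_sum.
- by rewrite map_inj_uniq// => k l [].
- by apply: uniq_box; exact: uniq_win.
- move=> I /mapP[k /hn0[h1 h2] ->]; apply/allpairsP; exists (k, fl k).
  by rewrite /= !mem_win; split => //; lia.
- by move=> I; rewrite mulr_ge0.
Qed.

Lemma convol_parts (f Phi Phi' : R -> R[i]) (p C : R) (m : nat) (k : int) x : 2 < p -> 0 < C ->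
  let P y := complex.Re (Phi y) in let Q y := complex.Im (Phi y) in
  let f1 y := complex.Re (f y) in let f2 y := complex.Im (f y) in
  molecule C P -> molecule C Q -> measurable_fun setT f1 -> measurable_fun setT f2 ->
  integ (fun y => `|f1 y| `^ p) -> integ (fun y => `|f2 y| `^ p) ->
  (forall y, complex.Re (Phi' y) = sc k * P (sc k * y + 2 ^+ m)) ->
  (forall y, complex.Im (Phi' y) = sc k * Q (sc k * y + 2 ^+ m)) ->
  cabs (convol f Phi' x) ^+ 2 = conv_sqr P Q f1 f2 m k x.
Proof.
move=> p2 C0 P Q f1 f2 molP molQ mf1 mf2 if1 if2 hP hQ.
have [mP tP] := molecule_th C0 molP; have [mQ tQ] := molecule_th C0 molQ.
have ic (g h : R -> R) : measurable_fun setT g -> integ (fun y => `|g y| `^ p) ->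
    measurable_fun setT h -> (forall z, `|h z| <= C * th z) ->
    integ (fun y => g y * (sc k * h (sc k * (x - y) + 2 ^+ m))).
  move=> mg ig mh th_; have := integZ (sc k) (integ_conv p2 mg ig k x (2 ^+ m) mh th_).
  by apply: eq_integ => y; rewrite mulrCA.
rewrite cabs_sqr /conv_sqr /cv; congr (_ ^+ 2 + _ ^+ 2); rewrite /convol /cintegral /=.
  rewrite -IntB; [|exact: ic..].
  have e y : complex.Re (f y * Phi' (x - y)) = f1 y * (sc k * P (sc k * (x - y) + 2 ^+ m)) -
     f2 y * (sc k * Q (sc k * (x - y) + 2 ^+ m)) by rewrite -hP -hQ; exact: Re_mul.
  exact: (eq_Int e).
rewrite -IntD; [|exact: ic..].
have e y : complex.Im (f y * Phi' (x - y)) = f1 y * (sc k * Q (sc k * (x - y) + 2 ^+ m)) +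
     f2 y * (sc k * P (sc k * (x - y) + 2 ^+ m)) by rewrite -hP -hQ; exact: Im_mul.
exact: (eq_Int e).
Qed.

Lemma measurable_cabs (f : R -> R[i]) : measurable_fun setT (fun x => complex.Re (f x)) ->
  measurable_fun setT (fun x => complex.Im (f x)) -> measurable_fun setT (fun x => cabs (f x)).
Proof.
move=> m1 m2.
have -> : (fun x => cabs (f x)) = (fun x => (complex.Re (f x) ^+ 2 + complex.Im (f x) ^+ 2) `^ 2^-1).
  apply/funext => x; rewrite -cabs_sqr -powR_mulrn ?cabs_ge0// -powRrM mulfV ?powRr1 ?cabs_ge0//.
apply: (measurableT_comp (measurable_powR _)).
by apply: measurable_funD; apply: measurable_funX.
Qed.

Lemma cLnormE p (f : R -> R[i]) : 0 < p -> integ (fun x => cabs (f x) `^ p) ->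
  cLnorm p f = (Int (fun x => cabs (f x) `^ p) `^ p^-1)%:E.
Proof.
move=> p0 i; rewrite /cLnorm unlock /=; set X := integral _ _ _.
have -> : X = (Int (fun x => cabs (f x) `^ p))%:E.
  rewrite -(EFin_Int i); apply: eq_integral => x _; rewrite /= ger0_norm ?cabs_ge0//.
by rewrite poweR_EFin.
Qed.

Lemma in_Lp_parts p (f : R -> R[i]) : 2 < p -> in_Lp p f ->
  [/\ measurable_fun setT (fun x => complex.Re (f x)), measurable_fun setT (fun x => complex.Im (f x)),
      integ (fun x => cabs (f x) `^ p), integ (fun x => `|complex.Re (f x)| `^ p) &
      integ (fun x => `|complex.Im (f x)| `^ p)].
Proof.
move=> p2 [m1 m2 hp].
have p0 : 0 < p by exact: lt_trans p2.
have mc := measurable_cabs m1 m2.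
have mcp : measurable_fun setT (fun x => cabs (f x) `^ p) := measurableT_comp (measurable_powR _) mc.
have ic : integ (fun x => cabs (f x) `^ p).
  apply/integrableP; split; first exact/measurable_EFinP.
  move: hp; rewrite /cLnorm unlock /=.
  set X := (X in (X `^ _ < _)%E -> _).
  rewrite (_ : integral _ _ _ = X); last first.
    by apply: eq_integral => x _; rewrite /= !ger0_norm ?powR_ge0 ?cabs_ge0.
  have X0 : (0 <= X)%E by apply: integral_ge0 => x _; by rewrite lee_fin powR_ge0.
  case: X X0 => //= [r _ _|_]; first by rewrite ltry.
  by rewrite invr_eq0 gt_eqF.
have part (g : R -> R) : measurable_fun setT g -> (forall x, `|g x| <= cabs (f x)) ->
    integ (fun x => `|g x| `^ p).
  move=> mg hg; apply: integ_le ic.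
    apply: (measurableT_comp (measurable_powR _)); exact: measurableT_comp.
  move=> x; rewrite ger0_norm ?powR_ge0//.
  by apply: ge0_ler_powR; rewrite ?nnegrE ?cabs_ge0 ?(ltW p0)// hg.
split => //; apply: part => // x; [exact: Re_le_cabs|exact: Im_le_cabs].
Qed.

End Majorant.

(** * Convergence of the series, the envelope, and the product of the two factors *)

Section Assembly.
Variable R : realType.
Local Notation mu := (@lebesgue_measure R).
Local Open Scope complex_scope.

Lemma cabsM (z w : R[i]) : cabs (z * w) = cabs z * cabs w.
Proof. exact: ComplexField.Normc.normcM. Qed.

Lemma Re_sum (T : Type) (s : seq T) (a : T -> R[i]) :
  complex.Re (\sum_(i <- s) a i) = \sum_(i <- s) complex.Re (a i).
Proof. by apply: (big_morph (@complex.Re R)) => // -[? ?] [? ?]. Qed.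

Lemma Im_sum (T : Type) (s : seq T) (a : T -> R[i]) :
  complex.Im (\sum_(i <- s) a i) = \sum_(i <- s) complex.Im (a i).
Proof. by apply: (big_morph (@complex.Im R)) => // -[? ?] [? ?]. Qed.

Lemma sum_win (a : int -> R[i]) n :
  \sum_(k < n.*2.+1) a (k%:Z - n%:Z) = \sum_(j <- win n) a j.
Proof. by rewrite big_map -[iota _ _]/(index_iota 0 n.*2.+1) big_mkord. Qed.

(** Convergence has to come first, since [limn] of a divergent sequence is a default value. The
    partial sums of [|u| + u] and of [|u|] are nondecreasing and bounded, so their difference
    converges. *)
Lemma win_cvg (u : int -> R) (B : R) :
  (forall s, uniq s -> \sum_(j <- s) `|u j| <= B) ->
  `|limn (fun n => \sum_(j <- win n) u j)| <= B.
Proof.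
move=> hB.
have cv (w : int -> R) : (forall j, 0 <= w j <= 2 * `|u j|) ->
    cvgn (fun n => \sum_(j <- win n) w j).
  move=> hw; apply: nondecreasing_is_cvgn.
    move=> n n' nn; apply: sub_sum; [exact: uniq_win|exact: uniq_win|exact: win_subset|].
    by move=> j; case/andP: (hw j).
  exists (2 * B) => _ [n _ <-]; apply: (@le_trans _ _ (2 * \sum_(j <- win n) `|u j|)).
    by rewrite mulr_sumr; apply: ler_sum => j _; case/andP: (hw j).
  by apply: ler_wpM2l => //; apply: hB; exact: uniq_win.
have c1 : cvgn (fun n => \sum_(j <- win n) (`|u j| + u j)).
  by apply: cv => j; have := ler_norm (u j); have := ler_norm (- u j); rewrite normrN; lra.
have c2 : cvgn (fun n => \sum_(j <- win n) `|u j|).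
  by apply: cv => j; have := normr_ge0 (u j); lra.
have c : cvgn (fun n => \sum_(j <- win n) u j).
  have -> : (fun n => \sum_(j <- win n) u j) =
     (fun n => \sum_(j <- win n) (`|u j| + u j) - \sum_(j <- win n) `|u j|).
    by apply/funext => n; rewrite -sumrB; apply: eq_bigr => j _; ring.
  exact: (is_cvgB c1 c2).
have hb n : `|\sum_(j <- win n) u j| <= B.
  by apply: le_trans (hB _ (uniq_win n)); exact: ler_norm_sum.
rewrite ler_norml; apply/andP; split.
  by apply: limr_ge => //; apply: nearW => n; have := hb n; rewrite ler_norml => /andP[].
by apply: limr_le => //; apply: nearW => n; have := hb n; rewrite ler_norml => /andP[].
Qed.

Lemma sumZ_le (a : int -> R[i]) (B : R) :
  (forall s, uniq s -> \sum_(j <- s) cabs (a j) <= B) ->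
  abs_summable a /\ cabs (sumZ a) <= 2 * B.
Proof.
move=> hB; split.
  apply: le_lt_trans (ltry B); apply: ge_ereal_sup => _ [A [finA _] <-].
  rewrite fsbig_finite//= .
  rewrite (eq_bigr (fun j => (cabs (a j))%:E)); last first.
    by move=> j _; rewrite ger0_norm ?cabs_ge0.
  by rewrite sumEFin lee_fin; apply: hB; exact: finmap.fset_uniq.
(* The factor 2 arises because real and imaginary parts are bounded separately. *)
apply: (le_trans (cabs_le _)) => /=; rewrite mulr_natl mulr2n; apply: lerD.
  under eq_fun do rewrite sum_win Re_sum.
  apply: win_cvg => s /hB; apply: le_trans; apply: ler_sum => j _; exact: Re_le_cabs.
under eq_fun do rewrite sum_win Im_sum.
apply: win_cvg => s /hB; apply: le_trans; apply: ler_sum => j _; exact: Im_le_cabs.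
Qed.

(* The integral of a nonnegative function is a supremum over the simple functions
   below it. This spares proving that [Pi_op] is measurable. *)
Lemma le_integral_nonmeasurable (f g : R -> \bar R) : (forall x, 0 <= f x)%E ->
  (forall x, f x <= g x)%E -> (\int[mu]_x f x <= \int[mu]_x g x)%E.
Proof.
move=> f0 fg; have g0 x : (0 <= g x)%E by exact: le_trans (fg x).
rewrite !ge0_integralTE//; apply: ereal_sup_le => _ [h hf <-]; exists h => // x.
exact: le_trans (hf x) (fg x).
Qed.

(** [H] is a measurable function to compare the bilinear series with. Its integral is finite, so it
    is finite almost everywhere, and at such points the series will converge absolutely. *)
Lemma monotone_envelope (h : nat -> R -> R) (B : R) : (forall n, integ (h n)) ->
  (forall n x, 0 <= h n x) -> (forall n n' x, (n <= n')%N -> h n x <= h n' x) ->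
  (forall n, Int (h n) <= B) ->
  exists H : R -> \bar R, [/\ measurable_fun setT H, forall x n, ((h n x)%:E <= H x)%E,
     (\int[mu]_x H x <= B%:E)%E & {ae mu, forall x, H x \is a fin_num}].
Proof.
move=> ih h0 hn hB.
have nd x : nondecreasing_seq (fun n => (h n x)%:E) by move=> n n' nn; rewrite lee_fin hn.
have mh n : measurable_fun setT (EFin \o h n) by exact: measurable_int (ih n).
pose H : R -> \bar R := fun x => limn (fun n => (h n x)%:E).
have cvH x : (fun n => (h n x)%:E) @ \oo --> H x by exact: ereal_nondecreasing_is_cvgn.
have mH : measurable_fun setT H.
  by apply: (emeasurable_fun_cvg (fun n => EFin \o h n)) => // x _; exact: cvH.
have leH x n : ((h n x)%:E <= H x)%E.
  by apply: lime_ge; [exact: cvH|near=> k; apply: nd; near: k; exists n].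
have H0 x : (0 <= H x)%E by apply: le_trans (leH x 0%N); rewrite lee_fin.
have IH : (\int[mu]_x H x <= B%:E)%E.
  rewrite /H (@monotone_convergence _ _ _ mu setT _ (fun n => EFin \o h n))//; last 2 first.
  - by move=> n x _; rewrite lee_fin.
  - by move=> x _; exact: nd.
  apply: lime_le.
    apply: ereal_nondecreasing_is_cvgn => n n' nn; apply: ge0_le_integral => //.
    - by move=> x _; rewrite lee_fin.
    - exact: mh.
    - exact: mh.
    - by move=> x _; exact: nd.
  by apply: nearW => n; rewrite EFin_Int// lee_fin.
exists H; split => //.
have iH : mu.-integrable setT H.
  apply/integrableP; split => //; under eq_integral do rewrite gee0_abs//.
  exact: le_lt_trans IH (ltry _).
by apply: filterS (integrable_ae measurableT iH) => x; exact.
Unshelve. all: by end_near. Qed.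

(** [M] will be the value of the envelope at a point where it is finite. Cauchy-Schwarz in j then
    bounds all finite partial sums at once, which is the input of [sumZ_le]. *)
Lemma pair_sum_le (u v : int -> R) (s1 s2 : nat -> R) (r M : R) : 0 < r ->
  (forall n, 0 <= s1 n) -> (forall n, 0 <= s2 n) ->
  (forall s, uniq s -> exists n0, forall n, (n0 <= n)%N -> \sum_(j <- s) u j ^+ 2 <= s1 n) ->
  (forall s, uniq s -> exists n0, forall n, (n0 <= n)%N -> \sum_(j <- s) v j ^+ 2 <= s2 n) ->
  (forall n, (s1 n * s2 n) `^ (r / 2) <= M) ->
  forall s, uniq s -> \sum_(j <- s) u j * v j <= M `^ r^-1.
Proof.
move=> r0 s10 s20 h1 h2 hM s us.
have [n1 k1] := h1 s us; have [n2 k2] := h2 s us; set n := maxn n1 n2.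
have {}k1 := k1 n (leq_maxl _ _); have {}k2 := k2 n (leq_maxr _ _).
have sq0 (w : int -> R) : 0 <= \sum_(j <- s) w j ^+ 2 by apply: sumr_ge0 => j _; exact: sqr_ge0.
have ss0 : 0 <= s1 n * s2 n by rewrite mulr_ge0.
have e : ((s1 n * s2 n) `^ (r / 2)) `^ r^-1 = (s1 n * s2 n) `^ 2^-1.
  by rewrite -powRrM; congr (_ `^ _); field; rewrite gt_eqF.
apply: le_trans (_ : (s1 n * s2 n) `^ 2^-1 <= _); last first.
  rewrite -e; apply: ge0_ler_powR; rewrite ?invr_ge0 ?nnegrE ?powR_ge0 ?(ltW r0)//.
  exact: le_trans (powR_ge0 _ _) (hM n).
apply: (le_trans (ler_norm _)).
have sq2 : ((s1 n * s2 n) `^ 2^-1) ^+ 2 = s1 n * s2 n.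
  by rewrite -powR_mulrn ?powR_ge0// -powRrM mulVf// powRr1.
rewrite -ler_sqr ?nnegrE ?powR_ge0// real_normK ?num_real// sq2.
by apply: (le_trans (cauchy_schwarz s u v)); apply: ler_pM.
Qed.

(** For L > 0 the map j -> L j + M is injective, so the sum over j is part of the sum over all
    dyadic scales. This is why [K] is independent of L and M. *)
Lemma factor_majorant (Phi : R -> R[i]) (p : R) : is_mother Phi -> 2 < p ->
  exists2 K : R, 0 <= K & forall (L : nat) (M : int) (m : nat) (Phi' : int -> R -> R[i]) (f : R -> R[i]),
    (0 < L)%N -> (1 <= m)%N -> (forall j, is_shifted_dilate Phi L M m j (Phi' j)) -> in_Lp p f ->
    exists b : int * int -> R, [/\ forall I, 0 <= b I,
      forall x s, uniq s -> exists n0, forall n, (n0 <= n)%N ->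
        \sum_(j <- s) cabs (convol f (Phi' j) x) ^+ 2 <= stepsum b n x &
      forall n, integ (fun x => stepsum b n x `^ (p / 2)) /\
        Int (fun x => stepsum b n x `^ (p / 2)) <=
          (K * m%:R * Int (fun x => cabs (f x) `^ p) `^ (p / 2)^-1) `^ (p / 2)].
Proof.
move=> hPhi p2; have [C C0 [molP molQ]] := mother_molecule hPhi.
have p22 : 1 < p / 2 by rewrite ltr_pdivlMr// mul1r.
(* The exponent conjugate to [p / 2], finite since p > 2. *)
pose q := (p / 2) / (p / 2 - 1).
have d0 : 0 < p / 2 - 1 by rewrite subr_gt0.
have q1 : 1 < q by rewrite ltr_pdivlMr// mul1r ltrBlDr ltrDl.
have pq : (p / 2)^-1 + q^-1 = 1.
  by rewrite /q; move: (p / 2) p22 => a a1; rewrite invf_div mulrBl mul1r mulfV ?gt_eqF ?(lt_trans ltr01)// addrC subrK.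
have K0 := square_const_ge0 C0 q1.
exists (32 * square_const C q); first exact: mulr_ge0 (ler0n _ _) K0.
move=> L M m Phi' f L0 m1 hd hf.
have [mf1 mf2 ic if1 if2] := in_Lp_parts p2 hf.
pose P y := complex.Re (Phi y); pose Q y := complex.Im (Phi y).
pose f1 y := complex.Re (f y); pose f2 y := complex.Im (f y).
have p0 : 0 < p by exact: lt_trans p2.
have le (g : R -> R) : integ (fun x => `|g x| `^ p) -> (forall x, `|g x| <= cabs (f x)) ->
    Int (fun x => `|g x| `^ p) `^ (p / 2)^-1 <= Int (fun x => cabs (f x) `^ p) `^ (p / 2)^-1.
  move=> ig hg; apply: ge0_ler_powR; rewrite ?nnegrE ?Int_ge0//.
  - by rewrite invr_ge0 ltW// (lt_trans ltr01).
  - by move=> x; exact: powR_ge0.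
  apply: Int_le => // x; apply: ge0_ler_powR; rewrite ?nnegrE ?cabs_ge0 ?(ltW p0)//.
have [b [b0 hb hI]] := majorant_exists p2 q1 pq C0 m1 molP molQ mf1 mf2 if1 if2
   (le f1 if1 (fun x => Re_le_cabs _)) (le f2 if2 (fun x => Im_le_cabs _)).
exists b; split => //; last by move=> n; apply: hI; exact: uniq_win.
move=> x s us.
have us' : uniq [seq L%:Z * j + M | j <- s].
  rewrite map_inj_uniq; first exact: us.
  by move=> i j /addIr; apply: mulfI; rewrite eqz_nat -lt0n.
have [n0 hn0] := scales_le us' b0 (fun I => hb I x).
exists n0 => n /hn0; rewrite big_map; apply: le_trans; apply: ler_sum => j _.
have [dP dQ] := dilate_unique hPhi.1 (hd j).
by rewrite (convol_parts x p2 C0 molP molQ mf1 mf2 if1 if2 dP dQ).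
Qed.

Lemma holder_halves (S1 S2 : R -> R) (p1 p2 r B1 B2 : R) : 0 < p1 -> 0 < p2 -> 0 < r ->
  p1^-1 + p2^-1 = r^-1 -> measurable_fun setT S1 -> measurable_fun setT S2 ->
  (forall x, 0 <= S1 x) -> (forall x, 0 <= S2 x) -> 0 <= B1 -> 0 <= B2 ->
  integ (fun x => S1 x `^ (p1 / 2)) -> integ (fun x => S2 x `^ (p2 / 2)) ->
  Int (fun x => S1 x `^ (p1 / 2)) <= B1 `^ (p1 / 2) ->
  Int (fun x => S2 x `^ (p2 / 2)) <= B2 `^ (p2 / 2) ->
  integ (fun x => (S1 x * S2 x) `^ (r / 2)) /\
  Int (fun x => (S1 x * S2 x) `^ (r / 2)) <= (B1 * B2) `^ (r / 2).
Proof.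
move=> p10 p20 r0 hp mS1 mS2 S10 S20 B10 B20 i1 i2 h1 h2.
have ex p : 0 < p -> r / 2 * (p / r) = p / 2 by move=> p0; field; rewrite gt_eqF.
have pw p (S : R -> R) : 0 < p -> (fun x => (S x `^ (r / 2)) `^ (p / r)) =1 (fun x => S x `^ (p / 2)).
  by move=> p0 x; rewrite -powRrM ex.
have ipw p (S : R -> R) : 0 < p -> integ (fun x => S x `^ (p / 2)) ->
    integ (fun x => (S x `^ (r / 2)) `^ (p / r)).
  by move=> p0; apply: eq_integ => x; rewrite pw.
have eh : (p1 / r)^-1 + (p2 / r)^-1 = 1.
  by rewrite !invf_div -mulrDr hp mulfV// gt_eqF.
have [ih hh] := @holder _ (fun x => S1 x `^ (r / 2)) (fun x => S2 x `^ (r / 2)) (p1 / r) (p2 / r)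
  (divr_gt0 p10 r0) (divr_gt0 p20 r0)
  eh
  (measurableT_comp (measurable_powR _) mS1) (measurableT_comp (measurable_powR _) mS2)
  (fun x => powR_ge0 _ _) (fun x => powR_ge0 _ _)
  (ipw _ _ p10 i1) (ipw _ _ p20 i2).
have e x : S1 x `^ (r / 2) * S2 x `^ (r / 2) = (S1 x * S2 x) `^ (r / 2) by rewrite powRM.
split; first by apply: eq_integ ih => x; rewrite e.
rewrite -(eq_Int e); apply: (le_trans hh); rewrite powRM//.
have one p (S : R -> R) B : 0 < p -> 0 <= B -> Int (fun x => S x `^ (p / 2)) <= B `^ (p / 2) ->
    Int (fun x => (S x `^ (r / 2)) `^ (p / r)) `^ (p / r)^-1 <= B `^ (r / 2).
  move=> p0 B0 h; rewrite (eq_Int (pw p S p0)).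
  have -> : B `^ (r / 2) = (B `^ (p / 2)) `^ (p / r)^-1.
    by rewrite -powRrM; congr (_ `^ _); field; rewrite !gt_eqF.
  apply: ge0_ler_powR; rewrite ?nnegrE ?powR_ge0 ?invr_ge0 ?divr_ge0 ?(ltW p0) ?(ltW r0)//.
  by apply: Int_ge0 => x; exact: powR_ge0.
by apply: ler_pM; rewrite ?powR_ge0// one.
Qed.

End Assembly.

(** * The bilinear estimate *)

Section Main.
Variable R : realType.
Local Notation mu := (@lebesgue_measure R).

Lemma Pi_bound (Phi : R -> R[i]%C) (L1 L2 : nat) (p1 p2 r : R) : is_mother Phi ->
  (0 < L1)%N -> (0 < L2)%N -> 2 < p1 -> 2 < p2 -> 0 < r -> p1^-1 + p2^-1 = r^-1 ->
  exists C : R, forall (M1 M2 : int) (m : nat), (1 <= m)%N -> forall Phi1 Phi2 : int -> R -> R[i]%C,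
      (forall j, is_shifted_dilate Phi L1 M1 m j (Phi1 j)) ->
      (forall j, is_shifted_dilate Phi L2 M2 m j (Phi2 j)) ->
    forall f1 f2 : R -> R[i]%C, in_Lp p1 f1 -> in_Lp p2 f2 ->
      {ae mu, forall x, abs_summable (Pi_term Phi1 Phi2 f1 f2 x)} /\
      (cLnorm r (Pi_op Phi1 Phi2 f1 f2) <= (C * m%:R)%:E * cLnorm p1 f1 * cLnorm p2 f2)%E.
Proof.
move=> hPhi L10 L20 hp1 hp2 r0 hp.
have p10 : 0 < p1 by exact: lt_trans hp1.
have p20 : 0 < p2 by exact: lt_trans hp2.
have [K1 K10 h1] := factor_majorant hPhi hp1; have [K2 K20 h2] := factor_majorant hPhi hp2.
(* The 2 comes from [sumZ_le]; [K1] and [K2] enter through square roots because the step functions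
   dominate squares. *)
exists (2 * (K1 * K2) `^ 2^-1) => M1 M2 m m1 Phi1 Phi2 d1 d2 f1 f2 hf1 hf2.
have [b1 [b10 s1 i1]] := h1 L1 M1 m Phi1 f1 L10 m1 d1 hf1.
have [b2 [b20 s2 i2]] := h2 L2 M2 m Phi2 f2 L20 m1 d2 hf2.
have [_ _ if1 _ _] := in_Lp_parts hp1 hf1; have [_ _ if2 _ _] := in_Lp_parts hp2 hf2.
move: i1 i2 (cLnormE p10 if1) (cLnormE p20 if2).
have : 0 <= Int (fun x => cabs (f1 x) `^ p1) by apply: Int_ge0 => x; exact: powR_ge0.
have : 0 <= Int (fun x => cabs (f2 x) `^ p2) by apply: Int_ge0 => x; exact: powR_ge0.
move: (Int (fun x => cabs (f1 x) `^ p1)) (Int (fun x => cabs (f2 x) `^ p2)) => A1 A2 A20 A10 i1 i2 -> ->.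
have m0 : 0 <= m%:R :> R by exact: ler0n.
set B1 := K1 * m%:R * _ in i1; set B2 := K2 * m%:R * _ in i2.
have B10 : 0 <= B1 by rewrite !mulr_ge0 ?powR_ge0.
have B20 : 0 <= B2 by rewrite !mulr_ge0 ?powR_ge0.
pose h n x := (stepsum b1 n x * stepsum b2 n x) `^ (r / 2).
have hh n := holder_halves p10 p20 r0 hp (measurable_stepsum b1 n) (measurable_stepsum b2 n)
  (fun x => stepsum_ge0 n x b10) (fun x => stepsum_ge0 n x b20) B10 B20
  (i1 n).1 (i2 n).1 (i1 n).2 (i2 n).2.
have r20 : 0 <= r / 2 by rewrite divr_ge0// ltW.
have [H [mH leH IH aeH]] := @monotone_envelope R h ((B1 * B2) `^ (r / 2)) (fun n => (hh n).1)
  (fun n x => powR_ge0 _ _)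
  (fun n n' x nn => ge0_ler_powR r20 (mulr_ge0 (stepsum_ge0 n x b10) (stepsum_ge0 n x b20))
     (mulr_ge0 (stepsum_ge0 n' x b10) (stepsum_ge0 n' x b20))
     (ler_pM (stepsum_ge0 n x b10) (stepsum_ge0 n x b20) (stepsum_le x b10 nn) (stepsum_le x b20 nn)))
  (fun n => (hh n).2).
have pt x M : H x = M%:E -> abs_summable (Pi_term Phi1 Phi2 f1 f2 x) /\
    cabs (Pi_op Phi1 Phi2 f1 f2 x) <= 2 * M `^ r^-1.
  move=> HM; apply: sumZ_le => s us.
  under eq_bigr do rewrite cabsM.
  apply: (pair_sum_le r0 (fun n => stepsum_ge0 n x b10) (fun n => stepsum_ge0 n x b20) (s1 x) (s2 x)) => //.
  by move=> n; have := leH x n; rewrite HM lee_fin.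
split.
  move: aeH; apply: (@filterS _ _ (ae_filter_ringOfSetsType mu)) => x Hx.
  by have [] := pt x (fine (H x)) (esym (fineK Hx)).
have H0 x : (0 <= H x)%E by apply: le_trans (leH x 0%N); rewrite lee_fin powR_ge0.
have two0 : 0 < 2 `^ r :> R by exact: powR_gt0.
have lePi x : ((cabs (Pi_op Phi1 Phi2 f1 f2 x) `^ r)%:E <= (2 `^ r)%:E * H x)%E.
  (* Where [H x] is infinite the series may diverge and [Pi_op] may be a default value, but the
     right-hand side is then infinite. *)
  have := H0 x; case E : (H x) => [M| |//] M0; last by rewrite gt0_muley ?lte_fin// leey.
  have [_ hM] := pt x M E; rewrite lee_fin in M0.
  have eM : (2 * M `^ r^-1) `^ r = 2 `^ r * M.
    by rewrite powRM ?powR_ge0// -powRrM mulVf ?gt_eqF// powRr1.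
  rewrite -EFinM lee_fin -eM.
  by apply: ge0_ler_powR; rewrite ?nnegrE ?cabs_ge0 ?mulr_ge0 ?powR_ge0 ?(ltW r0).
move: (Pi_op Phi1 Phi2 f1 f2) lePi => g lePi; rewrite /cLnorm unlock /=.
apply: le_trans (_ : (((2 `^ r)%:E * ((B1 * B2) `^ (r / 2))%:E) `^ r^-1)%E <= _)%E.
  apply: gt0_ler_poweR; rewrite ?invr_ge0 ?(ltW r0)//.
  - by rewrite in_itv /= leey andbT; apply: integral_ge0 => x _; rewrite lee_fin powR_ge0.
  - by rewrite in_itv /= leey andbT -EFinM lee_fin mulr_ge0 ?powR_ge0.
  apply: le_trans (_ : (\int[mu]_x ((2 `^ r)%:E * H x) <= _)%E); last first.
    by rewrite ge0_integralZl_EFin ?(ltW two0)// lee_pmul2l ?lte_fin.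
  apply: le_integral_nonmeasurable => x; first by rewrite lee_fin powR_ge0.
  by rewrite ger0_norm ?cabs_ge0.
rewrite -EFinM poweR_EFin -!EFinM lee_fin le_eqVlt; apply/orP; left; apply/eqP.
have half (a b : R) : 0 <= a -> 0 <= b -> (a * b) `^ 2^-1 = a `^ 2^-1 * b `^ 2^-1 by exact: powRM.
have root (A p : R) : 0 < p -> (A `^ (p / 2)^-1) `^ 2^-1 = A `^ p^-1.
  by move=> p0; rewrite -powRrM; congr (_ `^ _); field; rewrite gt_eqF.
have m2 : m%:R `^ 2^-1 * m%:R `^ 2^-1 = m%:R :> R.
  by rewrite -powRM// -expr2 -powR_mulrn// -powRrM mulfV// powRr1.
have er : (B1 * B2) `^ (r / 2) `^ r^-1 = (B1 * B2) `^ 2^-1.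
  by rewrite -powRrM; congr (_ `^ _); field; rewrite gt_eqF.
have e2 : (2 `^ r) `^ r^-1 = 2 :> R by rewrite -powRrM mulfV ?powRr1// gt_eqF.
rewrite (powRM _ (powR_ge0 _ _) (powR_ge0 _ _)) er e2.
rewrite !half ?mulr_ge0 ?powR_ge0// !root// -{3}m2; ring.
Qed.
End Main.

Theorem corollary5p1 (R : realType) (Phi : R -> R[i]%C) (hPhi : is_mother Phi)
    (L1 L2 : nat) (hL1 : (0 < L1)%N) (hL2 : (0 < L2)%N)
    (p1 p2 r : R) (hp1 : 2 < p1) (hp2 : 2 < p2) (hr1 : 1 < r) (hr2 : r < 2)
    (hp : p1^-1 + p2^-1 = r^-1) :
  exists C : R,
    forall (M1 M2 : int) (m : nat), (1 <= m)%N ->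
    forall Phi1 Phi2 : int -> R -> R[i]%C,
      (forall j, is_shifted_dilate Phi L1 M1 m j (Phi1 j)) ->
      (forall j, is_shifted_dilate Phi L2 M2 m j (Phi2 j)) ->
    forall f1 f2 : R -> R[i]%C, in_Lp p1 f1 -> in_Lp p2 f2 ->
      {ae @lebesgue_measure R, forall x, abs_summable (Pi_term Phi1 Phi2 f1 f2 x)} /\
      (cLnorm r (Pi_op Phi1 Phi2 f1 f2)
        <= (C * m%:R)%:E * cLnorm p1 f1 * cLnorm p2 f2)%E.
Proof. exact: Pi_bound hPhi hL1 hL2 hp1 hp2 (lt_trans ltr01 hr1) hp. Qed.
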